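(* Let $G\subset\mathcal{D}iff^{1,\alpha}(S^1)$ be a subgroup, $\alpha>1/2$. Suppose that at least one of the following holds: 1) the natural unitary action of $G$ in $L^2_{\mathbb{C}}(S^1,d\theta)$ given by $$\pi(g)(f)(\varphi)=f(g^{-1}(\varphi))\cdot[(g^{-1}(\varphi))']^{1/2}$$ is irreducible or is a direct sum of finitely many irreducible factors; or 2) $G$ contains an element conjugate in $\mathcal{D}iff^{1,\alpha}(S^1)$ to a hyperbolic fractional-linear transformation; or 3) $G$ contains an element conjugate in $\mathcal{D}iff^{1,\alpha}(S^1)$ to a parabolic ($\neq1$) fractional-linear transformation; or 4) $$\sup_{g\in G}\iint_{S^1\times S^1}\left[\frac{\sqrt{g'(\varphi)g'(\eta)}\,(\varphi-\eta)-(g(\varphi)-g(\eta))}{(g(\varphi)-g(\eta))(\varphi-\eta)}\right]^2d\varphi\,d\eta=\infty .$$ Then $G$ is not Kazhdan.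
   Context: $\mathcal{D}iff^{1,\alpha}(S^1)$ is the group of orientation-preserving diffeomorphisms of $S^1$ whose derivative lies in the Hölder space $C^\alpha(S^1)$, i.e. $|f(x)-f(y)|<c|x-y|^\alpha$. Fractional-linear transformations are the elements of $SO^+(1,2)\cong PSL_2(\mathbb{R})$ acting on $S^1=\partial\mathcal{H}^2$. In 4), $S^1=\mathbb{R}/2\pi\mathbb{Z}$ with angular coordinate, $g'$ is the derivative in this coordinate, and the differences $\varphi-\eta$ and $g(\varphi)-g(\eta)$ are represented by numbers in $(-\pi,\pi]$. ''Kazhdan'' means having Kazhdan's property (T), $G$ being considered as a discrete group. *)

(* Defs.v *)
From HB Require Import structures.
From mathcomp Require Import all_boot all_order all_algebra.
From mathcomp Require Import all_classical all_reals all_analysis.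
From mathcomp Require Import complex ring lra.

Set Implicit Arguments.
Unset Strict Implicit.
Unset Printing Implicit Defensive.

Import Order.TTheory GRing.Theory Num.Theory.
Import numFieldNormedType.Exports.

Local Open Scope classical_set_scope.
Local Open Scope ring_scope.
Local Open Scope complex_scope.
Local Open Scope quotient_scope.

Section Subgroup.
Variables (gT : groupType) (G : groupClosed gT).

Record subgroup_of : Type := SubgroupOf { sg_val : gT; _ : sg_val \in G }.

HB.instance Definition _ := [isSub for sg_val].
HB.instance Definition _ := [Choice of subgroup_of by <:].

Lemma subgroup_closed : group_closed G.
Proof.
split; first exact: gpred1.
by move=> x y xG yG; rewrite gpredM ?gpredV.
Qed.

HB.instance Definition _ :=
  SubChoice_isSubGroup.Build gT _ subgroup_of subgroup_closed.

End Subgroup.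

Record bijection (T : Type) := Bijection {
  bij_fun :> T -> T;
  bij_inv : T -> T;
  bij_funK : cancel bij_fun bij_inv;
  bij_invK : cancel bij_inv bij_fun }.

Section BijectionGroup.
Variable T : Type.
Implicit Types f g h : bijection T.

Lemma bijectionP f g : (f : T -> T) =1 g -> f = g.
Proof.
case: f g => [f f' fK f'K] [g g' gK g'K] /= /funext fg.
rewrite -{}fg in gK g'K *.
have f'g' : f' = g' by apply/funext => x; rewrite -{1}(g'K x) fK.
rewrite -{}f'g' in gK g'K *.
by rewrite (Prop_irrelevance gK fK) (Prop_irrelevance g'K f'K).
Qed.

HB.instance Definition _ := gen_eqMixin (bijection T).
HB.instance Definition _ := gen_choiceMixin (bijection T).

Definition bij_one : bijection T :=
  @Bijection T id id (fun=> erefl) (fun=> erefl).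
Definition bij_mul f g : bijection T :=
  Bijection (can_comp (bij_funK f) (bij_funK g))
            (can_comp (bij_invK g) (bij_invK f)).
Definition bij_opp f : bijection T := Bijection (bij_invK f) (bij_funK f).

Lemma bij_mulA : associative bij_mul.
Proof. by move=> f g h; exact: bijectionP. Qed.
Lemma bij_mul1 : left_id bij_one bij_mul.
Proof. by move=> f; exact: bijectionP. Qed.
Lemma bij_1mul : right_id bij_one bij_mul.
Proof. by move=> f; exact: bijectionP. Qed.
Lemma bij_mulV : left_inverse bij_one bij_opp bij_mul.
Proof. by move=> f; apply: bijectionP => x /=; rewrite bij_funK. Qed.
Lemma bij_mulV' : right_inverse bij_one bij_opp bij_mul.
Proof. by move=> f; apply: bijectionP => x /=; rewrite bij_invK. Qed.

HB.instance Definition _ := isGroup.Build (bijection T)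
  bij_mulA bij_mul1 bij_1mul bij_mulV bij_mulV'.

End BijectionGroup.

Section Circle.
Variable R : realType.

Definition two_pi_Z : {pred R} := fun x => x / (2 * pi) \is a Num.int.

Lemma two_pi_Z_closed : zmod_closed two_pi_Z.
Proof.
split; first by rewrite -topredE /= /two_pi_Z mul0r rpred0.
by move=> x y; rewrite -!topredE /= /two_pi_Z mulrBl; exact: rpredB.
Qed.

HB.instance Definition _ := GRing.isZmodClosed.Build R two_pi_Z two_pi_Z_closed.

Definition circle : Type := Quotient.quot two_pi_Z.

HB.instance Definition _ := GRing.Zmodule.on circle.
HB.instance Definition _ := isPointed.Build circle 0.

Definition angle (t : R) : circle := \pi_(Quotient.quot two_pi_Z) t.

(* The representative of p in (-pi, pi]: t - 2 k pi lies in (-pi, pi] exactly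
   when k = ceil ((t - pi) / (2 pi)). *)
Definition ang (p : circle) : R :=
  let t := repr p in t - 2 * pi * (Num.ceil ((t - pi) / (2 * pi)))%:~R.

Lemma ang_itv p : ang p \in `]- pi, pi]%R.
Proof.
rewrite in_itv /= /ang; set t := repr p; set u := (t - pi) / (2 * pi).
have pi2 : 0 < 2 * pi :> R by rewrite mulr_gt0 ?pi_gt0.
have tE : t = u * (2 * pi) + pi.
  by rewrite /u divfK ?subrK// gt_eqF.
have uc : u * (2 * pi) <= 2 * pi * (Num.ceil u)%:~R.
  by rewrite mulrC ler_pM2l// real_ceil_ge ?num_real.
have cu : 2 * pi * (Num.ceil u)%:~R < 2 * pi * (u + 1).
  by rewrite ltr_pM2l// -ltrBlDr -[X in _ - X]/(1%:~R) -intrB real_ceilB1_lt ?num_real.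
by rewrite tE; apply/andP; split; lra.
Qed.

Lemma angK : cancel ang angle.
Proof.
move=> p; rewrite -[RHS]reprK; apply/eqP.
rewrite -(Quotient.idealrBE two_pi_Z) -topredE /= /two_pi_Z /ang addrAC subrr.
rewrite sub0r mulNr mulrAC divff ?mul1r ?rpredN ?intr_int//.
by rewrite gt_eqF// mulr_gt0 ?pi_gt0.
Qed.

(* The quotient sigma-algebra, i.e. the Borel sets of the circle. *)
Definition circle_measurable : set (set circle) :=
  image_set_system setT angle (measurable : set (set (measurableTypeR R))).

Lemma circle_sigma_algebra : sigma_algebra setT circle_measurable.
Proof. by apply: sigma_algebra_image => //; exact: sigma_algebra_measurable. Qed.

Let circle_measurable0 : circle_measurable set0.
Proof. by case: circle_sigma_algebra. Qed.

Let circle_measurableC A : circle_measurable A -> circle_measurable (~` A).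
Proof. by rewrite -setTD; case: circle_sigma_algebra => _ + _; exact. Qed.

Let circle_measurable_bigcup (F : (set circle)^nat) :
  (forall i, circle_measurable (F i)) -> circle_measurable (\bigcup_i F i).
Proof. by case: circle_sigma_algebra => _ _; exact. Qed.

HB.instance Definition _ := @isMeasurable.Build default_measure_display circle
  circle_measurable circle_measurable0 circle_measurableC
  circle_measurable_bigcup.

Lemma measurable_angle :
  measurable_fun setT (angle : measurableTypeR R -> circle).
Proof. by move=> _ A mA; exact: mA. Qed.

HB.instance Definition _ :=
  isMeasurableFun.Build _ _ (measurableTypeR R) circle angle measurable_angle.

Let turn : set (measurableTypeR R) := `[0, 2 * pi[%classic.

Let measurable_turn : measurable turn.
Proof. exact: measurable_itv. Qed.

Let lebesgue_turn_lty : (lebesgue_measure turn < +oo)%E.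
Proof. by rewrite lebesgue_measure_itv; case: ifP => // _; exact: ltry. Qed.

Definition dtheta : set circle -> \bar R :=
  pushforward (mfrestr measurable_turn lebesgue_turn_lty) angle.

Let dtheta0 : dtheta set0 = 0%E.
Proof. by rewrite /dtheta /pushforward preimage_set0 measure0. Qed.

Let dtheta_ge0 A : (0 <= dtheta A)%E.
Proof. exact: measure_ge0. Qed.

Let dtheta_sigma_additive : semi_sigma_additive dtheta.
Proof. exact: measure_semi_sigma_additive. Qed.

HB.instance Definition _ := isMeasure.Build _ _ _ dtheta
  dtheta0 dtheta_ge0 dtheta_sigma_additive.

Let dtheta_fin : fin_num_fun dtheta.
Proof.
move=> A mA; apply: fin_num_measure; rewrite -[X in measurable X]setTI.
exact: measurable_angle.
Qed.

HB.instance Definition _ := Measure_isFinite.Build _ _ _ dtheta dtheta_fin.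

(* g near p, read in the angular coordinates centered at p and at g p. *)
Definition local_lift (g : circle -> circle) (p : circle) : R -> R :=
  fun h => ang (g (p + angle h) - g p).

Definition cderivable (g : circle -> circle) (p : circle) : Prop :=
  derivable (local_lift g p) 0 1.

Definition cderive (g : circle -> circle) (p : circle) : R :=
  derive1 (local_lift g p) 0.

(* A bijection of the circle with everywhere positive continuous derivative is
   an orientation-preserving diffeomorphism, and its inverse is of the same
   class; |ang (p - q)| is the arc-length distance. *)
Definition Diff1 (alpha : R) : set (bijection circle) :=
  [set g | [/\ forall p, cderivable g p,
               forall p, 0 < cderive g p &
               exists c : R, forall p q, p != q ->
                 `|cderive g p - cderive g q| < c * `|ang (p - q)| `^ alpha]].

(* The boundary RP^1 of the upper half-plane is identified with the circle by
   sending the line spanned by (cos (t/2), sin (t/2)) to the angle t; in the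
   affine coordinate x = cot (t/2) this is e^{it} = (x + i) / (x - i), and a
   matrix (a, b; c, d) acts by x |-> (a x + b) / (c x + d). *)
Definition half_angle (t : R) : 'cV[R]_2 :=
  \col_i (if i == 0 then cos (t / 2) else sin (t / 2)).

Definition fractional_linear (A : 'M[R]_2) (m : circle -> circle) : Prop :=
  \det A = 1 /\
  forall s t : R, m (angle s) = angle t ->
    exists k : R, A *m half_angle s = k *: half_angle t.

Definition hyperbolic (m : circle -> circle) : Prop :=
  exists2 A : 'M[R]_2, fractional_linear A m & 2 < `|\tr A|.

Definition parabolic (m : circle -> circle) : Prop :=
  exists2 A : 'M[R]_2, fractional_linear A m &
    [/\ `|\tr A| = 2, A != 1%:M & A != - 1%:M].

Implicit Types (f : circle -> R[i]) (V W : set (circle -> R[i])).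

(* Square-integrable functions; they are not quotiented by a.e. equality, but
   a closed subspace in the sense below is saturated for it. *)
Definition L2C : set (circle -> R[i]) :=
  [set f | (fun p => complex.Re (f p)) \in Lfun dtheta 2%:E /\
           (fun p => complex.Im (f p)) \in Lfun dtheta 2%:E].

Definition L2_inner f1 f2 : R[i] :=
  Complex (\int[dtheta]_p complex.Re (f1 p * (f2 p)^*%C))
          (\int[dtheta]_p complex.Im (f1 p * (f2 p)^*%C)).

Definition L2_norm2 f : R :=
  \int[dtheta]_p (complex.Re (f p) ^+ 2 + complex.Im (f p) ^+ 2).

Definition closed_subspace V : Prop :=
  [/\ V `<=` L2C,
      V (cst 0),
      forall (a : R[i]) f1 f2, V f1 -> V f2 -> V (fun p => a * f1 p + f2 p) &
      forall (u : nat -> circle -> R[i]) f, (forall n, V (u n)) -> L2C f ->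
        L2_norm2 (fun p => u n p - f p) @[n --> \oo] --> (0 : R) -> V f].

Definition null_fun f : Prop := {ae dtheta, forall p, f p = 0}.

(* The unitary action f |-> f(g^{-1}) [(g^{-1})']^{1/2} on half-densities. *)
Definition koopman (g : bijection circle) f : circle -> R[i] :=
  fun p => f (g^-1%g p) * (Num.sqrt (cderive g^-1%g p))%:C.

Definition invariant_subspace (G : {pred bijection circle}) V : Prop :=
  closed_subspace V /\
  forall g f, g \in G -> V f -> V (koopman g f).

Definition irreducible_subspace (G : {pred bijection circle}) V : Prop :=
  [/\ invariant_subspace G V,
      ~ (V `<=` null_fun) &
      forall W, invariant_subspace G W -> W `<=` V ->
        W `<=` null_fun \/ W = V].

Definition finite_sum_of_irreducibles (G : {pred bijection circle}) : Prop :=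
  exists (n : nat) (V : 'I_n -> set (circle -> R[i])),
    [/\ forall i, irreducible_subspace G (V i),
        forall i j, i != j -> forall f1 f2, V i f1 -> V j f2 ->
          L2_inner f1 f2 = 0 &
        forall f, L2C f -> exists u : 'I_n -> circle -> R[i],
          (forall i, V i (u i)) /\ null_fun (fun p => f p - \sum_i u i p)].

(* At the null sets where a factor of the denominator vanishes, x / 0 = 0. *)
Definition distortion (g : circle -> circle) (z : circle * circle) : R :=
  let: (phi, eta) := z in
  (Num.sqrt (cderive g phi * cderive g eta) * ang (phi - eta)
     - ang (g phi - g eta))
  / (ang (g phi - g eta) * ang (phi - eta)).

End Circle.

Section PropertyT.
Variable R : realType.

(* Conj-linear in the second argument of the inner product. *)
Record hilbertType := HilbertType {
  hilbert_sort :> completeNormedModType R[i];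
  inner : {dot hilbert_sort for (@Num.conj R[i])};
  innerE : forall v : hilbert_sort, `|v| ^+ 2 = inner v v }.

Definition unitary_rep (gT : groupType) (H : hilbertType) (rho : gT -> H -> H) :
    Prop :=
  [/\ forall g, linear (rho g),
      forall v, rho 1%g v = v,
      forall g h v, rho (g * h)%g v = rho g (rho h v) &
      forall g v w, inner H (rho g v) (rho g w) = inner H v w].

Definition kazhdan (gT : groupType) : Prop :=
  exists (K : seq gT) (eps : R), 0 < eps /\
    forall (H : hilbertType) (rho : gT -> H -> H), unitary_rep rho ->
      (exists v : H, v != 0 /\
         forall k, k \in K -> `|rho k v - v| < eps%:C * `|v|) ->
      exists w : H, w != 0 /\ forall g, rho g w = w.

End PropertyT.

(* Main.v *)
From HB Require Import structures.
From mathcomp Require Import all_boot all_order all_algebra.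
From mathcomp Require Import all_classical all_reals all_analysis.
From mathcomp Require Import measurable_realfun.
From mathcomp Require Import complex ring lra.
Require Import Defs.

Set Implicit Arguments.
Unset Strict Implicit.
Unset Printing Implicit Defensive.

Import Order.TTheory GRing.Theory Num.Theory.
Import numFieldNormedType.Exports.
Local Open Scope classical_set_scope.
Local Open Scope ring_scope.

(** The theorem follows from the study of one cocycle.  For a diffeomorphism g
put k_g(phi, eta) = sqrt(g'(phi) g'(eta)) / (g(phi) - g(eta)), the pull-back by
g of the kernel 1 / (phi - eta) acting on half-densities of the torus.  The
integrand of condition 4) is k_g - k_1 ([distortionE]).  As g' is alpha-Hoelder,
it is O(|phi - eta|^(alpha - 1)), hence square-integrable because alpha > 1/2
([sq_integrable_distortion]), and a change of variables shows that
||k_(gu) - k_(hu)|| = ||k_g - k_h|| ([dist2_distortion_comp]).  So g |-> k_g - k_1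
is a cocycle with values in a unitary representation.

Bounded cocycles.  A group with property (T) has only bounded cocycles
([kazhdan_bounded]).  Indeed, by Schur's product theorem exp(-t ||b_g - b_h||^2)
is a positive semidefinite right-invariant kernel, and for small t the regular
representation on its reproducing kernel Hilbert space has an almost invariant
unit vector.  An invariant vector of that space is a constant function, so the
constant 1 is a uniform limit of combinations of kernel sections
([kazhdan_kernel]); but such combinations are small where the cocycle is large.
This rules out 4).

Freeness.  Suppose g in G fixes a point and g <> 1.  Up to inverting g, its lift
fixes a point p and pushes every point of ]p, x] to the right, so that for each
e > 0 a power g^n sends p + e beyond x.  On ]p + e, x] times a left
neighbourhood of p the denominator of k_(g^n) is then at least x - p, so k_(g^n)
has a norm bounded independently of e (the integral of g'(phi) g'(eta) is
4 pi^2), while the integral of k_1^2 = 1 / (phi - eta)^2 grows like log (1 / e)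
([box_estimate]).  This contradicts the bound on the cocycle, so G acts freely
([fixed_point_trivial]).  A hyperbolic or parabolic matrix has a real
eigenvector, hence its map has a fixed point, and only the matrices 1 and -1 act
trivially; this rules out 2) and 3).

Finiteness.  In a free action the lifts of gh and hg never cross, which makes
the translation number additive modulo 2 pi (Hoelder); it is injective, because
a map with translation number 0 has a fixed point ([group_translation]).  The
kernels cos(m (tau g - tau h)) are positive semidefinite and, for suitable m, as
close to 1 as desired on a given finite set (Dirichlet), so the argument with
reproducing kernels yields an m with m tau(g) in 2 pi Z for all g
([kazhdan_torsion]); hence G is finite ([kazhdan_finite]).

Condition 1).  For finite G, pick f in an irreducible V that is not null.  The
u in V orthogonal to all translates of f form a proper invariant subspace, so
they are null, and V has dimension at most |G| modulo null functions.  A finite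
sum of such subspaces cannot contain the indicator functions of more disjoint
arcs than its dimension ([finite_group_not_finite_sum]). *)

(** * Reproducing kernel Hilbert spaces *)

Section Combinations.
Variables (R : realType) (X : Type).
Implicit Types (s t : seq (R * X)) (f g : X -> R).

(** A sequence of pairs (coefficient, point) encodes a finitely supported real
measure on X; [comb_eval f t] is the integral of f against it. *)
Definition comb_eval f t : R := \sum_(p <- t) p.1 * f p.2.

Definition scale_comb (a : R) t := [seq (a * p.1, p.2) | p <- t].

Lemma evalD f g t : comb_eval (f + g) t = comb_eval f t + comb_eval g t.
Proof. by rewrite /comb_eval -big_split; apply: eq_bigr => p _; rewrite mulrDr. Qed.

Lemma evalZ a f t : comb_eval (a *: f) t = a * comb_eval f t.
Proof. by rewrite /comb_eval mulr_sumr; apply: eq_bigr => p _; rewrite mulrCA. Qed.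

Lemma eval_scale_comb f a t : comb_eval f (scale_comb a t) = a * comb_eval f t.
Proof. by rewrite /comb_eval big_map mulr_sumr; apply: eq_bigr => p _; rewrite mulrA. Qed.

Lemma eval1 f x : comb_eval f [:: (1, x)] = f x.
Proof. by rewrite /comb_eval big_seq1 mul1r. Qed.

Definition kform (K : X -> X -> R) s t : R :=
  \sum_(p <- s) \sum_(q <- t) p.1 * q.1 * K p.2 q.2.

Record psd_kernel := PsdKernel {
  kern :> X -> X -> R;
  kern_sym : forall x y, kern x y = kern y x;
  kern_psd : forall s, 0 <= kform kern s s }.

End Combinations.

Section KernelForm.
Variables (R : realType) (X : Type) (K : psd_kernel R X).
Implicit Types (s t u : seq (R * X)) (f g : X -> R) (M e : R).

Definition section_of s : X -> R := fun x => \sum_(p <- s) p.1 * K p.2 x.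

Lemma section_ofE s x : section_of s x = comb_eval (K x) s.
Proof. by apply: eq_bigr => p _; rewrite kern_sym. Qed.

Lemma formE s t : kform K s t = comb_eval (section_of s) t.
Proof.
rewrite /kform exchange_big; apply: eq_bigr => q _; rewrite mulr_sumr.
by apply: eq_bigr => p _; ring.
Qed.

Lemma formC s t : kform K s t = kform K t s.
Proof.
rewrite /kform exchange_big; apply: eq_bigr => q _; apply: eq_bigr => p _.
by rewrite kern_sym; ring.
Qed.

Lemma section_of_cat s t : section_of (s ++ t) = section_of s + section_of t.
Proof. by apply/funext => x; rewrite /section_of big_cat. Qed.

Lemma section_of_scale_comb a s : section_of (scale_comb a s) = a *: section_of s.
Proof. by apply/funext => x; rewrite section_ofE eval_scale_comb -section_ofE. Qed.

Lemma form_catl s s' t : kform K (s ++ s') t = kform K s t + kform K s' t.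
Proof. by rewrite /kform big_cat. Qed.

Lemma form_scalel a s t : kform K (scale_comb a s) t = a * kform K s t.
Proof. by rewrite !formE section_of_scale_comb evalZ. Qed.

Lemma form_cauchy_schwarz s t : kform K s t ^+ 2 <= kform K s s * kform K t t.
Proof.
have Q a b : 0 <= a ^+ 2 * kform K s s + 2 * a * b * kform K s t + b ^+ 2 * kform K t t.
  have := kern_psd K (scale_comb a s ++ scale_comb b t).
  rewrite form_catl !form_scalel !(formC _ (scale_comb a s ++ _)) !form_catl.
  rewrite !form_scalel (formC t s); set x := kform K s s; set y := kform K t t.
  by set z := kform K s t => h; apply: le_trans h _; rewrite le_eqVlt; apply/orP; left; apply/eqP; ring.
have x0 := kern_psd K s; have y0 := kern_psd K t.
move: Q x0 y0; set x := kform K s s; set y := kform K t t; set z := kform K s t.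
move=> Q x0 y0; have [y00|yN0] := eqVneq y 0.
  have zz : z = 0.
    apply/eqP; rewrite -[_ == _]negbK; apply/negP => zN0.
    have := Q 1 (- (x + 1) / (2 * z)).
    rewrite y00 mulr0 addr0 expr1n mul1r mulr1.
    have -> : 2 * (- (x + 1) / (2 * z)) * z = - (x + 1) by field.
    by lra.
  by rewrite zz y00; lra.
have yp : 0 < y by rewrite lt_def yN0.
have := Q y (- z).
have -> : y ^+ 2 * x + 2 * y * - z * z + (- z) ^+ 2 * y = y * (x * y - z ^+ 2) by ring.
by rewrite pmulr_rge0// subr_ge0.
Qed.

(** The norm of f in the reproducing kernel space is the least M such that
|<f, sum_p a_p K(x_p, .)>| <= M ||sum_p a_p K(x_p, .)|| for all combinations.  Taking
this as the definition gives a norm on genuine functions, without completing an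
abstract pre-Hilbert space. *)
Definition bounded_by f M := 0 <= M /\
  forall t, `|comb_eval f t| <= M * Num.sqrt (kform K t t).

Lemma bounded_byD f g M e : bounded_by f M -> bounded_by g e ->
  bounded_by (f + g) (M + e).
Proof.
move=> [M0 fM] [e0 ge]; split; first exact: addr_ge0.
move=> t; rewrite evalD mulrDl; apply: le_trans (ler_normD _ _) _.
exact: lerD.
Qed.

Lemma bounded_byZ a f M : bounded_by f M -> bounded_by (a *: f) (`|a| * M).
Proof.
move=> [M0 fM]; split; first exact: mulr_ge0.
by move=> t; rewrite evalZ normrM -mulrA ler_wpM2l.
Qed.

Lemma bounded_by0 : bounded_by 0 0.
Proof.
split=> // t; rewrite mul0r /comb_eval big1 ?normr0// => p _.
by rewrite mulr0.
Qed.

Lemma bounded_by_le f M e : M <= e -> bounded_by f M -> bounded_by f e.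
Proof.
move=> Me [M0 fM]; split; first exact: le_trans Me.
by move=> t; apply: le_trans (fM t) _; rewrite ler_wpM2r ?sqrtr_ge0.
Qed.

Lemma bounded_by_section s : bounded_by (section_of s) (Num.sqrt (kform K s s)).
Proof.
split; first exact: sqrtr_ge0.
move=> t; rewrite -formE -sqrtrM ?kern_psd// -sqrtr_sqr.
by rewrite ler_wsqrtr// form_cauchy_schwarz.
Qed.

Lemma bounded_by_pt f M x : bounded_by f M -> `|f x| <= M * Num.sqrt (K x x).
Proof.
move=> [_ /(_ [:: (1, x)])]; rewrite eval1 /kform !big_seq1/= !mul1r.
by [].
Qed.

Definition knorm f : R := inf [set M | bounded_by f M].

Lemma knorm_le f M : bounded_by f M -> knorm f <= M.
Proof. by move=> fM; apply: ge_inf => //; exists 0 => e []. Qed.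

(** The infimum is attained, as the defining inequalities are closed in M. *)
Lemma knormP f M : bounded_by f M -> bounded_by f (knorm f).
Proof.
move=> fM; split; first by apply: lb_le_inf; [exists M|move=> e []].
move=> t; have [t0|tN0] := eqVneq (Num.sqrt (kform K t t)) 0.
  by case: fM => _ /(_ t); rewrite t0 !mulr0.
have tp : 0 < Num.sqrt (kform K t t) by rewrite lt_def tN0 sqrtr_ge0.
rewrite -ler_pdivrMr//; apply: lb_le_inf; first by exists M.
by move=> e [e0 /(_ t)]; rewrite ler_pdivrMr.
Qed.

(** Cauchy-Schwarz gives one inequality; testing [section_of s] against s itself
gives the other. *)
Lemma knorm_section s : knorm (section_of s) ^+ 2 = kform K s s.
Proof.
have rr : kform K s s = Num.sqrt (kform K s s) ^+ 2 by rewrite sqr_sqrtr ?kern_psd.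
have /knormP [n0 /(_ s)] := bounded_by_section s.
have /knorm_le := bounded_by_section s.
rewrite -formE ger0_norm ?kern_psd// [in X in _ -> X -> _]rr [in RHS]rr.
have := sqrtr_ge0 (kform K s s); set r := Num.sqrt _.
rewrite le_eqVlt => /predU1P[<- n1 _|r0 n1 n2].
  suff -> : knorm (section_of s) = 0 by [].
  by apply: le_anti; apply/andP; split; [exact: n1|exact: n0].
suff -> : knorm (section_of s) = r by [].
apply: le_anti; apply/andP; split; first exact: n1.
by rewrite -(ler_pM2r r0) -expr2 -[X in _ <= _ * X]ger0_norm ?(ltW r0)// -sqrtr_sqr.
Qed.

(** The functions of finite norm that are limits of finite combinations of kernel
sections.  Restricting to this closure makes every identity checkable on finite
combinations, where it is plain algebra, and then extend by continuity. *)
Definition in_rkhs f :=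
  forall e, 0 < e -> exists s, bounded_by (f - section_of s) e.

Lemma section_of_nil : section_of [::] = 0.
Proof. by apply/funext => x; rewrite /section_of big_nil. Qed.

Lemma in_rkhs_section s : in_rkhs (section_of s).
Proof. by move=> e e0; exists s; rewrite subrr; apply: bounded_by_le (bounded_by0); exact: ltW. Qed.

Lemma in_rkhsD f g : in_rkhs f -> in_rkhs g -> in_rkhs (f + g).
Proof.
move=> fH gH e e0; have e2 : 0 < e / 2 by rewrite divr_gt0.
have [s fs] := fH _ e2; have [t gt] := gH _ e2; exists (s ++ t).
by rewrite section_of_cat opprD addrACA (splitr e); exact: bounded_byD.
Qed.

Lemma in_rkhsZ a f : in_rkhs f -> in_rkhs (a *: f).
Proof.
move=> fH e e0; have a1 : 0 < `|a| + 1 by rewrite ltr_wpDl.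
have [s fs] := fH _ (divr_gt0 e0 a1); exists (scale_comb a s).
rewrite section_of_scale_comb -scalerBr; apply: bounded_by_le (bounded_byZ a fs).
rewrite mulrA ler_pdivrMr//; have := normr_ge0 a; nra.
Qed.

Lemma in_rkhs_bounded f : in_rkhs f -> bounded_by f (knorm f).
Proof.
move=> /(_ 1 ltr01) [s fs]; rewrite -[f in bounded_by f](subrK (section_of s)).
have := bounded_byD fs (bounded_by_section s); rewrite subrK.
exact: knormP.
Qed.

Lemma knorm_ge0 f : in_rkhs f -> 0 <= knorm f.
Proof. by move=> /in_rkhs_bounded []. Qed.

Lemma ler_knormD f g : in_rkhs f -> in_rkhs g ->
  knorm (f + g) <= knorm f + knorm g.
Proof.
by move=> fH gH; apply: knorm_le; apply: bounded_byD; exact: in_rkhs_bounded.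
Qed.

Lemma knormZ_le a f : in_rkhs f -> knorm (a *: f) <= `|a| * knorm f.
Proof. by move=> fH; apply/knorm_le/bounded_byZ/in_rkhs_bounded. Qed.

Lemma in_rkhsN f : in_rkhs f -> in_rkhs (- f).
Proof. by move=> fH; rewrite -scaleN1r; exact: in_rkhsZ. Qed.

Lemma in_rkhsB f g : in_rkhs f -> in_rkhs g -> in_rkhs (f - g).
Proof. by move=> fH gH; exact/in_rkhsD/in_rkhsN. Qed.

Lemma knormN f : in_rkhs f -> knorm (- f) = knorm f.
Proof.
move=> fH; apply: le_anti; apply/andP; split.
  by have := knormZ_le (-1) fH; rewrite scaleN1r normrN1 mul1r.
by have := knormZ_le (-1) (in_rkhsN fH); rewrite scaleN1r normrN1 mul1r opprK.
Qed.

Lemma ler_dist_knorm f g : in_rkhs f -> in_rkhs g ->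
  `|knorm f - knorm g| <= knorm (f - g).
Proof.
move=> fH gH; rewrite ler_norml; apply/andP; split.
  rewrite lerNl opprB lerBlDr -(knormN (in_rkhsB fH gH)) opprB.
  by have := ler_knormD (in_rkhsB gH fH) fH; rewrite subrK.
by rewrite lerBlDr; have := ler_knormD (in_rkhsB fH gH) gH; rewrite subrK.
Qed.

(** The norm is the primitive notion, so the inner product is its polarisation; that
it is bilinear is [kinner_scalarl]. *)
Definition kinner f g : R := (knorm (f + g) ^+ 2 - knorm (f - g) ^+ 2) / 4.

Lemma kinner_section s t : kinner (section_of s) (section_of t) = kform K s t.
Proof.
rewrite /kinner -section_of_cat -[_ - section_of t](_ : section_of (s ++ scale_comb (-1) t) = _); last first.
  by rewrite section_of_cat section_of_scale_comb scaleN1r.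
rewrite !knorm_section !form_catl form_scalel !(formC _ (_ ++ _)) !form_catl !form_scalel.
by rewrite (formC t s); field.
Qed.

Lemma cvg_kinner (u v : nat -> X -> R) f g :
  (forall n, in_rkhs (u n)) -> (forall n, in_rkhs (v n)) ->
  in_rkhs f -> in_rkhs g ->
  knorm (u n - f) @[n --> \oo] --> (0 : R) ->
  knorm (v n - g) @[n --> \oo] --> (0 : R) ->
  kinner (u n) (v n) @[n --> \oo] --> kinner f g.
Proof.
move=> uH vH fH gH uf vg.
have key (w : nat -> X -> R) h : (forall n, in_rkhs (w n)) -> in_rkhs h ->
    (forall n, knorm (w n - h) <= knorm (u n - f) + knorm (v n - g)) ->
    knorm (w n) ^+ 2 @[n --> \oo] --> knorm h ^+ 2.
  move=> wH hH wh.
  suff wc : knorm (w n) @[n --> \oo] --> knorm h.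
    by rewrite expr2; under eq_fun do rewrite expr2; exact: cvgM.
  have uv : knorm (u n - f) + knorm (v n - g) @[n --> \oo] --> (0 + 0 : R).
    exact: cvgD.
  apply/cvgrPdist_le => e e0.
  move/cvgrPdist_le : uv => /(_ e e0); apply: filterS => n.
  rewrite addr0 sub0r normrN => h1; rewrite distrC.
  apply: le_trans (ler_dist_knorm (wH n) hH) _.
  apply: le_trans (wh n) _; exact: le_trans (ler_norm _) h1.
apply: cvgM; last exact: cvg_cst.
apply: cvgB; apply: key => [n||n].
- exact: in_rkhsD.
- exact: in_rkhsD.
- by rewrite opprD addrACA; apply: ler_knormD; exact: in_rkhsB.
- exact: in_rkhsB.
- exact: in_rkhsB.
- have -> : u n - v n - (f - g) = (u n - f) - (v n - g).
    by rewrite !opprB addrACA [RHS]addrACA [- f - v n]addrC.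
  rewrite -(knormN (in_rkhsB (vH n) gH)).
  by apply: ler_knormD; [exact: in_rkhsB|exact/in_rkhsN/in_rkhsB].
Qed.

Lemma in_rkhs_seq f : in_rkhs f -> exists s : nat -> seq (R * X),
  knorm (section_of (s n) - f) @[n --> \oo] --> (0 : R).
Proof.
move=> fH; have inv0 n : 0 < n.+1%:R^-1 :> R by rewrite invr_gt0.
have [s sP] := choice (fun n => fH _ (inv0 n)); exists s.
apply: (@squeeze_cvgr _ _ _ _ (cst 0) harmonic); last 2 first.
- exact: cvg_cst.
- exact: cvg_harmonic.
apply: nearW => n; have wH : in_rkhs (section_of (s n) - f).
  by apply: in_rkhsB => //; exact: in_rkhs_section.
rewrite /= knorm_ge0//= -(knormN wH) opprB.
exact: knorm_le.
Qed.

(** Bilinearity holds for combinations of kernel sections by [kinner_section] and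
passes to their limits by [cvg_kinner]. *)
Lemma kinner_scalarl g : in_rkhs g -> forall a f f', in_rkhs f -> in_rkhs f' ->
  kinner (a *: f + f') g = a * kinner f g + kinner f' g.
Proof.
move=> gH a f f' fH f'H.
have [s sf] := in_rkhs_seq fH; have [s' sf'] := in_rkhs_seq f'H.
have [t tg] := in_rkhs_seq gH.
have sH n := in_rkhs_section (s n); have s'H n := in_rkhs_section (s' n).
have tH n := in_rkhs_section (t n).
have c1 := cvg_kinner sH tH fH gH sf tg.
have c2 := cvg_kinner s'H tH f'H gH sf' tg.
have c3 : a * kinner (section_of (s n)) (section_of (t n)) +
    kinner (section_of (s' n)) (section_of (t n)) @[n --> \oo] -->
    a * kinner f g + kinner f' g.
  by apply: cvgD => //; apply: cvgM => //; exact: cvg_cst.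
have lH n := in_rkhsD (in_rkhsZ a (sH n)) (s'H n).
have fH' := in_rkhsD (in_rkhsZ a fH) f'H.
have lc : knorm ((a *: section_of (s n) + section_of (s' n)) - (a *: f + f'))
    @[n --> \oo] --> (0 : R).
  apply: (@squeeze_cvgr _ _ _ _ (cst 0)
    (fun n => `|a| * knorm (section_of (s n) - f) + knorm (section_of (s' n) - f'))).
  - apply: nearW => n; rewrite /= knorm_ge0/=; last exact: in_rkhsB.
    rewrite opprD addrACA -scalerBr; apply: le_trans (ler_knormD _ _) _; last first.
    + by rewrite lerD2r; apply: knormZ_le; exact: in_rkhsB.
    + exact: in_rkhsB.
    + by apply: in_rkhsZ; exact: in_rkhsB.
  - exact: cvg_cst.
  - rewrite -[X in _ --> X](addr0 0) -[X in _ --> X + _](mulr0 `|a|).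
    by apply: cvgD => //; apply: cvgM => //; exact: cvg_cst.
have c4 := cvg_kinner lH tH fH' gH lc tg.
apply: (cvg_unique _ c4) => //; move: c3; apply: cvg_trans.
apply: near_eq_cvg; apply: nearW => n /=.
rewrite -section_of_scale_comb -section_of_cat !kinner_section form_catl.
by rewrite form_scalel.
Qed.

Lemma kinnerC f g : in_rkhs f -> in_rkhs g -> kinner f g = kinner g f.
Proof.
by move=> fH gH; rewrite /kinner -(knormN (in_rkhsB fH gH)) opprB (addrC f).
Qed.

Lemma knormZ a f : in_rkhs f -> knorm (a *: f) = `|a| * knorm f.
Proof.
move=> fH; apply: le_anti; rewrite knormZ_le//=.
have [->|aN0] := eqVneq a 0; first by rewrite normr0 mul0r scale0r knorm_ge0// -section_of_nil; exact: in_rkhs_section.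
have := knormZ_le a^-1 (in_rkhsZ a fH).
rewrite scalerA mulVf// scale1r => h.
by rewrite -ler_pdivlMl ?normr_gt0// -normfV.
Qed.

Lemma kinner_norm f : in_rkhs f -> kinner f f = knorm f ^+ 2.
Proof.
move=> fH; rewrite /kinner subrr -section_of_nil knorm_section.
rewrite -mulr2n -scaler_nat knormZ// ger0_norm// /kform big_nil.
by field.
Qed.

Lemma knorm_eq0 f : in_rkhs f -> knorm f = 0 -> f = 0.
Proof.
move=> fH f0; apply/funext => x; have := bounded_by_pt x (in_rkhs_bounded fH).
by rewrite f0 mul0r normr_le0 => /eqP.
Qed.

(** A Cauchy sequence converges pointwise because evaluations are bounded, and the
bounds [bounded_by], being a family of closed conditions, pass to the pointwise
limit. *)
Lemma rkhs_complete (u : nat -> X -> R) : (forall n, in_rkhs (u n)) ->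
  (forall e, 0 < e -> exists N, forall m n, (N <= m)%N -> (N <= n)%N ->
     knorm (u m - u n) <= e) ->
  exists2 f, in_rkhs f & knorm (u n - f) @[n --> \oo] --> (0 : R).
Proof.
move=> uH uC.
have dH m n : in_rkhs (u m - u n) by exact: in_rkhsB.
have ptC x : cvgn (fun n => u n x).
  apply/cauchy_cvgP/cauchy_ballP => e e0; rewrite near_map2.
  have r0 : 0 < Num.sqrt (K x x) + 1 by rewrite ltr_wpDl ?sqrtr_ge0.
  have [N NP] := uC _ (divr_gt0 e0 r0).
  exists ([set n | (N <= n)%N], [set n | (N <= n)%N]).
    by split; exists N.
  move=> [m n] /= [Nm Nn]; rewrite /ball/=.
  have := bounded_by_pt x (in_rkhs_bounded (dH m n)).
  move=> /le_lt_trans; apply.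
  apply: (@le_lt_trans _ _ (e / (Num.sqrt (K x x) + 1) * Num.sqrt (K x x))).
    by rewrite ler_wpM2r ?sqrtr_ge0// NP.
  by rewrite mulrAC ltr_pdivrMr// mulrDr mulr1 ltrDl.
pose f x := limn (fun n => u n x).
have evC t : comb_eval (u n) t @[n --> \oo] --> comb_eval f t.
  elim: t => [|p t IH].
    rewrite /comb_eval big_nil; under eq_fun do rewrite big_nil; exact: cvg_cst.
  rewrite /comb_eval big_cons; under eq_fun do rewrite big_cons.
  by apply: cvgD; [apply: cvgM; [exact: cvg_cst|exact: ptC]|exact: IH].
have uf e : 0 < e -> exists N, forall n, (N <= n)%N -> bounded_by (u n - f) e.
  move=> e0; have [N NP] := uC _ e0; exists N => n Nn; split; first exact: ltW.
  move=> t.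
  have c : `|comb_eval (u n) t - comb_eval (u m) t| @[m --> \oo] --> `|comb_eval (u n - f) t|.
    apply: cvg_norm; rewrite evalD -[- f]scaleN1r evalZ mulN1r.
    by apply: cvgB; [exact: cvg_cst|exact: evC].
  apply: (@closed_cvg _ _ _ eventually_filter _ [set x | x <= e * Num.sqrt (kform K t t)] _ _ _ c); first exact: closed_le.
  exists N => // m Nm /=.
  have [_ /(_ t)] := bounded_by_le (NP _ _ Nn Nm) (in_rkhs_bounded (dH n m)).
  by rewrite evalD -[- u m]scaleN1r evalZ mulN1r.
have fH : in_rkhs f.
  move=> e e0; have e2 : 0 < e / 2 by rewrite divr_gt0.
  have [N /(_ N (leqnn _)) NP] := uf _ e2; have [s sP] := uH N _ e2; exists s.
  have := bounded_byD (bounded_byZ (-1) NP) sP.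
  by rewrite normrN1 mul1r -splitr scaleN1r opprB addrA subrK.
exists f => //; apply/cvgrPdist_le => e e0; have [N NP] := uf _ e0.
exists N => // n Nn /=; rewrite sub0r normrN ger0_norm ?knorm_ge0//; last exact: in_rkhsB.
exact/knorm_le/NP.
Qed.

End KernelForm.

(** * Complexification of a reproducing kernel space *)

Section ComplexHilbert.
Variables (R : realType) (X : Type) (K : psd_kernel R X).
Local Open Scope complex_scope.

Definition re (F : X -> R[i]) : X -> R := fun x => complex.Re (F x).
Definition im (F : X -> R[i]) : X -> R := fun x => complex.Im (F x).
Definition crkhs : {pred X -> R[i]} :=
  fun F => `[< in_rkhs K (re F) /\ in_rkhs K (im F) >].

Lemma reZ a F : re (a *: F) = complex.Re a *: re F + - complex.Im a *: im F.
Proof.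
by apply/funext => x; rewrite /re /im !fctE /=; case: a => a b; case: (F x) => c d; rewrite -[RHS]/(a * c + - b * d) mulNr.
Qed.

Lemma imZ a F : im (a *: F) = complex.Re a *: im F + complex.Im a *: re F.
Proof.
by apply/funext => x; rewrite /re /im !fctE /=; case: a => a b; case: (F x).
Qed.

Lemma reD F G : re (F + G) = re F + re G.
Proof. by apply/funext => x; rewrite /re !fctE /=; case: (F x); case: (G x). Qed.

Lemma imD F G : im (F + G) = im F + im G.
Proof. by apply/funext => x; rewrite /im !fctE /=; case: (F x); case: (G x). Qed.

Lemma crkhs_closed : submod_closed crkhs.
Proof.
split.
  apply/asboolP; suff : in_rkhs K 0 by [].
  by rewrite -(@section_of_nil _ _ K); exact: in_rkhs_section.
move=> a F G /asboolP[F1 F2] /asboolP[G1 G2]; apply/asboolP.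
rewrite reD imD reZ imZ; split; apply: in_rkhsD => //; apply: in_rkhsD;
  exact: in_rkhsZ.
Qed.
HB.instance Definition _ := GRing.isSubmodClosed.Build _ _ crkhs crkhs_closed.

Record chilbert := CHilbert { chil_fun :> X -> R[i]; _ : chil_fun \in crkhs }.
HB.instance Definition _ := [isSub for chil_fun].
HB.instance Definition _ := [Choice of chilbert by <:].
HB.instance Definition _ := [SubChoice_isSubLmodule of chilbert by <:].

Implicit Types F G : chilbert.

Lemma chil_re F : in_rkhs K (re F).
Proof. by case: F => F /= /asboolP[]. Qed.
Lemma chil_im F : in_rkhs K (im F).
Proof. by case: F => F /= /asboolP[]. Qed.
Hint Resolve chil_re chil_im : core.

Lemma chilD F G : (F + G : chilbert) = (F : X -> R[i]) + (G : X -> R[i]) :> (X -> R[i]).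
Proof. by []. Qed.
Lemma chilZ a F : (a *: F : chilbert) = a *: (F : X -> R[i]) :> (X -> R[i]).
Proof. by []. Qed.

Definition cinner F G : R[i] :=
  (kinner K (re F) (re G) + kinner K (im F) (im G)) +i*
  (kinner K (im F) (re G) - kinner K (re F) (im G)).

(** The norm of R[i] takes values in R[i]; here it turns the pair of real norms into
their Euclidean norm. *)
Definition cnorm F : R[i] := `|knorm K (re F) +i* knorm K (im F)|.

Lemma cnorm_sqr F : cnorm F ^+ 2 = cinner F F.
Proof.
rewrite /cnorm -add_Re2_Im2 /= /cinner !kinner_norm//.
by rewrite kinnerC// subrr.
Qed.

Lemma kinnerDl f f' g : in_rkhs K f -> in_rkhs K f' -> in_rkhs K g ->
  kinner K (f + f') g = kinner K f g + kinner K f' g.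
Proof.
by move=> fH f'H gH; have := kinner_scalarl gH 1 fH f'H; rewrite scale1r mul1r.
Qed.

Lemma kinnerZl a f g : in_rkhs K f -> in_rkhs K g ->
  kinner K (a *: f) g = a * kinner K f g.
Proof.
move=> fH gH; have z : in_rkhs K 0.
  by rewrite -(@section_of_nil _ _ K); exact: in_rkhs_section.
have k0 : kinner K 0 g = 0.
  have := kinnerDl z z gH; rewrite addr0 => /eqP.
  by rewrite -subr_eq0 opprD addrA subrr add0r oppr_eq0 => /eqP.
by have := kinner_scalarl gH a fH z; rewrite addr0 k0 addr0.
Qed.

Lemma kinner_comb a b u v w g : in_rkhs K u -> in_rkhs K v -> in_rkhs K w ->
  in_rkhs K g -> kinner K (a *: u + b *: v + w) g =
    a * kinner K u g + b * kinner K v g + kinner K w g.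
Proof.
move=> uH vH wH gH; have auH := in_rkhsZ a uH; have bvH := in_rkhsZ b vH.
by rewrite kinnerDl ?(kinnerDl auH) ?kinnerZl//; exact: in_rkhsD.
Qed.

Lemma cinner_linearl G : GRing.linear_for *%R (cinner ^~ G).
Proof.
move=> a F F'; rewrite /cinner chilD chilZ reD imD reZ imZ !kinner_comb//.
by case: a => a b; apply/eqP; rewrite eq_complex /=; apply/andP; split; apply/eqP; ring.
Qed.

Lemma cinnerC F G : cinner F G = (cinner G F)^*.
Proof.
rewrite /cinner/= (kinnerC (chil_re F) (chil_re G)) (kinnerC (chil_im F) (chil_im G)).
by rewrite (kinnerC (chil_im F)) // (kinnerC (chil_re F)) // opprB.
Qed.

Lemma cinner_linearr F : GRing.linear_for (Num.conj \; *%R) (cinner F).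
Proof.
move=> a G G'; rewrite cinnerC cinner_linearl (cinnerC F G) (cinnerC F G').
by rewrite rmorphD rmorphM.
Qed.

HB.instance Definition _ := @bilinear_isBilinear.Build R[i] chilbert chilbert R[i]
  *%R (Num.conj \; *%R) cinner (cinner_linearl, cinner_linearr).

Lemma cinner_hermitian F G : cinner F G = (-1) ^+ false * Num.conj (cinner G F).
Proof. by rewrite expr0 mul1r; exact: cinnerC. Qed.

HB.instance Definition _ := @isHermitianSesquilinear.Build R[i] chilbert false
  Num.conj cinner cinner_hermitian.

Lemma cnorm_ge0 F : 0 <= cnorm F. Proof. exact: normr_ge0. Qed.

Lemma cnorm0_eq0 F : cnorm F = 0 -> F = 0.
Proof.
move=> /normr0_eq0/eqP; rewrite eq_complex /= => /andP[/eqP F1 /eqP F2].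
apply: val_inj; apply/funext => x; apply/eqP; rewrite eq_complex.
have := knorm_eq0 (chil_re F) F1; have := knorm_eq0 (chil_im F) F2.
move=> /(congr1 (fun f => f x)) /= h1 /(congr1 (fun f => f x)) /= h2.
by apply/andP; split; apply/eqP.
Qed.

Lemma cinner_pos F : F != 0 -> 0 < cinner F F.
Proof.
move=> F0; rewrite -cnorm_sqr exprn_gt0// lt_def cnorm_ge0 andbT.
by apply: contra F0 => /eqP/cnorm0_eq0 ->.
Qed.

HB.instance Definition _ := @isDotProduct.Build R[i] chilbert cinner cinner_pos.

Lemma cnormZ a F : cnorm (a *: F) = `|a| * cnorm F.
Proof.
apply/eqP; rewrite -(eqrXn2 (n := 2))// ?mulr_ge0 ?cnorm_ge0//.
rewrite exprMn !cnorm_sqr.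
have zl z : cinner (a *: F) z = a * cinner F z.
  by rewrite -[a *: F]addr0 cinner_linearl (_ : cinner 0 z = 0) ?addr0// linear0l.
rewrite {}zl; have -> : cinner F (a *: F) = Num.conj a * cinner F F by exact: linearZr_LR.
by rewrite normCK mulrA.
Qed.

Lemma cnorm_mono (a b c d : R) : 0 <= a -> a <= c -> 0 <= b -> b <= d ->
  `|a +i* b| <= `|c +i* d| :> R[i].
Proof.
move=> a0 ac b0 bd; rewrite !normc_def lecR ler_wsqrtr//=.
by apply: lerD; rewrite ler_sqr ?nnegrE//; lra.
Qed.

Lemma cnormD F G : cnorm (F + G) <= cnorm F + cnorm G.
Proof.
rewrite /cnorm chilD reD imD; apply: le_trans (ler_normD _ _).
by apply: cnorm_mono; rewrite ?knorm_ge0 ?ler_knormD//; exact: in_rkhsD.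
Qed.

HB.instance Definition _ := Lmodule_isNormed.Build R[i] chilbert
  cnormD cnormZ cnorm0_eq0.

Lemma chil_normE F : `|F| = cnorm F. Proof. by []. Qed.

Lemma knorm_re_le F : (knorm K (re F))%:C <= `|F|.
Proof. by have := normc_ge_Re (knorm K (re F) +i* knorm K (im F)); rewrite /= ger0_norm ?knorm_ge0. Qed.

Lemma knorm_im_le F : (knorm K (im F))%:C <= `|F|.
Proof.
rewrite chil_normE /cnorm normc_def lecR /= -[leLHS]ger0_norm ?knorm_ge0//.
by rewrite -sqrtr_sqr ler_wsqrtr// lerDr sqr_ge0.
Qed.

Lemma chil_norm_le F : `|F| <= (knorm K (re F) + knorm K (im F))%:C.
Proof.
rewrite chil_normE /cnorm.
have -> : knorm K (re F) +i* knorm K (im F) = (knorm K (re F))%:C + 'i * (knorm K (im F))%:C.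
  by rewrite [LHS]complexE.
have i1 : `|'i| = 1 :> R[i] by rewrite normc_def /= expr0n expr1n add0r sqrtr1.
apply: le_trans (ler_normD _ _) _; rewrite normrM i1 mul1r.
by rewrite !normc_def /= !expr0n /= !addr0 !sqrtr_sqr !ger0_norm ?knorm_ge0// -rmorphD.
Qed.

Lemma chilB_re F G : re (F - G : chilbert) = re F - re G.
Proof. by rewrite -[- G]scaleN1r chilD chilZ reD reZ /= !oppr0 scale0r addr0 scaleN1r. Qed.
Lemma chilB_im F G : im (F - G : chilbert) = im F - im G.
Proof. by rewrite -[- G]scaleN1r chilD chilZ imD imZ /= !oppr0 scale0r addr0 scaleN1r. Qed.

(** Choosing points of balls of radius 1/(n+1) extracts a Cauchy sequence from the
filter; its real and imaginary parts converge by [rkhs_complete]. *)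
Lemma chil_complete (FF : set_system chilbert) :
  ProperFilter FF -> cauchy FF -> cvg FF.
Proof.
move=> PF cF.
have inv0 n : 0 < (n.+1%:R^-1)%:C :> R[i] by rewrite ltcR invr_gt0.
have bl n : exists x : chilbert, FF (ball x (n.+1%:R^-1)%:C).
  by move/cauchyP : cF => /(_ _ (inv0 n)).
have [u uP] := choice bl.
have near_u m n : `|u m - u n| <= (m.+1%:R^-1 + n.+1%:R^-1)%:C.
  have mn : FF (ball (u m) (m.+1%:R^-1)%:C `&` ball (u n) (n.+1%:R^-1)%:C).
    exact: filterI.
  have [y [/= h1 h2]] := filter_ex mn.
  rewrite -[u m](subrK y) -addrA; apply: le_trans (ler_normD _ _) _.
  rewrite rmorphD; apply: lerD; first exact: ltW.
  by rewrite distrC; exact: ltW.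
have small (e : R) : 0 < e -> exists N, forall m n, (N <= m)%N -> (N <= n)%N ->
    m.+1%:R^-1 + n.+1%:R^-1 <= e.
  move=> e0; have /cvgrPdist_le/(_ (e / 2)) := @cvg_harmonic R.
  move=> /(_ (divr_gt0 e0 _))[//|N _ NP]; exists N => m n Nm Nn.
  rewrite (splitr e); apply: lerD.
    by have := NP m Nm; rewrite /= sub0r normrN ger0_norm.
  by have := NP n Nn; rewrite /= sub0r normrN ger0_norm.
have [f fH uf] : exists2 f, in_rkhs K f & knorm K (re (u n) - f) @[n --> \oo] --> (0 : R).
  apply: rkhs_complete => // e e0; have [N NP] := small e e0; exists N => m n Nm Nn.
  rewrite -chilB_re -lecR; apply: le_trans (knorm_re_le _) _.
  by apply: le_trans (near_u m n) _; rewrite lecR; exact: NP.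
have [g gH ug] : exists2 f, in_rkhs K f & knorm K (im (u n) - f) @[n --> \oo] --> (0 : R).
  apply: rkhs_complete => // e e0; have [N NP] := small e e0; exists N => m n Nm Nn.
  rewrite -chilB_im -lecR; apply: le_trans (knorm_im_le _) _.
  by apply: le_trans (near_u m n) _; rewrite lecR; exact: NP.
pose h : X -> R[i] := fun x => f x +i* g x.
have hH : h \in crkhs by apply/asboolP.
apply/cvg_ex; exists (CHilbert hH); apply/cvgrPdist_lt => -[e e'] e0.
move: e0; rewrite ltcE/= => /andP[/eqP -> e0] {e'}.
have e4 : 0 < e / 4 by rewrite divr_gt0.
have /cvgrPdist_le/(_ _ e4)[N1 _ N1P] := uf.
have /cvgrPdist_le/(_ _ e4)[N2 _ N2P] := ug.
have /cvgrPdist_le/(_ _ e4)[N3 _ N3P] := @cvg_harmonic R.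
pose N := maxn N1 (maxn N2 N3).
have k1 : knorm K (re (u N) - f) <= e / 4.
  have := N1P N; rewrite /= !leq_max leqnn /= => /(_ isT).
  by rewrite sub0r normrN; exact/le_trans/ler_norm.
have k2 : knorm K (im (u N) - g) <= e / 4.
  have := N2P N; rewrite /= !leq_max leqnn /= orbT => /(_ isT).
  by rewrite sub0r normrN; exact/le_trans/ler_norm.
have k3 : N.+1%:R^-1 <= e / 4.
  have := N3P N; rewrite /= !leq_max leqnn /= !orbT => /(_ isT).
  by rewrite sub0r normrN; exact/le_trans/ler_norm.
have d : `|u N - CHilbert hH| <= (e / 2)%:C.
  apply: le_trans (chil_norm_le _) _; rewrite chilB_re chilB_im lecR.
  have -> : re (CHilbert hH) = f by [].
  have -> : im (CHilbert hH) = g by [].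
  by lra.
apply: filterS (uP N) => y /= yu.
rewrite -[CHilbert hH](subrK (u N)) -addrA; apply: le_lt_trans (ler_normD _ _) _.
rewrite distrC; have -> : e +i* 0 = (e / 2)%:C + (e / 2)%:C by rewrite -rmorphD -splitr.
apply: ler_ltD => //; apply: lt_le_trans yu _; rewrite lecR.
by apply: le_trans k3 _; lra.
Qed.

HB.instance Definition _ := Uniform_isComplete.Build chilbert chil_complete.

Definition rkhs_hilbert : hilbertType R :=
  @HilbertType R chilbert cinner cnorm_sqr.

End ComplexHilbert.

(** * Property (T) and invariant kernels *)

Section RegularRepresentation.
Variables (R : realType) (gT : groupType) (K : psd_kernel R gT).
Hypothesis Kinv : forall u x y, K (x * u)%g (y * u)%g = K x y.
Local Open Scope complex_scope.

Definition shift_comb u (t : seq (R * gT)) := [seq (p.1, (p.2 * u)%g) | p <- t].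
Definition rshift {T} u (f : gT -> T) : gT -> T := fun g => f (g * u)%g.

Lemma eval_rshift u f t : comb_eval (rshift u f) t = comb_eval f (shift_comb u t).
Proof. by rewrite /comb_eval big_map. Qed.

Lemma form_shift u s t : kform K (shift_comb u s) (shift_comb u t) = kform K s t.
Proof.
rewrite /kform big_map; apply: eq_bigr => p _; rewrite big_map.
by apply: eq_bigr => q _; rewrite Kinv.
Qed.

Lemma section_of_shift u s :
  section_of K (shift_comb u s) = rshift u^-1%g (section_of K s).
Proof.
apply/funext => x; rewrite /section_of /rshift big_map; apply: eq_bigr => p _ /=.
by rewrite -(Kinv u _ (x * u^-1)%g) mulgVK.
Qed.

Lemma bounded_by_shift u f M : bounded_by K f M -> bounded_by K (rshift u f) M.
Proof.
by move=> [M0 fM]; split=> // t; rewrite eval_rshift -(form_shift u); exact: fM.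
Qed.

Lemma rshiftK u (f : gT -> R) : rshift u^-1%g (rshift u f) = f.
Proof. by apply/funext => x; rewrite /rshift mulgVK. Qed.

Lemma knorm_shift u f : in_rkhs K f -> knorm K (rshift u f) = knorm K f.
Proof.
move=> fH; have fb := bounded_by_shift u (in_rkhs_bounded fH).
apply: le_anti; apply/andP; split; first exact: knorm_le.
by have := bounded_by_shift u^-1%g (knormP fb); rewrite rshiftK; exact: knorm_le.
Qed.

Lemma in_rkhs_shift u f : in_rkhs K f -> in_rkhs K (rshift u f).
Proof.
move=> fH e e0; have [s fs] := fH e e0; exists (shift_comb u^-1%g s).
by rewrite section_of_shift invgK; exact: (bounded_by_shift u fs).
Qed.

Lemma crkhs_shift u (F : chilbert K) : rshift u (F : gT -> R[i]) \in crkhs K.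
Proof.
case: F => F /= /asboolP[F1 F2]; apply/asboolP.
by split; [exact: (in_rkhs_shift u F1)|exact: (in_rkhs_shift u F2)].
Qed.

Definition regular_rep u (F : rkhs_hilbert K) : rkhs_hilbert K :=
  CHilbert (crkhs_shift u F).

Lemma regular_rep_unitary : unitary_rep regular_rep.
Proof.
split.
- by move=> u a F G; apply: val_inj.
- by move=> F; apply: val_inj; apply/funext => x /=; rewrite /rshift mulg1.
- by move=> u v F; apply: val_inj; apply/funext => x /=; rewrite /rshift mulgA.
- move=> u F G; rewrite /= /cinner.
  have kI f g : in_rkhs K f -> in_rkhs K g ->
      kinner K (rshift u f) (rshift u g) = kinner K f g.
    move=> fH gH; rewrite /kinner -(knorm_shift u (in_rkhsD fH gH)).
    by rewrite -(knorm_shift u (in_rkhsB fH gH)).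
  have [F1 F2] := (chil_re F, chil_im F); have [G1 G2] := (chil_re G, chil_im G).
  by congr (_ +i* _); congr (_ + _); rewrite -?(kI _ _ F1 G1) -?(kI _ _ F2 G2) -?(kI _ _ F2 G1) -?(kI _ _ F1 G2).
Qed.

End RegularRepresentation.

(** The section of K at the unit is a unit vector v of the reproducing kernel space
with ||k v - v||^2 = 2 (1 - K(1, k)), hence almost invariant under the regular
representation.  An invariant vector is a constant function, so the space contains
1; approximation in norm is uniform approximation because K(g, g) = 1. *)
Lemma kazhdan_kernel (R : realType) (gT : groupType) : kazhdan R gT ->
  exists (S : seq gT) (eps : R), 0 < eps /\
  forall K : psd_kernel R gT, (forall u x y, K (x * u)%g (y * u)%g = K x y) ->
    K 1%g 1%g = 1 -> (forall k, k \in S -> 1 - K 1%g k < eps) ->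
    forall d, 0 < d ->
      exists s, forall g, `|section_of K s g - 1| <= d.
Proof.
move=> [S [eps [eps0 SP]]]; exists S, (eps ^+ 2 / 2); split.
  by rewrite divr_gt0// exprn_gt0.
move=> K Kinv K11 KS d d0.
have Kd g : K g g = 1 by rewrite -K11 -(Kinv g 1%g) !mul1g.
pose f := section_of K [:: (1, 1%g)].
have fE g : f g = K 1%g g by rewrite /f /section_of big_seq1 mul1r.
pose F : gT -> R[i] := fun g => (f g)%:C%C.
have FH : F \in crkhs K.
  apply/asboolP; split; first exact: in_rkhs_section.
  rewrite (_ : im F = 0) // -(@section_of_nil _ _ K); exact: in_rkhs_section.
pose v : rkhs_hilbert K := CHilbert FH.
have z0 : knorm K (0 : gT -> R) = 0.
  have := knorm_section K [::]; rewrite section_of_nil /kform big_nil.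
  by move=> /eqP; rewrite expf_eq0 => /andP[_ /eqP].
have nreal (G : rkhs_hilbert K) : im G = 0 -> `|G| = (knorm K (re G))%:C%C.
  move=> G0; rewrite chil_normE /cnorm G0 z0 normc_def /= expr0n addr0 sqrtr_sqr.
  by rewrite ger0_norm// knorm_ge0//; case: (G) => ? /= /asboolP[].
have nv : `|v| = 1.
  rewrite nreal//; suff : knorm K f ^+ 2 = 1.
    move=> /eqP; rewrite sqrf_eq1 => /orP[/eqP -> //|/eqP fN].
    have : 0 <= knorm K f by apply: knorm_ge0; exact: in_rkhs_section.
    by rewrite fN => h; exfalso; move: h; lra.
  by rewrite knorm_section /kform !big_seq1 K11 !mul1r.
have v0 : v != 0 by rewrite -normr_eq0 nv oner_eq0.
have inv (k : gT) : k \in S -> `|regular_rep Kinv k v - v| < eps%:C%C * `|v|.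
  move=> kS; rewrite nv mulr1 nreal; last first.
    by rewrite chilB_im; apply/funext => x; rewrite /im !fctE/= subr0.
  rewrite ltcR chilB_re.
  have -> : re (regular_rep Kinv k v) - re v =
      section_of K ([:: (1, k^-1%g)] ++ scale_comb (-1) [:: (1, 1%g)]).
    rewrite section_of_cat section_of_scale_comb scaleN1r; congr (_ - _).
    apply/funext => g; rewrite /section_of big_seq1 mul1r /=.
    by rewrite /re /= /rshift /F fE -(Kinv k k^-1%g) mulVg.
  rewrite -(ltr_pXn2r (n := 2)) ?nnegrE ?(ltW eps0)//; last first.
    by apply: knorm_ge0; exact: in_rkhs_section.
  rewrite knorm_section /kform/= !big_cons !big_nil /= !Kd.
  have := KS _ kS; rewrite -(Kinv k^-1%g) mulgV mul1g (kern_sym K 1%g).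
  by lra.
have [w [w0 wI]] := SP _ _ (regular_rep_unitary Kinv) (ex_intro _ v (conj v0 inv)).
have wc g : (w : gT -> R[i]) g = (w : gT -> R[i]) 1%g.
  by rewrite -[w in RHS](wI g) /= /rshift mul1g.
have [reH imH] : in_rkhs K (re w) /\ in_rkhs K (im w).
  by split; case: (w) => ? /= /asboolP[].
have [c cN0 cH] : exists2 c : R, c != 0 & in_rkhs K (fun=> c).
  have wre : re w = fun=> complex.Re ((w : gT -> R[i]) 1%g).
    by apply/funext => g; rewrite /re wc.
  have wim : im w = fun=> complex.Im ((w : gT -> R[i]) 1%g).
    by apply/funext => g; rewrite /im wc.
  have : (w : gT -> R[i]) 1%g != 0.
    apply: contra w0 => /eqP w1; apply/eqP/val_inj/funext => g /=.
    by rewrite wc w1.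
  rewrite eq_complex negb_and => /orP[cN|cN].
    by exists (complex.Re ((w : gT -> R[i]) 1%g)) => //; rewrite -wre.
  by exists (complex.Im ((w : gT -> R[i]) 1%g)) => //; rewrite -wim.
have oneH : in_rkhs K (fun=> 1).
  have := in_rkhsZ c^-1 cH; rewrite (_ : _ *: _ = fun=> 1)//.
  by apply/funext => g; rewrite !fctE /= -[LHS]/(c^-1 * c) mulVf.
have [s sP] := oneH d d0; exists s => g.
have := bounded_by_pt g sP; rewrite Kd sqrtr1 mulr1 distrC; exact.
Qed.

(** * Schur products and bounded cocycles *)

Section SquareIntegrable.
Context d (T : measurableType d) (R : realType) (mu : {measure set T -> \bar R}).
Implicit Types f g : T -> R.

Definition rintegrable f := mu.-integrable setT (EFin \o f).

Lemma rintegrableD f g : rintegrable f -> rintegrable g ->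
  rintegrable (fun x => f x + g x).
Proof. exact: integrableD. Qed.

Lemma rintegrableZ a f : rintegrable f -> rintegrable (fun x => a * f x).
Proof. exact: integrableZl. Qed.

Lemma rintegrable_sum I (s : seq I) (f : I -> T -> R) :
  (forall i, rintegrable (f i)) ->
  rintegrable (fun x => \sum_(i <- s) f i x) /\
  \int[mu]_x (\sum_(i <- s) f i x) = \sum_(i <- s) \int[mu]_x f i x.
Proof.
move=> fi; elim: s => [|i s [sI sE]].
  split.
    rewrite /rintegrable (_ : _ \o _ = cst 0%E); first exact: integrable0.
    by apply/funext => x /=; rewrite big_nil.
  rewrite big_nil; under eq_Rintegral do rewrite big_nil.
  by rewrite Rintegral_cst// mul0r.
split.
  rewrite (_ : (fun x => _) = (fun x => f i x + \sum_(j <- s) f j x)).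
    exact: rintegrableD.
  by apply/funext => x; rewrite big_cons.
rewrite big_cons -sE -(RintegralD measurableT (fi i) sI).
by apply: eq_Rintegral => x _; rewrite big_cons.
Qed.

Definition sq_integrable f :=
  measurable_fun setT f /\ (\int[mu]_x (f x ^+ 2)%:E < +oo)%E.

Lemma sq_integrableP f : sq_integrable f ->
  measurable_fun setT f /\ rintegrable (fun x => f x ^+ 2).
Proof.
move=> [mf f2]; split=> //; apply/integrableP; split.
  by apply/measurable_EFinP; exact: measurable_funX.
by under eq_integral do rewrite /= ger0_norm ?sqr_ge0//.
Qed.

Lemma sq_integrableM f g : sq_integrable f -> sq_integrable g ->
  rintegrable (fun x => f x * g x).
Proof.
move=> /sq_integrableP[mf If] /sq_integrableP[mg Ig].
apply: (le_integrable measurableT _ _ (rintegrableD If Ig)).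
  by apply/measurable_EFinP; exact: measurable_funM.
move=> x _ /=; rewrite lee_fin ler_norml ger0_norm ?addr_ge0 ?sqr_ge0//.
by apply/andP; split; nra.
Qed.

Lemma sq_integrable_lin a f g : sq_integrable f -> sq_integrable g ->
  sq_integrable (fun x => f x + a * g x).
Proof.
move=> fS gS; have [mf If] := sq_integrableP fS; have [mg Ig] := sq_integrableP gS.
split; first by apply: measurable_funD => //; exact: measurable_funM.
have /integrableP[_] := rintegrableD If (rintegrableD (rintegrableZ (2 * a)
  (sq_integrableM fS gS)) (rintegrableZ (a ^+ 2) Ig)).
rewrite (eq_integral (fun x => ((f x + a * g x) ^+ 2)%:E))// => x _ /=.
have -> : f x ^+ 2 + (2 * a * (f x * g x) + a ^+ 2 * g x ^+ 2) = (f x + a * g x) ^+ 2.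
  by ring.
by rewrite ger0_norm ?sqr_ge0.
Qed.

Definition dist2 f g : R := \int[mu]_x (f x - g x) ^+ 2.

Lemma dist2_ge0 f g : 0 <= dist2 f g.
Proof. by apply: Rintegral_ge0 => x _; exact: sqr_ge0. Qed.

Lemma sq_integrableB f g : sq_integrable f -> sq_integrable g ->
  rintegrable (fun x => (f x - g x) ^+ 2).
Proof.
move=> fS gS; have [_] := sq_integrableP (sq_integrable_lin (-1) fS gS).
by rewrite (_ : (fun x => (f x + -1 * g x) ^+ 2) = (fun x => (f x - g x) ^+ 2))//; apply/funext => x; rewrite mulN1r.
Qed.

Lemma dist2_split f g h : sq_integrable f -> sq_integrable g -> sq_integrable h ->
  dist2 f h <= 2 * dist2 f g + 2 * dist2 g h.
Proof.
move=> fS gS hS; rewrite /dist2 -!RintegralZl//; try exact: sq_integrableB.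
rewrite -RintegralD//; try by apply: rintegrableZ; exact: sq_integrableB.
apply: le_Rintegral => //; first exact: sq_integrableB.
  by apply: rintegrableD; apply: rintegrableZ; exact: sq_integrableB.
move=> x _; have := sqr_ge0 (f x - g x - (g x - h x)).
by nra.
Qed.

Lemma dist2E f g : sq_integrable f -> sq_integrable g ->
  dist2 f g = \int[mu]_x (f x ^+ 2) + \int[mu]_x (g x ^+ 2)
     - 2 * \int[mu]_x (f x * g x).
Proof.
move=> fS gS; have [_ If] := sq_integrableP fS; have [_ Ig] := sq_integrableP gS.
have Ifg := sq_integrableM fS gS.
rewrite -RintegralZl// -RintegralD// -RintegralB//; last 2 first.
- exact: rintegrableD.
- exact: rintegrableZ.
by apply: eq_Rintegral => x _; ring.
Qed.

End SquareIntegrable.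

Section Schur.
Variables (R : realType) (X : Type).
Implicit Types (K : X -> X -> R) (s : seq (R * X)).

Definition psd K := forall s, 0 <= kform K s s.

Lemma psd_add K K' : psd K -> psd K' -> psd (fun x y => K x y + K' x y).
Proof.
move=> KP K'P s; rewrite (_ : kform _ _ _ = kform K s s + kform K' s s).
  exact: addr_ge0.
rewrite /kform -big_split; apply: eq_bigr => p _; rewrite -big_split.
by apply: eq_bigr => q _; rewrite mulrDr.
Qed.

Lemma psd_scale a K : 0 <= a -> psd K -> psd (fun x y => a * K x y).
Proof.
move=> a0 KP s; rewrite (_ : kform _ _ _ = a * kform K s s); first exact: mulr_ge0.
rewrite /kform mulr_sumr; apply: eq_bigr => p _; rewrite mulr_sumr.
by apply: eq_bigr => q _; rewrite mulrCA.
Qed.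

Lemma psd_rank1 (u : X -> R) K : psd K -> psd (fun x y => u x * u y * K x y).
Proof.
move=> KP s; have := KP [seq (p.1 * u p.2, p.2) | p <- s].
rewrite /kform big_map; congr (0 <= _); apply: eq_bigr => p _.
by rewrite big_map; apply: eq_bigr => q _ /=; ring.
Qed.

Lemma psd_cst a : 0 <= a -> psd (fun _ _ => a).
Proof.
move=> a0 s; rewrite /kform (_ : \sum_(p <- s) _ = (\sum_(p <- s) p.1) ^+ 2 * a).
  by rewrite mulr_ge0 ?sqr_ge0.
rewrite expr2 -mulrA mulr_suml; apply: eq_bigr => p _.
by rewrite mulr_suml mulr_sumr; apply: eq_bigr => q _; rewrite mulrA.
Qed.

Lemma psd_cvg (K_ : nat -> X -> X -> R) K : (forall n, psd (K_ n)) ->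
  (forall x y, K_ n x y @[n --> \oo] --> K x y) -> psd K.
Proof.
move=> KP KC s.
have c : kform (K_ n) s s @[n --> \oo] --> kform K s s.
  rewrite /kform; elim: {1 3}s => [|p s' IH].
    by rewrite big_nil; under eq_fun do rewrite big_nil; exact: cvg_cst.
  rewrite big_cons; under eq_fun do rewrite big_cons.
  apply: cvgD; last exact: IH.
  elim: (s) => [|q t IH'].
    by rewrite big_nil; under eq_fun do rewrite big_nil; exact: cvg_cst.
  rewrite big_cons; under eq_fun do rewrite big_cons.
  by apply: cvgD; [apply: cvgM; [exact: cvg_cst|exact: KC]|exact: IH'].
rewrite -(cvg_lim _ c)//; apply: limr_ge; first by apply/cvg_ex; eexists; exact: c.
by apply: nearW => n; exact: KP.
Qed.

Context d (T : measurableType d) (mu : {measure set T -> \bar R}).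
Variable b : X -> T -> R.
Hypothesis bS : forall x, sq_integrable mu (b x).

Definition gram x y := \int[mu]_z (b x z * b y z).

(** Schur's product theorem: for fixed z the kernel b_x(z) b_y(z) K(x, y) is a rank
one twist of K, and the Gram matrix averages these over z. *)
Lemma psd_schur K : psd K -> psd (fun x y => K x y * gram x y).
Proof.
move=> KP s.
have -> : kform (fun x y => K x y * gram x y) s s =
    \int[mu]_z (\sum_(p <- s) \sum_(q <- s)
      p.1 * q.1 * K p.2 q.2 * (b p.2 z * b q.2 z)).
  have I1 p q : rintegrable mu (fun z => p.1 * q.1 * K p.2 q.2 * (b p.2 z * b q.2 z)).
    exact/rintegrableZ/sq_integrableM.
  have I2 p := rintegrable_sum s (I1 p).
  rewrite (rintegrable_sum s (fun p => (I2 p).1)).2; apply: eq_bigr => p _.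
  rewrite (I2 p).2; apply: eq_bigr => q _.
  by rewrite RintegralZl ?mulrA//; exact: sq_integrableM.
apply: Rintegral_ge0 => z _.
have := psd_rank1 (fun x => b x z) KP s.
rewrite /kform; congr (0 <= _); apply: eq_bigr => p _; apply: eq_bigr => q _.
by ring.
Qed.

Lemma psd_gramX n : psd (fun x y => gram x y ^+ n).
Proof.
elim: n => [|n IH]; first by under eq_fun do under eq_fun do rewrite expr0; exact: psd_cst.
by under eq_fun do under eq_fun do rewrite exprSr; exact: psd_schur.
Qed.

Lemma psd_exp_gram a : 0 <= a -> psd (fun x y => expR (a * gram x y)).
Proof.
move=> a0; pose K_ n x y := series (exp_coeff (a * gram x y)) n.
apply: (@psd_cvg K_); last by move=> x y; exact: is_cvg_series_exp_coeff.
elim=> [|n IH].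
  have -> : K_ 0%N = (fun _ _ => 0).
    by apply/funext => x; apply/funext => y; rewrite /K_ /series /= big_geq.
  exact: psd_cst.
rewrite (_ : K_ n.+1 = fun x y => K_ n x y + a ^+ n / n`!%:R * gram x y ^+ n).
  apply: psd_add => //; apply: psd_scale; last exact: psd_gramX.
  by rewrite divr_ge0 ?exprn_ge0.
apply/funext => x; apply/funext => y.
by rewrite /K_ /series /= big_nat_recr//= /exp_coeff /= exprMn mulrAC.
Qed.

(** Schoenberg: ||b_x - b_y||^2 = ||b_x||^2 + ||b_y||^2 - 2 <b_x, b_y>, so the kernel is a
rank one twist of exp(2 a <b_x, b_y>). *)
Lemma psd_exp_dist2 a : 0 <= a -> psd (fun x y => expR (- a * dist2 mu (b x) (b y))).
Proof.
move=> a0; have a2 : 0 <= a * 2 by rewrite mulr_ge0.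
have := psd_rank1 (fun x => expR (- a * \int[mu]_z (b x z ^+ 2))) (psd_exp_gram a2).
congr psd; apply/funext => x; apply/funext => y.
by rewrite -!expRD dist2E// /gram; congr expR; ring.
Qed.

End Schur.

(** Delorme's theorem for cocycles in L^2.  The kernel exp(-t psi) satisfies the
hypotheses of [kazhdan_kernel] for small t, and a fixed combination of its sections
is less than 1/2 in absolute value at any g far from the points of the
combination, so it cannot be close to 1 there. *)
Lemma kazhdan_bounded (R : realType) (gT : groupType) d (T : measurableType d)
    (mu : {measure set T -> \bar R}) (b : gT -> T -> R) :
  kazhdan R gT -> (forall g, sq_integrable mu (b g)) ->
  (forall u x y, dist2 mu (b (x * u)%g) (b (y * u)%g) = dist2 mu (b x) (b y)) ->
  exists M, forall g, dist2 mu (b g) (b 1%g) <= M.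
Proof.
move=> /kazhdan_kernel[S [eps [eps0 SP]]] bS bI.
pose psi x y := dist2 mu (b x) (b y).
have psi0 x y : 0 <= psi x y by exact: dist2_ge0.
have psiC x y : psi x y = psi y x.
  by apply: eq_Rintegral => z _; rewrite -sqrrN opprB.
pose P := \sum_(k <- S) psi 1%g k.
have P0 : 0 <= P by apply: sumr_ge0.
have PS k : k \in S -> psi 1%g k <= P.
  move=> kS; rewrite /P (big_rem k)//= lerDl; exact: sumr_ge0.
pose t := eps / (P + 1).
have P1 : 0 < P + 1 by rewrite ltr_wpDl.
have t0 : 0 < t by rewrite divr_gt0.
pose K := PsdKernel
  (kern := fun x y => expR (- t * psi x y))
  (fun x y => congr1 expR (congr1 (fun z => - t * z) (psiC x y)))
  (psd_exp_dist2 bS (ltW t0)).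
have psixx x : psi x x = 0.
  rewrite /psi /dist2; under eq_Rintegral do rewrite subrr expr0n /=.
  by rewrite Rintegral_cst// mul0r.
have [||k kS||] := SP K _ _ _ (2^-1).
- by move=> u x y; rewrite /= /psi bI.
- by rewrite /= psixx mulr0 expR0.
- rewrite /= ltrBlDr.
  have := expR_ge1Dx (- t * psi 1%g k).
  suff : t * psi 1%g k < eps by lra.
  apply: (@le_lt_trans _ _ (t * P)); first by rewrite ler_pM2l// PS.
  by rewrite /t mulrAC ltr_pdivrMr// ltr_pM2l// ltrDl.
- by rewrite invr_gt0.
move=> s sP; pose C := \sum_(p <- s) `|p.1|.
have C0 : 0 <= C by exact: sumr_ge0.
(* With t * L = 2 C one has C exp(- t L) <= C / (1 + 2 C) < 1/2. *)
pose L := 2 * C / t.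
have L0 : 0 <= L by apply: divr_ge0; [exact: mulr_ge0|exact: ltW].
pose Q := \sum_(p <- s) psi p.2 1%g.
exists (2 * L + 2 * Q) => g; rewrite leNgt; apply/negP => gbig.
have far p : p \in [seq q.2 | q <- s] -> L <= psi p g.
  move=> /[dup] ps.
  have : psi p 1%g <= Q.
    rewrite /Q -(big_map snd xpredT (fun x => psi x 1%g)).
    by rewrite (big_rem p)//= lerDl; exact: sumr_ge0.
  have := dist2_split (bS g) (bS p) (bS 1%g).
  rewrite -/(psi g 1%g) -/(psi g p) -/(psi p 1%g) (psiC g p) => h1 h2 _.
  by move: gbig; rewrite -/(psi g 1%g); lra.
have : `|section_of K s g| <= C / (1 + t * L).
  rewrite /section_of; apply: le_trans (ler_norm_sum _ _ _) _.
  rewrite /C mulr_suml big_seq [leRHS]big_seq; apply: ler_sum => p ps.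
  rewrite normrM ler_wpM2l// ger0_norm ?expR_ge0//=.
  have /far pL : p.2 \in [seq q.2 | q <- s] by exact: map_f.
  have tL : 0 <= t * L by rewrite mulr_ge0// ltW.
  rewrite mulNr expRN lef_pV2 ?posrE ?expR_gt0 ?ltr_wpDr//.
  apply: le_trans (expR_ge1Dx _); rewrite lerD2l ler_pM2l//.
have -> : t * L = 2 * C by rewrite /L mulrC divfK ?gt_eqF.
have D0 : 0 < 1 + 2 * C by lra.
rewrite ler_pdivlMr// => h.
have := sP g; rewrite ler_norml => /andP[h1 _].
have h3 := ler_norm (section_of K s g).
have h4 : 2^-1 <= `|section_of K s g| by lra.
have := ler_pM2r D0 2^-1 `|section_of K s g|; rewrite h4; lra.
Qed.

(** * Antiderivatives and the angular coordinate *)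

Section Antiderivative.
Variable R : realType.
Implicit Types f F : R -> R.

(** For f vanishing near -oo the integral over ]-oo, x] is a primitive. *)
Lemma antiderivative_left0 f a : continuous f -> (forall t, t <= a -> f t = 0) ->
  exists F, forall x, is_derive x (1 : R) F (f x).
Proof.
move=> cf f0; pose mu := @lebesgue_measure R.
pose F x := (\int[mu]_(t in [set` `]-oo, x]]) (f t))%R.
have mf : measurable_fun setT f by exact: continuous_measurable_fun.
have fi u : mu.-integrable [set` `]-oo, u]] (EFin \o f).
  have [ua|au] := leP u a.
    apply: (eq_integrable _ (cst 0%E)) => //; last exact: integrable0.
    move=> x; rewrite inE/= in_itv/= => xu.
    by rewrite f0// (le_trans xu ua).
  have fE : mu.-integrable [set` `]-oo, u]] (EFin \o f \_ `[a, u]).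
    rewrite -restrict_EFin; apply/integrable_restrict => //.
    rewrite setIidr; last by move=> x /=; rewrite !in_itv/= => /andP[].
    apply: continuous_compact_integrable; first exact: segment_compact.
    exact: continuous_subspaceT.
  apply: eq_integrable fE => //; move=> x; rewrite inE/= in_itv/= => xu.
  rewrite patchE; case: ifPn => //; rewrite notin_setE/= in_itv/= xu andbT => /negP.
  by rewrite -ltNge => /ltW/f0 ->.
exists F => x.
have xu : x < x + 1 by rewrite ltrDl.
have [Fd FE] := continuous_FTC1 xu (fi _) (ltNyr x) (cf x).
by rewrite -FE derive1E; exact: DeriveDef.
Qed.

(** A cut-off splits f into a part vanishing on the left and a part vanishing on the
right; the second is reflected. *)
Lemma antiderivative f : continuous f ->
  exists F, forall x, is_derive x (1 : R) F (f x).
Proof.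
move=> cf; pose chi (x : R) := Num.min (Num.max x 0) 1.
have cchi : continuous chi.
  apply: (@min_fun_continuous _ R R (fun x => Num.max x 0) (cst 1)).
    apply: (@max_fun_continuous _ R R id (cst 0)).
      by move=> ?; exact: cvg_id.
    by move=> ?; exact: cvg_cst.
  by move=> ?; exact: cvg_cst.
have [||A AP] := @antiderivative_left0 (fun x => f x * chi x) 0.
- by move=> x; apply: cvgM; [exact: cf|exact: cchi].
- by move=> t t0; rewrite /chi max_r// min_l ?mulr0.
have [||B BP] := @antiderivative_left0 (fun x => f (- x) * (1 - chi (- x))) (-1).
- move=> x; apply: (@continuous_comp _ _ _ -%R (fun x => f x * (1 - chi x))).
    exact: opp_continuous.
  apply: cvgM; first exact: cf.
  by apply: cvgB; [exact: cvg_cst|exact: cchi].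
- move=> t t0; rewrite /chi max_l; last lra.
  by rewrite min_r ?subrr ?mulr0//; lra.
(* A is a primitive of f chi and - B(- x) one of f (1 - chi). *)
exists (fun x => A x - B (- x)) => x.
have BN : is_derive x (1 : R) (fun x => B (- x)) (- (f x * (1 - chi x))).
  have := BP (- x); rewrite opprK => BNx.
  have idN : is_derive x (1 : R) -%R (-1 : R) by exact: is_deriveNid.
  by have := is_derive1_comp BNx idN; rewrite mulrN1.
have -> : f x = f x * chi x - (- (f x * (1 - chi x))) by ring.
exact: is_deriveB.
Qed.

End Antiderivative.

Section Angle.
Variable R : realType.
Local Open Scope quotient_scope.
Implicit Types (x y t : R) (p q : circle R).
Local Notation pi := (@pi R).

Lemma angleD x y : angle (x + y) = angle x + angle y.
Proof. exact: raddfD. Qed.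

Lemma angleB x y : angle (x - y) = angle x - angle y.
Proof. exact: raddfB. Qed.

Lemma angleN x : angle (- x) = - angle x.
Proof. exact: raddfN. Qed.

Lemma angle0 : angle (0 : R) = 0.
Proof. exact: raddf0. Qed.

Lemma angle_eqP x y : angle x = angle y <-> exists k : int, x = y + 2 * pi * k%:~R.
Proof.
have pi2 : 2 * pi != 0 :> R by rewrite mulf_neq0 ?gt_eqF ?pi_gt0.
have -> : (angle x = angle y) <-> two_pi_Z (x - y).
  split=> [|h]; first by move=> /eqP; rewrite -(Quotient.idealrBE (@two_pi_Z R)).
  by apply/eqP; rewrite -(Quotient.idealrBE (@two_pi_Z R)).
rewrite /two_pi_Z; split=> [/intrP[k kE]|[k ->]].
  by exists k; rewrite -kE mulrCA divff// mulr1 addrC subrK.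
by rewrite addrAC subrr add0r mulrAC divff// mul1r intr_int.
Qed.

Lemma angle2pi : angle (2 * pi) = 0.
Proof. by rewrite -angle0; apply/angle_eqP; exists 1; rewrite add0r mulr1. Qed.

Lemma angleK t : - pi < t <= pi -> ang (angle t) = t.
Proof.
move=> /andP[t1 t2]; have := ang_itv (angle t); rewrite in_itv/= => /andP[a1 a2].
have /angle_eqP[k kE] := angK (angle t); rewrite kE in a1 a2 *.
have p0 := pi_gt0 R.
suff -> : k = 0 by rewrite mulr0 addr0.
have k1 : (k%:~R : R) < 1 by rewrite -(ltr_pM2l (_ : 0 < 2 * pi)) ?mulr_gt0//; lra.
have k2 : (-1 : R) < k%:~R by rewrite -(ltr_pM2l (_ : 0 < 2 * pi)) ?mulr_gt0//; lra.
apply/eqP; rewrite eq_le; apply/andP; split.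
  by rewrite -ltzD1 -(ltr_int R) add0r.
by rewrite -(ler_int R) -[0%:~R]/(0 : R) leNgt; apply/negP => h; move: k2; rewrite ltNge => /negP; apply; rewrite -[-1]/((-1)%:~R) ler_int -ltzD1 subrr -(ltr_int R).
Qed.

Lemma ang0 : ang (0 : circle R) = 0.
Proof. by rewrite -angle0 angleK// pi_ge0 andbT oppr_lt0 pi_gt0. Qed.

Lemma ang_eq0 p : ang p = 0 -> p = 0.
Proof. by move=> p0; rewrite -(angK p) p0 angle0. Qed.

Lemma ang_le_pi p : `|ang p| <= pi.
Proof.
have := ang_itv p; rewrite in_itv/= => /andP[h1 h2]; rewrite ler_norml.
by rewrite h2 (ltW h1).
Qed.

Lemma ang_angle_le t : `|ang (angle t)| <= `|t|.
Proof.
have [h|h] := ltP `|t| pi; last exact: le_trans (ang_le_pi _) h.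
by rewrite angleK//; move: h; rewrite ltr_norml => /andP[-> /ltW ->].
Qed.

Lemma ang_shift t : exists k : int, t = ang (angle t) + 2 * pi * k%:~R.
Proof. by apply/angle_eqP; rewrite angK. Qed.

Lemma cos_periodic (k : int) t : cos (t + 2 * pi * k%:~R) = cos t.
Proof.
have h (n : nat) x : cos (x + 2 * pi * n%:R) = cos x.
  have e : 2 * pi = pi *+ 2 by rewrite mulr_natl.
  elim: n => [|n IH]; first by rewrite mulr0 addr0.
  have -> : x + 2 * pi * n.+1%:R = x + 2 * pi * n%:R + pi *+ 2.
    by rewrite -e -natr1; ring.
  by rewrite cosD2pi.
case: k => n; first by rewrite h.
by rewrite NegzE mulrNz mulrN -(h n.+1) subrK.
Qed.

End Angle.

(** * Lifts of circle maps *)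

Section Lift.
Variable R : realType.
Local Notation pi := (@pi R).
Implicit Types (g h : circle R -> circle R) (G H : R -> R) (x y t : R) (p q : circle R).

Lemma is_derive_continuous G (dG : R -> R) :
  (forall x, is_derive x (1 : R) G (dG x)) -> continuous G.
Proof.
move=> Gd x; apply/differentiable_continuous/derivable1_diffP.
by have [] := Gd x.
Qed.

Lemma MVT_global G (dG : R -> R) : (forall x, is_derive x (1 : R) G (dG x)) ->
  forall x y, x <= y -> exists2 z, x <= z <= y & G y - G x = dG z * (y - x).
Proof.
move=> Gd x y xy; have [|z] := @MVT_segment R G dG x y xy (fun z _ => Gd z).
  exact/continuous_subspaceT/is_derive_continuous.
by rewrite in_itv/=; exists z.
Qed.

Record lift_of g G : Prop := LiftOf {
  lift_angle : forall x, angle (G x) = g (angle x);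
  lift_derive : forall x, is_derive x (1 : R) G (cderive g (angle x));
  lift_period : forall x, G (x + 2 * pi) = G x + 2 * pi }.

(** The cosine detects whether two points of the circle coincide, and, unlike the
representative in ]-pi, pi], it is differentiable. *)
Lemma cos_eq1 t : - pi < t <= pi -> cos t = 1 -> t = 0.
Proof.
move=> /andP[t1 t2] ct.
have ct' : cos `|t| = 1 by case: (ger0P t) => _ //; rewrite cosN.
have h : `|t| \in `[0, pi]%R.
  by rewrite in_itv/= normr_ge0/= ler_norml t2 (ltW t1).
have := @cos_inj R _ _ h _ (etrans ct' (esym (cos0 R))).
rewrite in_itv/= lexx pi_ge0 => /(_ isT)/eqP.
by rewrite normr_eq0 => /eqP.
Qed.

(** Let G be a primitive of the derivative of g with the right value at 0.  The cosine
of the angle between g(x) and G(x) has zero derivative, so it is constantly 1.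
The degree is a positive integer since G increases, and it is 1 because otherwise
g would take some value twice in one turn. *)
Lemma lift_exists g : injective g -> (forall p, cderivable g p) ->
  (forall p, 0 < cderive g p) ->
  continuous (fun t => cderive g (angle t)) -> exists G, lift_of g G.
Proof.
move=> ginj gd gp gc; have [F FP] := antiderivative gc.
pose G x := F x - F 0 + ang (g (angle 0)).
have GP x : is_derive x (1 : R) G (cderive g (angle x)).
  by rewrite -[cderive _ _]addr0 -[X in X + _]subr0; apply: is_deriveD; apply: is_deriveB.
(* The defect phi need not be continuous, but for each x its cosine equals cos u,
   where u, read in the coordinate of the local lift at x, has derivative 0 at x. *)
pose phi x := ang (g (angle x) - angle (G x)).
have cosC p t : p = angle t -> cos (ang p) = cos t.
  by move=> ->; have [k {2}->] := ang_shift t; rewrite cos_periodic.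
have C' x : is_derive x (1 : R) (cos \o phi) 0.
  pose l := local_lift g (angle x).
  have lP : is_derive (0 : R) (1 : R) l (cderive g (angle x)).
    by rewrite /cderive derive1E; apply: DeriveDef => //; exact: gd.
  pose u y := phi x + (l (y - x) - (G y - G x)).
  have uP : is_derive x (1 : R) u 0.
    have d1 : is_derive x (1 : R) (fun y => l (y - x)) (cderive g (angle x)).
      have d0 : is_derive x (1 : R) (fun y => y - x) 1.
        by rewrite -[1 in X in is_derive _ _ _ X]subr0; exact: is_deriveB.
      rewrite -[cderive _ _]mulr1; apply: (@is_derive1_comp _ l (fun y => y - x)).
      by rewrite subrr.
    have -> : (0 : R) = 0 + (cderive g (angle x) - (cderive g (angle x) - 0)).
      by rewrite subr0 subrr addr0.
    by apply: is_deriveD; apply: is_deriveB; exact: is_deriveB.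
  have -> : cos \o phi = cos \o u.
    apply/funext => y /=; rewrite {1}/phi; apply: cosC.
    have e : angle x + angle (y - x) = angle y by rewrite -angleD addrC subrK.
    rewrite /u /phi /l /local_lift e angleD (angleB (ang _)) (angleB (G y)) !angK.
    by rewrite opprB addrCA !subrKA.
  have := @is_derive1_comp _ cos u x _ _ (is_derive_cos _) uP.
  by rewrite mulr0.
have phi0 : phi 0 = 0.
  by rewrite /phi /G subrr add0r angK subrr ang0.
have Gg x : angle (G x) = g (angle x).
  have := is_derive_0_is_cst x 0 C'.
  rewrite /= phi0 cos0 => /cos_eq1 phix0.
  have /ang_eq0/eqP : phi x = 0.
    by apply: phix0; have := ang_itv (g (angle x) - angle (G x)); rewrite in_itv.
  by rewrite subr_eq0 => /eqP.
exists G; split=> // x.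
have pi0 : 0 < pi by exact: pi_gt0.
pose D x := G (x + 2 * pi) - G x.
have D' y : is_derive y (1 : R) D 0.
  have -> : (0 : R) = cderive g (angle (y + 2 * pi)) * 1 - cderive g (angle y).
    by rewrite angleD angle2pi addr0 mulr1 subrr.
  apply: is_deriveB; apply: (@is_derive1_comp _ G (fun y => y + 2 * pi)).
  by rewrite -[1 in X in is_derive _ _ _ X]addr0; exact: is_deriveD.
have Dx : D x = D 0 by exact: (is_derive_0_is_cst x 0 D').
have Gmono a b : a < b -> G a < G b.
  move=> ab; have [z _ E] := MVT_global GP (ltW ab).
  by rewrite -subr_gt0 E mulr_gt0// subr_gt0.
have D0 : 0 < D 0 by rewrite subr_gt0 Gmono// add0r mulr_gt0.
have /angle_eqP[k kE] : angle (D 0) = angle 0.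
  by rewrite /D angleB !Gg angleD angle2pi addr0 subrr angle0.
rewrite add0r in kE.
(* G gains 2 pi k over one turn; if k >= 2 then G takes the value G 0 + 2 pi inside
   the turn, contradicting the injectivity of g. *)
suff k1 : k = 1 by rewrite -(subrK (G x) (G _)) -/(D x) Dx kE k1 mulr1 addrC.
have k0 : (0 < k)%R.
  by move: D0; rewrite kE pmulr_rgt0 ?mulr_gt0// -[0 in X in X -> _]/(0%:~R) ltr_int.
apply/eqP; rewrite eq_le -gtz0_ge1 k0 andbT leNgt; apply/negP => k2.
have k2' : (2 : R) <= k%:~R by rewrite -[2]/(2%:~R) ler_int -ltzD1 ltrD2r.
have cG : {within `[0, 2 * pi], continuous G}.
  exact/continuous_subspaceT/is_derive_continuous.
have [||z] := @IVT _ G 0 (2 * pi) (G 0 + 2 * pi) _ cG.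
- by rewrite mulr_ge0// ltW.
- have GD : G (2 * pi) = G 0 + 2 * pi * k%:~R.
    by rewrite -kE /D add0r addrC subrK.
  have le : G 0 <= G (2 * pi) by rewrite ltW// Gmono// mulr_gt0.
  by rewrite min_l// max_r// GD; apply/andP; split; [nra|rewrite lerD2l; nra].
rewrite in_itv/= => /andP[z0 z2] Gz.
have z1 : z != 0 by apply/eqP => zz; move: Gz; rewrite zz => h; nra.
have z3 : z != 2 * pi.
  apply/eqP => zz; move: Gz; rewrite zz -[G (2 * pi)](subrK (G 0)).
  by rewrite -{1}(add0r (2 * pi)) -/(D 0) kE => h; nra.
have /ginj/angle_eqP[j] : g (angle z) = g (angle 0).
  by rewrite -!Gg Gz angleD angle2pi addr0.
rewrite add0r => zj.
have zp : 0 < z by rewrite lt_def z1.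
have zl : z < 2 * pi by rewrite lt_neqAle z3.
have j0 : (0 < j)%R.
  by move: zp; rewrite zj pmulr_rgt0 ?mulr_gt0// -[0 in X in X -> _]/(0%:~R) ltr_int.
have : (j < 1)%R.
  by move: zl; rewrite zj -[X in _ < X]mulr1 ltr_pM2l ?mulr_gt0// -[1 in X in X -> _]/(1%:~R) ltr_int.
by rewrite ltNge -gtz0_ge1 j0.
Qed.

End Lift.

(** * Change of variables *)

Section WeightedPushforward.
Local Open Scope ereal_scope.
Context d1 d2 (X : measurableType d1) (Y : measurableType d2) (R : realType).
Variables (mu : {measure set X -> \bar R}) (nu : {measure set Y -> \bar R}).
Variables (phi : X -> Y) (w : X -> R).
Hypotheses (mphi : measurable_fun setT phi) (mw : measurable_fun setT w)
  (w0 : forall x, (0 <= w x)%R).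
Hypothesis pushE : forall A, measurable A ->
  \int[mu]_(x in phi @^-1` A) (w x)%:E = nu A.

Import HBNNSimple.

(** The identity for indicator functions is the hypothesis; it extends to simple
functions by linearity and to nonnegative functions by monotone convergence. *)
Lemma ge0_integral_weighted_pushforward (f : Y -> \bar R) :
  measurable_fun setT f -> (forall y, 0 <= f y) ->
  \int[mu]_x (f (phi x) * (w x)%:E) = \int[nu]_y f y.
Proof.
move=> mf f0; pose f_ := nnsfun_approx measurableT mf.
have mpre A : measurable A -> measurable (phi @^-1` A).
  by move=> mA; rewrite -[X in measurable X]setTI; exact: mphi.
have fw n : \int[mu]_x ((f_ n (phi x))%:E * (w x)%:E) = \int[nu]_y (f_ n y)%:E.
  transitivity (\sum_(k \in range (f_ n))
      \int[mu]_x (k * \1_(f_ n @^-1` [set k]) (phi x) * w x)%:E).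
    rewrite -ge0_integral_fsum//; last 2 first.
    - move=> k; apply/measurable_EFinP; apply: measurable_funM => //.
      by apply: measurable_funM => //; exact: measurableT_comp.
    - move=> k x _; rewrite EFinM mule_ge0//; last by rewrite lee_fin.
      by rewrite EFinM nnfun_muleindic_ge0.
    apply: eq_integral => x _; rewrite fsumEFin// -EFinM; congr EFin.
    by rewrite [in LHS](fimfunE (f_ n)) mulr_fsuml.
  under [RHS]eq_integral do rewrite fimfunE -fsumEFin//.
  rewrite ge0_integral_fsum//; last 2 first.
  - by move=> y; exact/measurable_EFinP/measurable_funM.
  - by move=> y x _; rewrite nnfun_muleindic_ge0.
  apply: eq_fsbigr => k _.
  have mk : measurable (f_ n @^-1` [set k]) by [].
  rewrite [RHS]integralZl_indic_nnsfun// integral_indic// setIT -pushE//.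
  have [k0|k0] := leP 0%R k; last first.
    have fk0 : f_ n @^-1` [set k] = set0 by rewrite preimage_nnfun0.
    rewrite fk0 preimage_set0 integral_set0 mule0.
    by under eq_integral do rewrite indic0 mulr0 mul0r; rewrite integral0.
  rewrite -ge0_integralZl//; last 3 first.
  - exact: mpre.
  - exact/measurable_EFinP/measurable_funTS.
  - by move=> x _; rewrite lee_fin.
  rewrite [RHS]integral_mkcond; apply: eq_integral => x _.
  rewrite patchE indicE; case: ifPn => [/set_mem /= xk|xk].
    by rewrite mem_set//= mulr1 EFinM.
  rewrite memNset ?mulr0 ?mul0r// => /= xk'.
  by move: xk; rewrite mem_set.
transitivity (limn (fun n => \int[mu]_x ((f_ n (phi x))%:E * (w x)%:E))).
  rewrite -monotone_convergence//.
  - apply: eq_integral => x _; apply/esym/cvg_lim => //.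
    apply: cvgeZr => //; apply: cvg_nnsfun_approx => //.
  - move=> n; apply: emeasurable_funM; last exact/measurable_EFinP.
    by apply/measurable_EFinP; exact: measurableT_comp.
  - by move=> n x _; rewrite mule_ge0// lee_fin.
  - move=> x _ m n mn; rewrite lee_wpmul2r ?lee_fin//.
    exact/lefP/nd_nnsfun_approx.
under eq_fun do rewrite fw.
rewrite -monotone_convergence//.
- by apply: eq_integral => y _; apply/cvg_lim => //; apply: cvg_nnsfun_approx.
- by move=> n; exact/measurable_EFinP.
- by move=> n y _; rewrite lee_fin.
- by move=> y _ m n mn; rewrite lee_fin; exact/lefP/nd_nnsfun_approx.
Qed.

End WeightedPushforward.

Section Substitution.
Variable R : realType.
Variables (G G' : R -> R).
Hypotheses (Gd : forall x, is_derive x (1 : R) G (G' x))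
  (cG' : continuous G') (G'0 : forall x, 0 < G' x)
  (Gsurj : forall y, exists x, G x = y).
Local Notation mu := (@lebesgue_measure R).

Lemma pos_derive_lt x y : x < y -> G x < G y.
Proof.
move=> xy; have [z _ E] := MVT_global Gd (ltW xy).
by rewrite -subr_gt0 E mulr_gt0// subr_gt0.
Qed.

Lemma pos_derive_ltE : {mono G : x y / x < y}.
Proof.
move=> x y; apply/idP/idP; last exact: pos_derive_lt.
move=> h; rewrite ltNge; apply/negP; rewrite le_eqVlt => /predU1P[yx|/pos_derive_lt].
  by rewrite yx ltxx in h.
by rewrite ltNge (ltW h).
Qed.

Lemma pos_derive_leE : {mono G : x y / x <= y}.
Proof. by move=> x y; rewrite !leNgt pos_derive_ltE. Qed.

Let mG : measurable_fun setT (G : measurableTypeR R -> measurableTypeR R).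
Proof. by apply: continuous_measurable_fun; exact: (is_derive_continuous Gd). Qed.
Let mG' : measurable_fun setT (G' : measurableTypeR R -> measurableTypeR R).
Proof. exact: continuous_measurable_fun. Qed.

Let mpre (A : set (measurableTypeR R)) : measurable A -> measurable (G @^-1` A : set (measurableTypeR R)).
Proof. by move=> mA; rewrite -[X in measurable X]setTI; exact: mG. Qed.

Definition subst_measure (A : set (measurableTypeR R)) : \bar R :=
  (\int[mu]_(t in G @^-1` A) (G' t)%:E)%E.

Let subst0 : subst_measure set0 = 0%E.
Proof. by rewrite /subst_measure preimage_set0 integral_set0. Qed.

Let subst_ge0 A : (0 <= subst_measure A)%E.
Proof. by apply: integral_ge0 => x _; rewrite lee_fin; exact: ltW. Qed.

Let subst_sigma_additive : semi_sigma_additive subst_measure.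
Proof.
move=> F mF tF mUF; rewrite /subst_measure; apply: cvg_toP.
  apply: ereal_nondecreasing_is_cvgn => m n mn.
  apply: lee_sum_nneg_natr => // k _ _.
  by apply: integral_ge0 => /= x Fkx; rewrite lee_fin; exact: ltW.
rewrite preimage_bigcup ge0_integral_bigcup//=.
- by move=> k; exact: mpre.
- by apply/measurable_EFinP; exact: measurable_funTS.
- by move=> x _; rewrite lee_fin; exact: ltW.
- move=> i j _ _ [x [/= Fi Fj]]; apply: (tF i j) => //; by exists (G x).
Qed.

HB.instance Definition _ := isMeasure.Build _ _ _ subst_measure
  subst0 subst_ge0 subst_sigma_additive.

(** Both sides are measures in A, so they agree once they agree on half-open
intervals, where the identity is the fundamental theorem of calculus. *)
Lemma lebesgue_substitution A : measurable A ->
  (\int[mu]_(t in G @^-1` A) (G' t)%:E = mu A)%E.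
Proof.
move=> mA; apply/esym/(@lebesgue_measure_unique R subst_measure) => //.
move=> _ [[a b] _ <-] /=; rewrite /subst_measure.
have [a' a'E] := Gsurj a; have [b' b'E] := Gsurj b.
have -> : G @^-1` [set` `]a, b]] = [set` `]a', b']].
  apply/seteqP; split=> x /=; rewrite !in_itv/= -a'E -b'E.
    by rewrite pos_derive_ltE pos_derive_leE.
  by rewrite pos_derive_ltE pos_derive_leE.
rewrite lebesgue_measure_itv/= lte_fin -a'E -b'E pos_derive_ltE.
case: ifPn => [ab|]; last first.
  by rewrite -leNgt => ba; rewrite set_itv_ge ?integral_set0// bnd_simp -leNgt.
rewrite integral_itv_obnd_cbnd; last exact/measurable_EFinP/measurable_funTS.
rewrite (continuous_FTC2 ab (F := G)) ?EFinB//.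
- exact: continuous_subspaceT.
- have cG := is_derive_continuous Gd.
  split; first by move=> x _; have [] := Gd x.
    exact/cvg_at_right_filter/cG.
  exact/cvg_at_left_filter/cG.
- by move=> x _; rewrite derive1E; have [_ ->] := Gd x.
Qed.

End Substitution.

(** * Rotation-invariance of the circle measure *)

Section CircleMeasure.
Variable R : realType.
Local Notation pi := (@pi R).
Local Notation mu := (@lebesgue_measure R).
Local Notation mR := (measurableTypeR R).
Implicit Types (g h : circle R -> circle R) (G H : R -> R) (a x y t : R) (p q : circle R).

Lemma measurable_circleP d (Y : measurableType d) (f : circle R -> Y) :
  measurable_fun setT (fun t : mR => f (angle t)) -> measurable_fun setT f.
Proof.
move=> mf _ B mB; rewrite setTI.
have := mf measurableT B mB; rewrite setTI => mfB.
by rewrite /measurable/= /circle_measurable /image_set_system/= setTI.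
Qed.

Lemma twopi_gt0 : 0 < 2 * pi :> R. Proof. by rewrite mulr_gt0// pi_gt0. Qed.
Local Hint Resolve twopi_gt0 : core.

Lemma lebesgue_shift c (B : set mR) : measurable B ->
  mu [set t | B (t + c)] = mu B.
Proof.
move=> mB; have d t : is_derive t (1 : R) (fun t => t + c) 1.
  by rewrite -[1 in X in is_derive _ _ _ X]addr0; exact: is_deriveD.
have c1 : continuous (fun _ : R => 1 : R) by move=> ?; exact: cvg_cst.
have s y : exists x, x + c = y by exists (y - c); rewrite subrK.
have := lebesgue_substitution d c1 (fun _ => ltr01) s mB.
rewrite integral_cst/= ?mul1e//.
have : measurable_fun setT (fun t : mR => (t + c : mR)).
  by apply: continuous_measurable_fun; exact: (is_derive_continuous d).
by move=> /(_ measurableT _ mB); rewrite setTI.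
Qed.

Lemma first_turn x : exists k : int, 0 <= x - 2 * pi * k%:~R <= 2 * pi.
Proof.
pose z := x / (2 * pi); pose k := Num.floor z; exists k.
have p0 : 2 * pi != 0 :> R by rewrite gt_eqF.
have {1 2}-> : x = 2 * pi * z by rewrite /z mulrC divfK.
have k1 : k%:~R <= z by have := ge_floor z; rewrite -/k.
have k2 : z < k%:~R + 1 by have := floorD1_gt z; rewrite -/k intrD.
rewrite -mulrBr mulr_ge0 ?(ltW twopi_gt0) ?subr_ge0//=.
by rewrite -[leRHS]mulr1 ler_pM2l//; lra.
Qed.

Definition periodic_set (B : set mR) := forall t, B (t + 2 * pi) <-> B t.

Lemma periodic_set_int B (k : int) : periodic_set B ->
  forall t, B (t + 2 * pi * k%:~R) <-> B t.
Proof.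
move=> pB; have h (n : nat) t : B (t + 2 * pi * n%:R) <-> B t.
  elim: n t => [|n IH] t; first by rewrite mulr0 addr0.
  have -> : t + 2 * pi * n.+1%:R = (t + 2 * pi * n%:R) + 2 * pi.
    by rewrite -natr1; ring.
  by rewrite pB IH.
move=> t; case: k => n; first exact: h.
by rewrite NegzE mulrNz mulrN -(h n.+1) subrK.
Qed.

(** Moving the window from x to y removes [x, y[ and adds its translate by 2 pi, of
the same trace on B; the general case reduces to a window starting in [0, 2 pi]. *)
Lemma measure_turn B a : measurable B -> periodic_set B ->
  mu (B `&` `[a, a + 2 * pi[) = mu (B `&` `[0, 2 * pi[).
Proof.
move=> mB pB.
have mI (x y : R) : measurable (B `&` `[x, y[) by exact: measurableI.
have step x y : x <= y -> y <= x + 2 * pi ->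
    mu (B `&` `[y, y + 2 * pi[) = mu (B `&` `[x, x + 2 * pi[).
  move=> xy yx.
  have -> : `[y, y + 2 * pi[%classic = `[y, x + 2 * pi[ `|` `[x + 2 * pi, y + 2 * pi[ :> set R.
    by rewrite -itv_bndbnd_setU// bnd_simp// lerD2r.
  have -> : `[x, x + 2 * pi[%classic = `[x, y[ `|` `[y, x + 2 * pi[ :> set R.
    by rewrite -itv_bndbnd_setU// bnd_simp.
  rewrite !setIUr !measureU//; last 2 first.
  - rewrite -subset0 => t [[_ /=]]; rewrite !in_itv/= => /andP[_ h] [_ /andP[h' _]].
    by move: h; rewrite ltNge h'.
  - rewrite -subset0 => t [[_ /=]]; rewrite !in_itv/= => /andP[_ h] [_ /andP[h' _]].
    by move: h; rewrite ltNge h'.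
  rewrite addeC; congr (_ + _)%E.
  apply: (etrans (esym (lebesgue_shift (2 * pi) (mI (x + 2 * pi) (y + 2 * pi))))).
  congr (mu _); apply/seteqP; split=> t /= [Bt]; rewrite !in_itv/= lerD2r ltrD2r => h; split=> //; exact/pB.
have [k /andP[r0 r1]] := first_turn a.
pose r := a - 2 * pi * k%:~R; rewrite -/r in r0 r1.
transitivity (mu (B `&` `[r, r + 2 * pi[)).
  rewrite -(lebesgue_shift (2 * pi * k%:~R) (mI a (a + 2 * pi))).
  congr (mu _); apply/seteqP; split=> t /= [Bt]; rewrite !in_itv/= /r => h; split;
    try exact/(periodic_set_int k pB); lra.
by rewrite (step 0 r)// ?add0r.
Qed.

Lemma dthetaE (A : set (circle R)) : dtheta A = mu (@angle R @^-1` A `&` `[0, 2 * pi[).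
Proof. by []. Qed.

Lemma periodic_preimage (A : set (circle R)) : periodic_set (@angle R @^-1` A).
Proof. by move=> t; rewrite /preimage/= angleD angle2pi addr0. Qed.

Lemma measurable_preimage_angle (A : set (circle R)) : measurable A ->
  measurable (@angle R @^-1` A : set mR).
Proof. by move=> mA; rewrite -[X in measurable X]setTI; exact: measurable_angle. Qed.

Lemma dtheta_itv (A : set (circle R)) a : measurable A ->
  dtheta A = mu (@angle R @^-1` A `&` `[a, a + 2 * pi[).
Proof.
move=> mA; rewrite measure_turn//; last exact: periodic_preimage.
exact: measurable_preimage_angle.
Qed.

Lemma ge0_integral_dtheta a (f : circle R -> \bar R) :
  measurable_fun setT f -> (forall p, 0 <= f p)%E ->
  (\int[@dtheta R]_p f p = \int[mu]_(t in `[a, (a + 2 * pi)%R[) f (angle t))%E.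
Proof.
move=> mf f0; pose w t := \1_(`[a, a + 2 * pi[%classic : set mR) t : R.
have mw : measurable_fun (setT : set mR) w by exact: measurable_indic.
have w0 t : 0 <= w t by [].
have wE A : measurable A ->
    (\int[mu]_(t in @angle R @^-1` A) (w t)%:E = dtheta A)%E.
  move=> mA; rewrite integral_indic//; last exact: measurable_preimage_angle.
  by rewrite (dtheta_itv a mA) setIC.
have := @ge0_integral_weighted_pushforward _ _ mR (circle R) R mu (@dtheta R)
  (@angle R) w (measurable_angle (R:=R)) mw w0 wE f mf f0.
move=> <-; rewrite [RHS]integral_mkcond; apply: eq_integral => t _.
by rewrite patchE /w indicE; case: ifPn => _; rewrite ?mule1 ?mule0.
Qed.

End CircleMeasure.

(** * Circle diffeomorphisms *)

Section CircleDiffeo.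
Variable R : realType.
Local Notation pi := (@pi R).
Local Notation mR := (measurableTypeR R).
Implicit Types (g h : circle R -> circle R) (G H : R -> R) (a x y t : R) (p q : circle R).
Let p2 : 0 < 2 * pi :> R := twopi_gt0 R.

(** The consequences of [Diff1] that do not involve the Hoelder exponent; this class is
stable by composition, and it is all that lifts and substitutions use. *)
Record circle_diffeo g : Prop := CircleDiffeo {
  cd_inj : injective g;
  cd_derivable : forall p, cderivable g p;
  cd_pos : forall p, 0 < cderive g p;
  cd_continuous : continuous (fun t => cderive g (angle t)) }.

Lemma circle_diffeo_lift g : circle_diffeo g -> exists G, lift_of g G.
Proof. by case=> *; exact: lift_exists. Qed.

Lemma Diff1_circle_diffeo alpha (g : bijection (circle R)) : 0 < alpha ->
  Diff1 alpha g -> circle_diffeo g.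
Proof.
move=> a0 [gd gp [c gc]]; split=> //; first exact: can_inj (bij_funK g).
have c1 : 0 < `|c| + 1 by rewrite ltr_wpDl.
move=> x; apply/cvgrPdist_lt => e e0.
have r0 : 0 < (e / (`|c| + 1)) `^ alpha^-1 by rewrite powR_gt0// divr_gt0.
near=> y.
have [pq|pq] := eqVneq (@angle R x) (angle y); first by rewrite pq subrr normr0.
have xy : `|x - y| < (e / (`|c| + 1)) `^ alpha^-1.
  by near: y; apply: cvgr_dist_lt => //; exact: cvg_id.
apply: lt_trans (gc _ _ pq) _; rewrite -angleB.
apply: (@le_lt_trans _ _ ((`|c| + 1) * `|x - y| `^ alpha)).
  apply: (@le_trans _ _ ((`|c| + 1) * `|ang (angle (x - y))| `^ alpha)).
    by rewrite ler_wpM2r ?powR_ge0//; apply: le_trans (ler_norm c) _; rewrite lerDl.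
  rewrite ler_pM2l// ge0_ler_powR ?nnegrE ?(ltW a0)//; exact: ang_angle_le.
rewrite mulrC -ltr_pdivlMr//.
have -> : e / (`|c| + 1) = ((e / (`|c| + 1)) `^ alpha^-1) `^ alpha.
  by rewrite -powRrM mulVf ?gt_eqF// powRr1// divr_ge0// ltW.
by rewrite gt0_ltr_powR// ?nnegrE// ltW.
Unshelve. all: by end_near. Qed.

(** The local lift at x is h |-> G(x + h) - G(x) for small h, where this difference
lies in ]-pi, pi]. *)
Lemma cderive_lift g G x a : (forall y, angle (G y) = g (angle y)) ->
  is_derive x (1 : R) G a ->
  cderivable g (angle x) /\ cderive g (angle x) = a.
Proof.
move=> Gg Ga.
suff [d dE] : is_derive (0 : R) (1 : R) (local_lift g (angle x)) a.
  by split=> //; rewrite /cderive derive1E.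
have d0 : is_derive (0 : R) (1 : R) (fun s => x + s) 1.
  by rewrite -[1 in X in is_derive _ _ _ X]add0r; exact: is_deriveD.
have Ga0 : is_derive (x + 0) (1 : R) G a by rewrite addr0.
have d1 : is_derive (0 : R) (1 : R) (fun s => G (x + s) - G x) a.
  rewrite -[a]subr0; apply: is_deriveB; rewrite -[a]mulr1.
  exact: (@is_derive1_comp _ G (fun s => x + s)).
apply: near_eq_is_derive d1.
have cont : {for 0, continuous (fun s => G (x + s) - G x)}.
  apply/differentiable_continuous/derivable1_diffP.
  have d1 : is_derive (0 : R) (1 : R) (fun s => G (x + s) - G x) a.
    rewrite -[a]subr0; apply: is_deriveB; rewrite -[a]mulr1.
    exact: (@is_derive1_comp _ G (fun s => x + s)).
  by have [] := d1.
near=> s; rewrite /local_lift -angleD -!Gg -angleB angleK//.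
have : `|(G (x + 0) - G x) - (G (x + s) - G x)| < pi.
  near: s; move/cvgrPdist_lt : cont; apply; exact: pi_gt0.
rewrite addr0 subrr sub0r normrN ltr_norml => /andP[-> h2].
exact: ltW.
Unshelve. all: by end_near. Qed.

Lemma turn_equivariant_int G x (k : int) : (forall t, G (t + 2 * pi) = G t + 2 * pi) ->
  G (x + 2 * pi * k%:~R) = G x + 2 * pi * k%:~R.
Proof.
move=> GP; have h (n : nat) t : G (t + 2 * pi * n%:R) = G t + 2 * pi * n%:R.
  elim: n => [|n IH]; first by rewrite mulr0 !addr0.
  have -> : t + 2 * pi * n.+1%:R = (t + 2 * pi * n%:R) + 2 * pi.
    by rewrite -natr1; ring.
  by rewrite GP IH -natr1; ring.
case: k => n; first exact: h.
by rewrite NegzE mulrNz mulrN -[in RHS](subrK (2 * pi * n.+1%:R) x) h addrK.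
Qed.

Section WithLift.
Variables (g : circle R -> circle R) (G : R -> R).
Hypotheses (gD : circle_diffeo g) (gG : lift_of g G).

Lemma lift_lt : {mono G : x y / x < y}.
Proof. exact: (pos_derive_ltE (lift_derive gG) (fun x => cd_pos gD (angle x))). Qed.

Lemma lift_le : {mono G : x y / x <= y}.
Proof. exact: (pos_derive_leE (lift_derive gG) (fun x => cd_pos gD (angle x))). Qed.

Lemma lift_cont : continuous G.
Proof. exact: is_derive_continuous (lift_derive gG). Qed.

Lemma lift_int x (k : int) : G (x + 2 * pi * k%:~R) = G x + 2 * pi * k%:~R.
Proof. exact: turn_equivariant_int (lift_period gG). Qed.

Lemma lift_surj y : exists x, G x = y.
Proof.
pose z := (y - G 0) / (2 * pi); pose k := Num.floor z.
have yE : y = G 0 + 2 * pi * z.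
  have p0 : 2 * pi != 0 :> R by rewrite gt_eqF.
  by rewrite /z mulrC divfK//; ring.
pose a := 2 * pi * k%:~R; pose b := 2 * pi * (k + 1)%:~R.
have Ga : G a = G 0 + a by rewrite -[a]add0r lift_int add0r.
have Gb : G b = G 0 + b by rewrite -[b]add0r lift_int add0r.
have ay : G a <= y.
  by rewrite Ga yE lerD2l ler_pM2l//; have := ge_floor z; rewrite -/k.
have yb : y <= G b by rewrite Gb yE lerD2l ler_pM2l// ltW//; exact: floorD1_gt.
have ab : a <= b by rewrite -lift_le (le_trans ay).
have [||x _ xE] := @IVT _ G a b y ab; last by exists x.
  exact/continuous_subspaceT/lift_cont.
by rewrite min_l ?max_r ?lift_le// ay.
Qed.

Lemma measurable_diffeo : measurable_fun setT g.
Proof.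
apply: measurable_circleP.
have -> : (fun t : mR => g (angle t)) = (@angle R) \o (G : mR -> mR).
  by apply/funext => t /=; rewrite (lift_angle gG).
apply: measurableT_comp; first exact: measurable_angle.
by apply: continuous_measurable_fun; exact: lift_cont.
Qed.

Lemma measurable_cderive : measurable_fun setT (cderive g).
Proof.
apply: measurable_circleP; apply: continuous_measurable_fun; exact: cd_continuous.
Qed.

(** A turn of the lift is mapped onto a turn, so this is [lebesgue_substitution] read
on the windows [0, 2 pi[ and [G 0, G 0 + 2 pi[. *)
Lemma circle_pushforward A : measurable A ->
  (\int[@dtheta R]_(p in g @^-1` A) (cderive g p)%:E = dtheta A)%E.
Proof.
move=> mA; have mgA : measurable (g @^-1` A).
  by rewrite -[X in measurable X]setTI; exact: measurable_diffeo.
have mc := measurable_cderive.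
rewrite integral_mkcond (ge0_integral_dtheta 0); last 2 first.
- apply/(measurable_restrictT _ _).1 => //; apply/measurable_EFinP.
  exact: measurable_funTS.
- by move=> p; rewrite patchE; case: ifPn => // _; rewrite lee_fin; exact/ltW/(cd_pos gD).
rewrite (dtheta_itv (G 0) mA).
have mB : measurable ((@angle R @^-1` A : set mR) `&` `[G 0, G 0 + 2 * pi[).
  by apply: measurableI => //; exact: measurable_preimage_angle.
rewrite -(lebesgue_substitution (lift_derive gG) (cd_continuous gD) (fun x => cd_pos gD (angle x)) lift_surj mB).
rewrite [LHS]integral_mkcond [RHS]integral_mkcond.
apply: eq_integral => t _; rewrite /patch.
have e : (t \in [set` `[0, 0 + 2 * pi[]) && (angle t \in g @^-1` A) =
         (t \in G @^-1` (@angle R @^-1` A `&` `[G 0, G 0 + 2 * pi[)).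
  apply/idP/idP.
    move=> /andP[/set_mem /=]; rewrite in_itv/= => h /set_mem /= At.
    apply/mem_set; split=> /=; first by rewrite (lift_angle gG).
    by rewrite in_itv/= -(lift_period gG) lift_le lift_lt.
  move=> /set_mem [/= At]; rewrite in_itv/= -(lift_period gG) lift_le lift_lt => h.
  apply/andP; split; apply/mem_set => /=; first by rewrite in_itv.
  by rewrite -(lift_angle gG).
by rewrite -e; case: ifP => //= _; case: ifP.
Qed.

End WithLift.

Lemma circle_substitution g (f : circle R -> \bar R) : circle_diffeo g ->
  measurable_fun setT f -> (forall p, 0 <= f p)%E ->
  (\int[@dtheta R]_p (f (g p) * (cderive g p)%:E) = \int[@dtheta R]_p f p)%E.
Proof.
move=> gD mf f0; have [G gG] := circle_diffeo_lift gD.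
apply: (@ge0_integral_weighted_pushforward _ _ _ _ R (@dtheta R) (@dtheta R) g (cderive g)) => //.
- exact: measurable_diffeo gG.
- exact: measurable_cderive.
- by move=> p; exact/ltW/(cd_pos gD).
- by move=> A mA; exact: (circle_pushforward gD gG).
Qed.

Lemma cderive_comp g h p : circle_diffeo g -> circle_diffeo h ->
  cderive (g \o h) p = cderive g (h p) * cderive h p.
Proof.
move=> gD hD; have [G gG] := circle_diffeo_lift gD; have [H hH] := circle_diffeo_lift hD.
rewrite -(angK p) -(lift_angle hH).
have := @cderive_lift (g \o h) (G \o H) (ang p).
move=> /(_ _ _ (is_derive1_comp (lift_derive gG _) (lift_derive hH _)))[].
  by move=> y /=; rewrite (lift_angle gG) (lift_angle hH).
by [].
Qed.

Lemma cderive_id p : cderive id p = 1.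
Proof. by rewrite -(angK p); have [] := @cderive_lift id id (ang p) 1 (fun=> erefl) (is_derive_id _ _). Qed.

Lemma lift_comp g h G H : circle_diffeo g -> circle_diffeo h ->
  lift_of g G -> lift_of h H -> lift_of (g \o h) (G \o H).
Proof.
move=> gD hD gG hH; split=> [x|x|x] /=.
- by rewrite (lift_angle gG) (lift_angle hH).
- rewrite cderive_comp// -(lift_angle hH).
  exact: is_derive1_comp (lift_derive gG _) (lift_derive hH _).
- by rewrite (lift_period hH) (lift_period gG).
Qed.

Lemma lift_of_shift g G (k : int) : lift_of g G ->
  lift_of g (fun x => G x + 2 * pi * k%:~R).
Proof.
move=> gG; split=> [x|x|x].
- rewrite -(lift_angle gG) ; apply/angle_eqP; by exists k.
- by rewrite -[cderive _ _]addr0; apply: is_deriveD; exact: lift_derive gG x.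
- by rewrite (lift_period gG) addrAC.
Qed.

Lemma lift_unique g G H : lift_of g G -> lift_of g H ->
  exists k : int, forall x, H x = G x + 2 * pi * k%:~R.
Proof.
move=> gG gH.
have /angle_eqP[k kE] : angle (H 0) = angle (G 0).
  by rewrite (lift_angle gG) (lift_angle gH).
exists k => x.
have d y : is_derive y (1 : R) (fun y => H y - G y) 0.
  rewrite -(subrr (cderive g (angle y))); apply: is_deriveB.
    exact: lift_derive gH y.
  exact: lift_derive gG y.
have := is_derive_0_is_cst x 0 d; rewrite kE => h.
by rewrite -[H x](subrK (G x)) h; ring.
Qed.

Lemma cderive_bounds g : circle_diffeo g ->
  exists m M, 0 < m /\ forall p, m <= cderive g p <= M.
Proof.
move=> gD; have c : {within `[- pi, pi], continuous (fun t => cderive g (angle t))}.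
  exact/continuous_subspaceT/cd_continuous.
have pp : - pi <= pi by rewrite ge0_cp// pi_ge0.
have [t1 _ P1] := EVT_min pp c; have [t2 _ P2] := EVT_max pp c.
exists (cderive g (angle t1)), (cderive g (angle t2)); split; first exact: cd_pos.
move=> p; have := ang_itv p; rewrite in_itv/= => /andP[h1 h2].
have h : ang p \in `[- pi, pi] by rewrite in_itv/= h2 ltW.
by have := P1 _ h; have := P2 _ h; rewrite angK => -> ->.
Qed.

End CircleDiffeo.

(** * Integrability of powers of the angular distance *)

Section SingularKernel.
Variable R : realType.
Local Notation pi := (@pi R).
Local Notation mu := (@lebesgue_measure R).
Local Notation mR := (measurableTypeR R).
Implicit Types (a x y t r : R) (p q : circle R).
Let p2 : 0 < 2 * pi :> R := twopi_gt0 R.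

(** With 1 / 0 = 0, one has 1 / x = x (x^2)^(-1) everywhere, which reduces the claim to
real powers. *)
Lemma measurable_inv : measurable_fun setT (fun x : R => x^-1).
Proof.
have -> : (fun x : R => x^-1) = (fun x => x * (x ^+ 2) `^ (-1)).
  apply/funext => x; rewrite powR_inv1 ?sqr_ge0//.
  have [->|x0] := eqVneq x 0; first by rewrite invr0 mul0r.
  by field.
apply: measurable_funM => //.
apply: (@measurableT_comp _ _ _ _ _ _ (fun x : R => x `^ (-1))).
  exact: measurable_powR.
exact: measurable_funX.
Qed.

Lemma measurable_sqrt : measurable_fun setT (Num.sqrt : R -> R).
Proof. by apply: continuous_measurable_fun; exact: sqrt_continuous. Qed.

Lemma ang_angleE t :
  ang (angle t) = t - 2 * pi * (Num.ceil ((t - pi) / (2 * pi)))%:~R.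
Proof.
set k := Num.ceil _.
have -> : angle t = angle (t - 2 * pi * k%:~R).
  by apply/angle_eqP; exists k; rewrite subrK.
apply: angleK; set u := (t - pi) / (2 * pi) in k *.
have tE : t = u * (2 * pi) + pi by rewrite /u divfK ?subrK// gt_eqF.
have h1 : u * (2 * pi) <= 2 * pi * k%:~R.
  by rewrite mulrC ler_pM2l// real_ceil_ge ?num_real.
have h2 : 2 * pi * k%:~R < 2 * pi * (u + 1).
  by rewrite ltr_pM2l// -ltrBlDr -[X in _ - X]/(1%:~R) -intrB real_ceilB1_lt ?num_real.
by apply/andP; split; lra.
Qed.

Lemma measurable_ang : measurable_fun setT (@ang R).
Proof.
apply: measurable_circleP.
rewrite (_ : (fun _ => _) = (fun t : mR => (t - 2 * pi * (Num.ceil ((t - pi) / (2 * pi)))%:~R : R))); last first.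
  by apply/funext => t; rewrite ang_angleE.
apply: measurable_funB => //; apply: measurable_funM => //.
apply: nondecreasing_measurable => // x y xy; rewrite ler_int.
by apply: le_ceil; rewrite ler_pM2r ?invr_gt0// lerD2r.
Qed.

Lemma measurable_ang_sub d (T : measurableType d) (f g : T -> circle R) :
  measurable_fun setT f -> measurable_fun setT g ->
  measurable_fun setT (fun z => ang (f z - g z)).
Proof.
move=> mf mg; rewrite (_ : (fun z => _) =
    @ang R \o (@angle R) \o (fun z => ang (f z) - ang (g z) : mR)); last first.
  by apply/funext => z /=; rewrite angleB !angK.
apply: measurableT_comp; last first.
  by apply: measurable_funB; apply: measurableT_comp => //; exact: measurable_ang.
by apply: measurableT_comp; [exact: measurable_ang|exact: measurable_angle].
Qed.

Lemma measurable_ang_powR r : measurable_fun setT (fun p : circle R => (`|ang p| `^ r)%:E).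
Proof.
apply/measurable_EFinP; apply: (@measurableT_comp _ _ _ _ _ _ (fun t : R => t `^ r)).
  exact: measurable_powR.
by apply: measurableT_comp => //; exact: measurable_ang.
Qed.

Lemma measurable_ang_sub_powR r :
  measurable_fun setT (fun z : circle R * circle R => (`|ang (z.1 - z.2)| `^ r)%:E).
Proof.
apply/measurable_EFinP; apply: (@measurableT_comp _ _ _ _ _ _ (fun t : R => t `^ r)).
  exact: measurable_powR.
by apply: measurableT_comp => //; exact: measurable_ang_sub.
Qed.

(** The primitive t^(r+1) / (r+1) is bounded on ]0, pi] for r > -1; the singular end is
reached along the intervals [1/(n+1), pi]. *)
Lemma integral_powR_lty r : -1 < r ->
  (\int[mu]_(t in `]0%R, pi]) (t `^ r)%:E < +oo)%E.
Proof.
move=> r1; have r10 : 0 < r + 1 by lra.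
have pi0 := pi_gt0 R.
pose F n : set mR := `[n.+1%:R^-1 , pi]%classic.
have UF : \bigcup_n F n = `]0, pi]%classic.
  apply/seteqP; split=> t /=.
    move=> [n _]; rewrite /F /= !in_itv/= => /andP[h ->]; rewrite andbT.
    by apply: lt_le_trans h; rewrite invr_gt0.
  rewrite in_itv/= => /andP[t0 tp].
  have /cvgrPdist_lt/(_ _ t0)[N _ /(_ N (leqnn N))] := @cvg_harmonic R.
  rewrite /= sub0r normrN ger0_norm ?invr_ge0// => h; exists N => //.
  by rewrite /F /= in_itv/= tp ltW.
have mf : measurable_fun (setT : set mR) (fun t : mR => (t `^ r)%:E).
  by apply/measurable_EFinP; exact: measurable_powR.
have c := @ge0_nondecreasing_set_cvg_integral _ mR R F (fun t => (t `^ r)%:E) mu.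
have {}c : (\int[mu]_(t in F n) (t `^ r)%:E @[n --> \oo] -->
   \int[mu]_(t in `]0%R, pi]) (t `^ r)%:E)%E.
  rewrite -UF; apply: c.
  - move=> m n mn; apply/subsetPset => t; rewrite /F /= !in_itv/= => /andP[h ->].
    rewrite andbT; apply: le_trans h.
    by rewrite lef_pV2 ?posrE// ler_nat ltnS.
  - by move=> n; exact: measurable_itv.
  - by move=> n; exact: measurable_funTS.
  - by move=> n t _; rewrite lee_fin powR_ge0.
have bound n : (\int[mu]_(t in F n) (t `^ r)%:E <= (pi `^ (r + 1) / (r + 1))%:E)%E.
  have n0 : 0 < n.+1%:R^-1 :> R by rewrite invr_gt0.
  have [np|np] := ltP (n.+1%:R^-1 : R) pi; last first.
    move: np; rewrite le_eqVlt => /predU1P[pE|np].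
      rewrite /F -pE set_itv1 integral_set1 lee_fin.
      by rewrite divr_ge0 ?powR_ge0 ?(ltW r10).
    rewrite /F set_itv_ge ?integral_set0 ?lee_fin; last by rewrite bnd_simp -ltNge.
    by rewrite divr_ge0 ?powR_ge0 ?(ltW r10).
  pose P t := (r + 1)^-1 * t `^ (r + 1).
  have dP t : 0 < t -> is_derive t (1 : R) P (t `^ r).
    move=> t0.
    have -> : t `^ r = (r + 1)^-1 *: ((r + 1) * t `^ (r + 1 - 1)).
      by rewrite addrK -[RHS]/((r + 1)^-1 * ((r + 1) * _)) mulrA mulVf ?mul1r// gt_eqF.
    exact: (is_deriveZ (r + 1)^-1 (is_derive1_powR (r + 1) t0)).
  have cP t : 0 < t -> {for t, continuous P}.
    move=> t0; apply/differentiable_continuous/derivable1_diffP.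
    by have [] := dP t t0.
  rewrite /F (continuous_FTC2 np (F := P)).
  - rewrite /P -EFinB lee_fin mulrC lerBlDr lerDl.
    by rewrite mulr_ge0 ?powR_ge0// invr_ge0 ltW.
  - apply/continuous_in_subspaceT => t /set_mem/=; rewrite in_itv/= => /andP[h _].
    have t0 : 0 < t by exact: lt_le_trans h.
    apply/differentiable_continuous/derivable1_diffP.
    by apply: derivable_powR; rewrite in_itv/= t0.
  - split.
    + move=> t; rewrite in_itv/= => /andP[h _]; have t0 : 0 < t by exact: lt_trans h.
      by have [] := dP t t0.
    + exact/cvg_at_right_filter/cP.
    + exact/cvg_at_left_filter/cP.
  - move=> t; rewrite in_itv/= => /andP[h _]; have t0 : 0 < t by exact: lt_trans h.
    by rewrite derive1E; have [_ ->] := dP t t0.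
apply: (@le_lt_trans _ _ (pi `^ (r + 1) / (r + 1))%:E); last exact: ltry.
rewrite -(cvg_lim _ c)//; apply: lime_le.
  by apply/cvg_ex; eexists; exact: c.
exact: nearW.
Qed.

End SingularKernel.

Section DoubleIntegral.
Variable R : realType.
Local Notation pi := (@pi R).
Local Notation mu := (@lebesgue_measure R).
Local Notation mR := (measurableTypeR R).
Local Notation dth := (@dtheta R).
Implicit Types (a x y t r : R) (p q : circle R).
Let p2 : 0 < 2 * pi :> R := twopi_gt0 R.

Lemma measurable_subC q : measurable_fun setT (fun p : circle R => p - q).
Proof.
apply: measurable_circleP.
rewrite (_ : (fun t => _) = @angle R \o (fun t : mR => (t - ang q : mR))).
  by apply: measurableT_comp; [exact: measurable_angle|exact: measurable_funB].
by apply/funext => t /=; rewrite angleB angK.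
Qed.

Lemma integral_rotate q (f : circle R -> \bar R) :
  measurable_fun setT f -> (forall p, 0 <= f p)%E ->
  (\int[dth]_p f (p - q)%R = \int[dth]_p f p)%E.
Proof.
move=> mf f0.
have h := @ge0_integral_weighted_pushforward _ _ _ _ R dth dth (fun p => p - q) (fun=> 1) _ _ _ _ f mf f0.
rewrite -h.
- by apply: eq_integral => p _; rewrite mule1.
- exact: measurable_subC.
- by [].
- by move=> p; exact: ler01.
- move=> A mA; have mB : measurable ((fun p => p - q) @^-1` A).
    by rewrite -[X in measurable X]setTI; exact: measurable_subC.
  rewrite integral_cst//= mul1e (dtheta_itv (ang q) mB) dthetaE.
  rewrite -(@lebesgue_shift _ (ang q) (@angle R @^-1` ((fun p => p - q) @^-1` A) `&` `[ang q, ang q + 2 * pi[)).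
    have sh (x t c : R) : (x <= t + x < x + c) = (0 <= t < c).
      by rewrite lerDr (addrC t) ltrD2l.
    congr (mu _); apply/seteqP; split=> t /=.
      by rewrite in_itv/= angleD angK addrK sh => -[].
    by rewrite angleD angK addrK => -[At]; rewrite !in_itv/= sh => h'.
  apply: measurableI; last exact: measurable_itv.
  exact: measurable_preimage_angle.
Qed.

Lemma integral_reflect (f : mR -> \bar R) :
  measurable_fun setT f -> (forall t, 0 <= f t)%E ->
  (\int[mu]_t f (- t)%R = \int[mu]_t f t)%E.
Proof.
move=> mf f0.
have h := @ge0_integral_weighted_pushforward _ _ mR mR R mu mu -%R (fun=> 1) _ _ _ _ f mf f0.
rewrite -h//.
- by apply: eq_integral => p _; rewrite mule1.
- move=> A mA; have mB : measurable ((-%R : mR -> mR) @^-1` A).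
    rewrite -[X in measurable X]setTI.
    by have : measurable_fun setT (-%R : mR -> mR) by []; apply.
  by rewrite integral_cst//= mul1e; exact: lebesgue_measureN.
Qed.

Lemma integral_ang_powR_lty r : -1 < r ->
  (\int[dth]_p (`|ang p| `^ r)%:E < +oo)%E.
Proof.
move=> r1; have pi0 := pi_gt0 R.
pose f (t : mR) := ((t `^ r)%:E * (\1_(`]0%R, pi]%classic : set mR) t)%:E : \bar R)%E.
have mf : measurable_fun setT f.
  apply: emeasurable_funM; first by apply/measurable_EFinP; exact: measurable_powR.
  by apply/measurable_EFinP; exact: measurable_indic.
have f0 t : (0 <= f t)%E by rewrite mule_ge0// lee_fin ?powR_ge0.
have If : (\int[mu]_t f t < +oo)%E.
  apply: le_lt_trans (integral_powR_lty r1).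
  rewrite [leRHS]integral_mkcond le_eqVlt; apply/orP; left; apply/eqP.
  by apply: eq_integral => t _; rewrite patchE /f indicE; case: ifPn => _; rewrite ?mule1 ?mule0.
have mang := measurable_ang_powR r.
rewrite (ge0_integral_dtheta (- pi)); last 2 first.
- exact: mang.
- by move=> p; rewrite lee_fin powR_ge0.
have mf' : measurable_fun setT (fun t : mR => f (- t)%R).
  exact: (@measurableT_comp _ _ _ _ _ _ f).
pose D : set mR := `[(- pi)%R, (- pi + 2 * pi)%R[%classic.
apply: (@le_lt_trans _ _ (\int[mu]_(t in D) (f t + f (- t)%R + 1))%E).
  apply: ge0_le_integral.
  - by [].
  - by move=> t _; rewrite lee_fin powR_ge0.
  - by apply: measurable_funTS; exact: (measurableT_comp mang (measurable_angle (R:=R))).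
  - by apply: measurable_funTS; apply: emeasurable_funD => //; exact: emeasurable_funD.
  - move=> t; rewrite /D/= in_itv/= => /andP[h1 h2].
    have -> : `|ang (angle t)| = `|t|.
      move: h1; rewrite le_eqVlt => /predU1P[<-|h1].
        rewrite (_ : angle (- pi) = angle pi) ?angleK ?normrN// ?lexx ?andbT; first lra.
        by apply/angle_eqP; exists (-1); rewrite mulrN1; ring.
      by rewrite angleK// h1/=; lra.
    rewrite /f !indicE.
    have [t0|t0|->] := ltgtP t 0.
    + rewrite [t \in _]memNset ?mule0 ?add0e; last by rewrite /= in_itv/= => /andP[h _]; lra.
      rewrite mem_set ?mule1; last by rewrite /= in_itv/=; apply/andP; split; lra.
      by rewrite ltr0_norm// -EFinD lee_fin lerDl.
    + rewrite mem_set ?mule1; last by rewrite /= in_itv/=; apply/andP; split; lra.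
      rewrite memNset ?mule0 ?adde0; last by rewrite /= in_itv/= => /andP[h _]; lra.
      by rewrite gtr0_norm// -EFinD lee_fin lerDl.
    + rewrite memNset ?mule0 ?add0e; last by rewrite /= in_itv/= ltxx.
      rewrite memNset ?mule0 ?add0e; last by rewrite /= in_itv/= oppr0 ltxx.
      by rewrite normr0 lee_fin /powR eqxx; case: (r == 0).
have mD : measurable D by exact: measurable_itv.
have muD : (mu D < +oo)%E.
  by rewrite /D lebesgue_measure_itv/=; case: ifP => _; exact: ltry.
rewrite ge0_integralD//; last 2 first.
- by move=> t _; rewrite adde_ge0.
- by apply: measurable_funTS; exact: emeasurable_funD.
rewrite ge0_integralD//; try exact: measurable_funTS.
rewrite integral_cst// mul1e lte_add_pinfty//.
rewrite lte_add_pinfty//; apply: le_lt_trans If.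
  by apply: ge0_subset_integral.
by rewrite -integral_reflect//; apply: ge0_subset_integral.
Qed.

(** Rotation invariance reduces the double integral to the one of a function of a
single variable. *)
Lemma double_integral_ang_lty r : -1 < r ->
  (\int[dth \x dth]_z (`|ang (z.1 - z.2)%R| `^ r)%:E < +oo)%E.
Proof.
move=> r1; rewrite fubini_tonelli2; last 2 first.
- exact: measurable_ang_sub_powR.
- by move=> z; rewrite lee_fin powR_ge0.
have := integral_ang_powR_lty r1.
set I := (\int[dth]_p _)%E => I1.
have I0 : (0 <= I)%E by apply: integral_ge0 => p _; rewrite lee_fin powR_ge0.
rewrite (eq_integral (fun=> I)); last first.
  move=> q _; rewrite /fubini_G /I.
  apply: (integral_rotate q (f := fun p => (`|ang p| `^ r)%:E)).
    exact: measurable_ang_powR.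
  by move=> p; rewrite lee_fin powR_ge0.
rewrite integral_cst//; apply: lte_mul_pinfty => //.
  by rewrite ge0_fin_numE.
by rewrite ltey_eq fin_num_measure.
Qed.

End DoubleIntegral.

(** * The distortion as a coboundary *)

Section Cocycle.
Variable R : realType.
Local Notation pi := (@pi R).
Implicit Types (g h u : circle R -> circle R) (G H : R -> R) (p q : circle R)
  (z : circle R * circle R).
Let p2 : 0 < 2 * pi :> R := twopi_gt0 R.

(** The kernel 1 / (phi - eta) pulled back by g as a half-density in each variable. *)
Definition density_kernel g z : R :=
  Num.sqrt (cderive g z.1 * cderive g z.2) / ang (g z.1 - g z.2).

Lemma distortionE g z : injective g ->
  distortion g z = density_kernel g z - density_kernel id z.
Proof.
case: z => p q ginj; rewrite /distortion /density_kernel /= !cderive_id mulr1 sqrtr1.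
set a := ang (p - q); set b := ang (g p - g q).
have [pq|pq] := eqVneq p q.
  have a0 : a = 0 by rewrite /a pq subrr ang0.
  have b0 : b = 0 by rewrite /b pq subrr ang0.
  by rewrite a0 b0 !(mulr0, invr0) subrr.
have a0 : a != 0.
  by apply: contra pq => /eqP/ang_eq0/eqP; rewrite subr_eq0.
have b0 : b != 0.
  apply: contra pq => /eqP/ang_eq0/eqP; rewrite subr_eq0 => /eqP/ginj ->//.
by field; rewrite a0 b0.
Qed.

Lemma measurable_cderive2 g : circle_diffeo g ->
  measurable_fun setT (fun z : circle R * circle R => cderive g z.1 * cderive g z.2).
Proof.
move=> /measurable_cderive mc; apply: measurable_funM.
  exact: (measurableT_comp mc measurable_fst).
exact: (measurableT_comp mc measurable_snd).
Qed.

Lemma measurable_density_kernel g : circle_diffeo g ->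
  measurable_fun setT (density_kernel g).
Proof.
move=> gD; have [G gG] := circle_diffeo_lift gD.
have mg := measurable_diffeo gG.
apply: measurable_funM; last first.
  apply: (@measurableT_comp _ _ _ _ _ _ (fun x : R => x^-1)).
    exact: measurable_inv.
  apply: measurable_ang_sub.
    exact: (measurableT_comp mg measurable_fst).
  exact: (measurableT_comp mg measurable_snd).
apply: (@measurableT_comp _ _ _ _ _ _ (Num.sqrt : R -> R)).
  exact: measurable_sqrt.
exact: measurable_cderive2.
Qed.

Lemma circle_diffeo_id : circle_diffeo (@id (circle R)).
Proof.
split=> //.
- move=> p; rewrite -(angK p).
  by have [] := @cderive_lift R id id (ang p) 1 (fun=> erefl) (is_derive_id _ _).
- by move=> p; rewrite cderive_id.
- by rewrite (_ : (fun _ => _) = cst 1); [move=> ?; exact: cvg_cst|apply/funext => t; rewrite cderive_id].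
Qed.

Lemma measurable_distortion g : circle_diffeo g -> measurable_fun setT (distortion g).
Proof.
move=> gD; rewrite (_ : distortion g = (fun z => density_kernel g z - density_kernel id z)).
  have := measurable_density_kernel circle_diffeo_id.
  by apply: measurable_funB; exact: measurable_density_kernel.
by apply/funext => z; rewrite distortionE//; exact: cd_inj gD.
Qed.

Lemma lift_bilipschitz g G m M : circle_diffeo g -> lift_of g G ->
  0 < m -> (forall p, m <= cderive g p <= M) ->
  forall x y, m * `|x - y| <= `|G x - G y| <= M * `|x - y|.
Proof.
move=> gD gG m0 b x y; wlog xy : x y / x <= y.
  move=> H; have [/H //|/ltW/H] := leP x y.
  by rewrite distrC [`|G y - _|]distrC.
have [t _ E] := MVT_global (lift_derive gG) xy.
rewrite distrC [`|G x - _|]distrC E normrM (ger0_norm (ltW (cd_pos gD _))).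
by have /andP[b1 b2] := b (angle t); apply/andP; split; apply: ler_wpM2r.
Qed.

(** Some translate of ang p by a multiple of 2 pi has an image at distance
|ang (g p - g q)| from that of ang q, and no translate is nearer to ang q than
|ang (p - q)|. *)
Lemma ang_diffeo_ge g m M : circle_diffeo g ->
  0 < m -> (forall p, m <= cderive g p <= M) ->
  forall p q, m * `|ang (p - q)| <= `|ang (g p - g q)|.
Proof.
move=> gD m0 b p q; have [G gG] := circle_diffeo_lift gD.
have := ang_shift (G (ang p) - G (ang q)).
rewrite angleB !(lift_angle gG) !angK => -[k kE].
have -> : ang (g p - g q) = G (ang p - 2 * pi * k%:~R) - G (ang q).
  rewrite (_ : ang p - 2 * pi * k%:~R = ang p + 2 * pi * (- k)%:~R).
    by rewrite (lift_int gG) mulrNz mulrN; lra.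
  by rewrite mulrNz mulrN.
have /andP[h _] := lift_bilipschitz gD gG m0 b (ang p - 2 * pi * k%:~R) (ang q).
apply: le_trans h; rewrite ler_pM2l//.
have -> : p - q = angle (ang p - 2 * pi * k%:~R - ang q).
  rewrite -{1}(angK p) -{1}(angK q) -angleB; apply/angle_eqP; exists k; ring.
exact: ang_angle_le.
Qed.

(** A geometric mean lies between the two numbers. *)
Lemma sqrtM_dist (a b w e : R) : 0 < a -> 0 < b -> 0 < w -> 0 <= e ->
  `|a - w| <= e -> `|b - w| <= e -> `|Num.sqrt (a * b) - w| <= e.
Proof.
move=> a0 b0 w0 e0; rewrite !ler_norml => /andP[a1 a2] /andP[b1 b2].
have s0 := sqrtr_ge0 (a * b).
have s2 : Num.sqrt (a * b) ^+ 2 = a * b by rewrite sqr_sqrtr// mulr_ge0// ltW.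
apply/andP; split.
  rewrite lerNl opprB lerBlDr leNgt; apply/negP => h.
  have h1 : 0 <= w - e by lra.
  nra.
rewrite lerBlDr leNgt; apply/negP => h.
nra.
Qed.

(** If the arc between p and q has an image shorter than pi, the mean value theorem
gives g(p) - g(q) = g'(t) (p - q) for an intermediate t, so the distortion is
(sqrt(g'(p) g'(q)) - g'(t)) / (g(p) - g(q)); the numerator is O(|p - q|^alpha) by the
Hoelder condition and the denominator is comparable to |p - q|.  Otherwise p and q
are far apart and both terms are bounded. *)
Lemma distortion_bound (alpha : R) (g : bijection (circle R)) : 0 < alpha ->
  Diff1 alpha g ->
  exists C C', [/\ 0 <= C, 0 <= C' & forall z,
    `|distortion g z| <= C * `|ang (z.1 - z.2)| `^ (alpha - 1) + C'].
Proof.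
move=> a0 gDiff; have gD := Diff1_circle_diffeo a0 gDiff.
have [G gG] := circle_diffeo_lift gD.
have [m [M [m0 b]]] := cderive_bounds gD.
have pi0 := pi_gt0 R.
have M0 : 0 < M by have /andP[h1 h2] := b 0; apply: lt_le_trans h2; exact: lt_le_trans h1.
have [_ _ [c gc]] := gDiff.
exists (`|c| / m), (M / (m * (pi / M)) + (pi / M)^-1).
have piM : 0 < pi / M by rewrite divr_gt0.
have C'0 : 0 <= M / (m * (pi / M)) + (pi / M)^-1.
  by apply: ltW; apply: addr_gt0; [rewrite divr_gt0// mulr_gt0|rewrite invr_gt0].
have C0 : 0 <= `|c| / m by rewrite divr_ge0// ltW.
split=> //.
move=> z; rewrite distortionE; last exact: cd_inj gD.
case: z => p q.
rewrite /density_kernel /= !cderive_id mulr1 sqrtr1.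
set a := ang (p - q); set d := ang (g p - g q); set s := Num.sqrt _.
have [pq|pq] := eqVneq p q.
  rewrite /d /a pq !subrr ang0 invr0 !mulr0 subrr normr0.
  by rewrite addr_ge0// mulr_ge0 ?powR_ge0.
have aN0 : a != 0.
  by apply: contra pq => /eqP/ang_eq0/eqP; rewrite subr_eq0.
have na0 : 0 < `|a| by rewrite normr_gt0.
pose y := ang q; pose x := y + a.
have xp : angle x = p by rewrite /x angleD !angK addrC subrK.
have yq : angle y = q by rewrite angK.
pose D := G x - G y.
have dD : d = ang (angle D) by rewrite /D angleB !(lift_angle gG) xp yq.
have md : m * `|a| <= `|d| by exact: ang_diffeo_ge b _ _.
have /andP[D1 D2] := lift_bilipschitz gD gG m0 b x y.
have xya : x - y = a by rewrite /x addrC addKr.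
rewrite xya -/D in D1 D2.
have dN0 : d != 0 by rewrite -normr_gt0; apply: lt_le_trans md; rewrite mulr_gt0.
have sM : 0 <= s <= M.
  rewrite sqrtr_ge0/= /s -[leRHS](ger0_norm (ltW M0)) -sqrtr_sqr ler_wsqrtr//.
  have /andP[_ h1] := b p; have /andP[_ h2] := b q.
  by rewrite expr2 ler_pM// ltW// cd_pos.
have [Dpi|Dpi] := ltP `|D| pi; last first.
  have aM : pi / M <= `|a| by rewrite ler_pdivrMr// mulrC (le_trans Dpi).
  apply: (@le_trans _ _ (M / (m * (pi / M)) + (pi / M)^-1)); last first.
    by rewrite lerDr mulr_ge0 ?powR_ge0.
  apply: le_trans (ler_normB _ _) _; apply: lerD; last first.
    by rewrite mul1r normfV lef_pV2 ?posrE.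
  move: sM => /andP[s0 sM].
  rewrite normrM normfV (ger0_norm s0) ler_pM// ?invr_ge0//.
  have mpM : 0 < m * (pi / M) by rewrite mulr_gt0.
  rewrite lef_pV2 ?posrE ?normr_gt0//.
  by apply: le_trans md; rewrite ler_pM2l.
have dE : d = D.
  by rewrite dD angleK//; move: Dpi; rewrite ltr_norml => /andP[-> /ltW ->].
have [t t12 E] : exists2 t, `|x - t| <= `|a| /\ `|y - t| <= `|a| & D = cderive g (angle t) * a.
  have [xy|/ltW xy] := leP x y.
    have [t /andP[t1 t2] E] := MVT_global (lift_derive gG) xy.
    exists t; last by rewrite /D -opprB E -mulrN opprB xya.
    rewrite -xya ler0_norm ?subr_le0// (ler0_norm (_ : x - y <= 0)) ?subr_le0//.
    by rewrite ger0_norm ?subr_ge0//; lra.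
  have [t /andP[t1 t2] E] := MVT_global (lift_derive gG) xy.
  exists t; last by rewrite /D E xya.
  rewrite -xya ger0_norm ?subr_ge0// (ger0_norm (_ : 0 <= x - y)) ?subr_ge0//.
  by rewrite ler0_norm ?subr_le0//; lra.
have hold v : `|v - t| <= `|a| ->
    `|cderive g (angle v) - cderive g (angle t)| <= `|c| * `|a| `^ alpha.
  move=> va; have [->|vt] := eqVneq (angle v) (angle t).
    by rewrite subrr normr0 mulr_ge0 ?powR_ge0.
  apply: le_trans (ltW (gc _ _ vt)) _.
  apply: (@le_trans _ _ (`|c| * `|ang (angle v - angle t)| `^ alpha)).
    by rewrite ler_wpM2r ?powR_ge0// ler_norm.
  rewrite ler_wpM2l// ge0_ler_powR ?nnegrE// ?(ltW a0)// -angleB.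
  exact: le_trans (ang_angle_le _) va.
have sd : `|s - cderive g (angle t)| <= `|c| * `|a| `^ alpha.
  apply: sqrtM_dist; try exact: (cd_pos gD).
  - by rewrite mulr_ge0 ?powR_ge0.
  - by rewrite -xp; exact: hold t12.1.
  - by rewrite -yq; exact: hold t12.2.
apply: (@le_trans _ _ (`|c| / m * `|a| `^ (alpha - 1))); last by rewrite lerDl.
have -> : s / d - 1 / a = (s - cderive g (angle t)) / d.
  rewrite mulrBl; congr (_ - _); rewrite dE E; field.
  by rewrite aN0 gt_eqF// cd_pos.
rewrite normrM normfV ler_pdivrMr ?normr_gt0//; apply: le_trans sd _.
apply: (@le_trans _ _ (`|c| / m * `|a| `^ (alpha - 1) * (m * `|a|))); last first.
  by rewrite ler_wpM2l// mulr_ge0 ?powR_ge0.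
have -> : `|a| `^ alpha = `|a| `^ (alpha - 1) * `|a|.
  by rewrite -[X in _ = _ * X]powRr1// -powRD ?subrK// gt_eqF ?implybT.
rewrite le_eqVlt; apply/orP; left; apply/eqP; field.
by rewrite gt_eqF.
Qed.

End Cocycle.

(** * Uniform boundedness of the distortion *)

Section BoundedCocycle.
Variable R : realType.
Local Notation dth := (@dtheta R).
Local Notation dth2 := (@dtheta R \x @dtheta R)%E.
Implicit Types (g h u : circle R -> circle R) (p q : circle R)
  (z : circle R * circle R).

(** The exponent 2 (alpha - 1) exceeds -1 exactly when alpha > 1/2. *)
Lemma sq_integrable_distortion (alpha : R) (g : bijection (circle R)) :
  1 / 2 < alpha -> Diff1 alpha g -> sq_integrable dth2 (distortion g).
Proof.
move=> a12 gDiff; have a0 : 0 < alpha by lra.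
have gD := Diff1_circle_diffeo a0 gDiff.
split; first exact: measurable_distortion.
have [C [C' [C0 C'0 b]]] := distortion_bound a0 gDiff.
pose r := (alpha - 1) * 2.
have r1 : -1 < r by rewrite /r; lra.
pose F z : \bar R := ((2 * C ^+ 2)%:E * (`|ang (z.1 - z.2)%R| `^ r)%:E + (2 * C' ^+ 2)%:E)%E.
have mpw := measurable_ang_sub_powR (R := R) r.
have C20 : 0 <= 2 * C ^+ 2 by rewrite mulr_ge0// sqr_ge0.
have C20' : 0 <= 2 * C' ^+ 2 by rewrite mulr_ge0// sqr_ge0.
apply: (@le_lt_trans _ _ (\int[dth2]_z F z)%E).
  apply: ge0_le_integral => //.
  - by move=> z _; rewrite lee_fin sqr_ge0.
  - by apply/measurable_EFinP/measurable_funX; exact: measurable_distortion.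
  - apply: emeasurable_funD => //; exact: measurable_funeM.
  - move=> z _; rewrite /F -EFinM -EFinD lee_fin.
    have := b z; rewrite /r powRrM powR_mulrn ?powR_ge0//.
    set x := _ `^ _; rewrite ler_norml => /andP[h1 h2].
    have x0 : 0 <= x by exact: powR_ge0.
    have Cx : 0 <= C * x by rewrite mulr_ge0.
    have : distortion g z ^+ 2 <= (C * x + C') ^+ 2.
      by rewrite -[leLHS]real_normK ?num_real// ler_sqr ?nnegrE ?addr_ge0// ler_norml h1.
    have := sqr_ge0 (C * x - C'); rewrite !expr2; nra.
rewrite /F ge0_integralD//; last 2 first.
- by move=> z _; rewrite mule_ge0// lee_fin ?powR_ge0.
- exact: measurable_funeM.
rewrite ge0_integralZl//.
have I1 := double_integral_ang_lty r1.
have T2 : (dth2 setT < +oo)%E.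
  rewrite -setXTT product_measure1E//.
  by apply: lte_mul_pinfty; rewrite ?measure_ge0 ?fin_num_measure// ltey_eq fin_num_measure.
rewrite integral_cst//; apply: lte_add_pinfty.
  apply: lte_mul_pinfty => //; rewrite ?lee_fin//.
apply: lte_mul_pinfty => //; rewrite ?lee_fin//.
Qed.

Lemma double_substitution u (f : circle R * circle R -> \bar R) : circle_diffeo u ->
  measurable_fun setT f -> (forall z, 0 <= f z)%E ->
  (\int[dth2]_z (f (u z.1, u z.2) * (cderive u z.1 * cderive u z.2)%:E) =
   \int[dth2]_z f z)%E.
Proof.
move=> uD mf f0; have [U uU] := circle_diffeo_lift uD.
have mu := measurable_diffeo uU; have mc := measurable_cderive uD.
have c0 p : 0 <= cderive u p by exact/ltW/(cd_pos uD).
rewrite !fubini_tonelli1//; last 2 first.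
- apply: emeasurable_funM.
    apply: (measurableT_comp mf); apply: measurable_fun_pair.
      exact: (measurableT_comp mu measurable_fst).
    exact: (measurableT_comp mu measurable_snd).
  by apply/measurable_EFinP; exact: measurable_cderive2.
- by move=> z; rewrite mule_ge0// lee_fin mulr_ge0.
rewrite /fubini_F /=.
have mF : measurable_fun setT (fubini_F dth f).
  exact: measurable_fun_fubini_tonelli_F.
rewrite -(circle_substitution uD mF); last first.
  by move=> p; apply: integral_ge0.
apply: eq_integral => p _; rewrite /fubini_F.
have mfp : measurable_fun setT (fun q => f (u p, q)).
  by apply: (measurableT_comp mf); exact: pair1_measurable.
rewrite -(circle_substitution uD mfp)//.
rewrite muleC -ge0_integralZl//; last 3 first.
- apply: emeasurable_funM; last exact/measurable_EFinP.
  exact: (measurableT_comp mfp mu).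
- by move=> q _; rewrite mule_ge0// lee_fin.
- by rewrite lee_fin.
by apply: eq_integral => q _ /=; rewrite EFinM muleCA.
Qed.

(** The chain rule: half-densities transform by the square root of the derivative. *)
Lemma density_kernel_comp g u z : circle_diffeo g -> circle_diffeo u ->
  density_kernel (g \o u) z =
  Num.sqrt (cderive u z.1 * cderive u z.2) * density_kernel g (u z.1, u z.2).
Proof.
move=> gD uD; rewrite /density_kernel (cderive_comp z.1 gD uD) (cderive_comp z.2 gD uD) [RHS]mulrA /=.
congr (_ * _).
have c0 p : 0 <= cderive u p by exact/ltW/(cd_pos uD).
by rewrite -sqrtrM ?mulr_ge0// mulrACA [X in Num.sqrt X]mulrC.
Qed.

(** The terms k_1 cancel in the difference, and by [density_kernel_comp] right
translation by u is a change of variables for half-densities of the torus, which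
is isometric. *)
Lemma dist2_distortion_comp (g h u : bijection (circle R)) :
  circle_diffeo g -> circle_diffeo h -> circle_diffeo u ->
  dist2 dth2 (distortion (g * u)%g) (distortion (h * u)%g) =
  dist2 dth2 (distortion g) (distortion h).
Proof.
move=> gD hD uD; rewrite /dist2 /Rintegral; congr fine.
have c0 p : 0 <= cderive u p by exact/ltW/(cd_pos uD).
have inj (k : bijection (circle R)) : injective k by exact: can_inj (bij_funK k).
rewrite -[RHS](double_substitution uD); last 2 first.
- apply/measurable_EFinP/measurable_funX/measurable_funB; exact: measurable_distortion.
- by move=> z; rewrite lee_fin sqr_ge0.
apply: eq_integral => z _; rewrite -EFinM; congr EFin.
rewrite !distortionE// !opprB !addrA !subrK.
rewrite (density_kernel_comp z gD uD) (density_kernel_comp z hD uD).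
rewrite -mulrBr exprMn sqr_sqrtr ?mulr_ge0// mulrC; congr (_ ^+ 2 * _).
Qed.

Theorem kazhdan_distortion_bounded (alpha : R) (G : groupClosed (bijection (circle R))) :
  1 / 2 < alpha -> (forall g : bijection (circle R), g \in G -> Diff1 alpha g) ->
  kazhdan R (subgroup_of G) ->
  exists M : R, forall g : bijection (circle R), g \in G ->
    (\int[dth2]_z ((distortion g z) ^+ 2)%:E <= M%:E)%E.
Proof.
move=> a12 hG kG; have a0 : 0 < alpha by lra.
have gin (g : subgroup_of G) : sg_val g \in G by case: g.
have gD (g : subgroup_of G) := Diff1_circle_diffeo a0 (hG _ (gin g)).
have [||M MP] := kazhdan_bounded (mu := dth2)
    (b := fun g : subgroup_of G => distortion (sg_val g)) kG.
- by move=> g; apply: (sq_integrable_distortion a12); exact: hG.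
- have sgM (x y : subgroup_of G) : sg_val (x * y)%g = (sg_val x * sg_val y)%g by [].
  by move=> u x y; rewrite !sgM; exact: dist2_distortion_comp.
exists M => g gG; have := MP (SubgroupOf gG).
have [_ lty] := sq_integrable_distortion a12 (hG g gG).
have d1 z : distortion (sg_val (1%g : subgroup_of G)) z = 0.
  by rewrite distortionE; [exact: subrr|move=> ? ?].
rewrite /dist2 /Rintegral -lee_fin fineK; last first.
  rewrite ge0_fin_numE; last by apply: integral_ge0 => z _; rewrite lee_fin sqr_ge0.
  by under eq_integral do rewrite d1 subr0.
by under eq_integral do rewrite d1 subr0.
Qed.

End BoundedCocycle.

(** * Expanding intervals and arcs *)

Section ExpandingInterval.
Variable R : realType.
Variables (F : R -> R) (a x : R).
Hypotheses (cF : continuous F) (Fmono : {homo F : u v / u <= v}) (Fa : F a = a) (ax : a < x)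
  (Fx : x < F x).

(** p is the supremum of the fixed points in [a, x]. *)
Lemma last_fixed_point : exists p, [/\ a <= p, p < x, F p = p &
  forall y, p < y <= x -> y < F y].
Proof.
pose S := [set y | a <= y <= x /\ F y = y].
have Sa : S a by rewrite /S/= lexx (ltW ax).
have Sub : has_sup S.
  by split; [exists a|exists x => y [/andP[_ h] _]].
pose p := sup S.
have pS y : S y -> y <= p by move=> Sy; apply: ub_le_sup => //; case: Sub.
have ap : a <= p by exact: pS.
have px : p <= x by apply: ge_sup; [exists a|move=> y [/andP[_ h] _]].
have Fp1 : p <= F p.
  apply: ge_sup; first by exists a.
  by move=> y Sy; have [_ yE] := Sy; rewrite -yE; apply: Fmono; exact: pS.
have Fp : F p = p.
  apply/eqP; rewrite eq_le Fp1 andbT leNgt; apply/negP => h.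
  have h0 : 0 < F p - p by rewrite subr_gt0.
  have cFp : F y @[y --> p] --> F p by exact: cF.
  move/cvgrPdist_lt : cFp => /(_ _ h0)/nbhs_ballP[e /= e0 eP].
  have [y Sy yp] := sup_adherent e0 Sub.
  have yp' := pS _ Sy; have [_ yE] := Sy.
  have : `|F p - F y| < F p - p.
    apply: eP; rewrite /ball/= ger0_norm ?subr_ge0//.
    by rewrite ltrBlDr addrC -ltrBlDr.
  by rewrite yE ltr_norml => /andP[_]; lra.
have pxl : p < x.
  by rewrite lt_neqAle px andbT; apply/eqP => pE; move: Fx; rewrite -pE Fp ltxx.
exists p; split=> // y /andP[py yx]; rewrite ltNge; apply/negP => Fy.
have cFi : {within `[y, x], continuous (fun t => F t - t)}.
  apply: continuous_subspaceT => t; apply: cvgB; [exact: cF|exact: cvg_id].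
have [|z zyx /eqP] := @IVT _ (fun t => F t - t) y x 0 yx cFi.
  by rewrite ge_min le_max subr_le0 Fy /= !subr_ge0 (ltW Fx) orbT.
rewrite subr_eq0 => /eqP zE; move: zyx; rewrite in_itv/= => /andP[yz zx].
have : z <= p by apply: pS; split=> //; rewrite zx andbT (le_trans ap)// (le_trans (ltW py)).
by rewrite leNgt (lt_le_trans py yz).
Qed.

(** Otherwise the orbit increases to a fixed point in ]p, x]. *)
Lemma orbit_escapes p y : (forall z, p < z <= x -> z < F z) -> p < y ->
  exists n, x <= iter n F y.
Proof.
move=> Fgt py; apply: contrapT => /forallNP H.
pose u n := iter n F y.
have ux n : u n < x by rewrite ltNge; apply/negP; exact: H.
have pu n : p < u n.
  elim: n => [//|n IH]; apply: (lt_trans IH); apply: Fgt.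
  by rewrite IH ltW.
have uS n : u n.+1 = F (u n) by [].
have und : nondecreasing_seq u.
  apply/nondecreasing_seqP => n; rewrite uS; apply: ltW; apply: Fgt.
  by rewrite pu ltW.
have ub : has_ubound (range u) by exists x => _ [n _ <-]; exact: ltW.
have uc := nondecreasing_cvgn und ub.
set l := sup _ in uc.
have ul n : u n <= l by apply: ub_le_sup => //; exists n.
have lx : l <= x by apply: ge_sup; [exists (u 0%N), 0%N|move=> _ [n _ <-]; exact: ltW].
have pl : p < l by apply: lt_le_trans (ul 0%N).
have c1 : u n.+1 @[n --> \oo] --> l by have := uc; rewrite -cvg_shiftS.
have c2 : u n.+1 @[n --> \oo] --> F l by apply: (cvg_comp _ _ uc); exact: cF.
have lE : F l = l by apply: (cvg_unique _ c2 c1).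
by have := Fgt l; rewrite pl lx lE ltxx => /(_ isT).
Qed.

End ExpandingInterval.

Section ArcMeasure.
Variable R : realType.
Local Notation pi := (@pi R).
Local Notation mR := (measurableTypeR R).
Local Notation dth := (@dtheta R).
Implicit Types (p q : circle R) (z : circle R * circle R).

Definition arc (P : circle R) (a b : R) : set (circle R) :=
  [set p | a < ang (p - P) <= b].

Lemma measurable_arc P a b : measurable (arc P a b).
Proof.
have m : measurable_fun setT (fun p : circle R => ang (p - P)).
  by apply: measurable_ang_sub => //; exact: measurable_id.
have := m measurableT `]a, b]%classic (measurable_itv _); rewrite setTI.
by congr measurable; apply/seteqP; split=> p /=; rewrite in_itv.
Qed.

Lemma dtheta_arc P a b : - pi <= a -> a <= b -> b < pi ->
  dth (arc P a b) = (b - a)%:E.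
Proof.
move=> pa ab bp; pose t0 := ang P.
rewrite (dtheta_itv (t0 - pi)); last exact: measurable_arc.
have -> : (@angle R @^-1` arc P a b : set mR) `&` `[t0 - pi, t0 - pi + 2 * pi[ = `]t0 + a, t0 + b]%classic.
  have e t : angle t - P = angle (t - t0) by rewrite angleB angK.
  have pi0 := pi_gt0 R.
  apply/seteqP; split=> t /=; rewrite /arc /= e !in_itv/=.
    move=> [h /andP[]]; rewrite le_eqVlt => /predU1P[tE _|h1 h2].
      move: h; rewrite (_ : angle (t - t0) = angle pi).
        by rewrite angleK; [move=> /andP[_ ?]; lra|apply/andP; split; lra].
      by apply/angle_eqP; exists (-1); rewrite -tE mulrN1; ring.
    by rewrite angleK in h; [move/andP: h => [? ?]; apply/andP; split|apply/andP; split]; lra.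
  move=> /andP[h1 h2]; split; last by apply/andP; split; lra.
  by rewrite angleK; apply/andP; split; lra.
rewrite lebesgue_measure_itv/= lte_fin ltrD2l; case: ltP => [h|h].
  by rewrite -EFinB; congr EFin; ring.
have -> : b = a by apply: le_anti; rewrite h ab.
by rewrite subrr.
Qed.

End ArcMeasure.

(** * Distortion near a fixed point *)

Section FixedPoints.
Variable R : realType.
Local Notation pi := (@pi R).
Local Notation dth := (@dtheta R).
Local Notation dth2 := (@dtheta R \x @dtheta R)%E.
Implicit Types (p q : circle R) (z : circle R * circle R).
Let p2 : 0 < 2 * pi :> R := twopi_gt0 R.

(** On this box |p - q| <= 2 rho while the lifted points g(p) and g(q) are at distance
D >= d.  If D <= pi, then |k_g| <= sqrt(g'(p) g'(q)) / d, and k_1^2 / 2 <= (k_g - k_1)^2 + k_g^2.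
If D > pi, the representative of g(p) - g(q) is negative, so k_g and k_1 have opposite
signs and (k_g - k_1)^2 >= k_1^2. *)
Lemma box_pointwise (g : circle R -> circle R) F x d rho p q :
  circle_diffeo g -> lift_of g F -> F x = x -> 0 < d -> 0 < rho -> rho <= pi / 4 ->
  x + d <= F (x + rho / 2) ->
  arc (angle x) (rho / 2) rho p -> arc (angle x) (- rho) 0 q ->
  (8 * rho ^+ 2)^-1 <=
    distortion g (p, q) ^+ 2 + (d ^+ 2)^-1 * (cderive g p * cderive g q).
Proof.
move=> gD gF Fx d0 r0 rpi Fd hp hq; have pi0 := pi_gt0 R.
pose u := ang (p - angle x); pose v := ang (q - angle x).
have /andP[u1 u2] : rho / 2 < u <= rho := hp.
have /andP[v1 v2] : - rho < v <= 0 := hq.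
have pE : p = angle (x + u) by rewrite angleD angK addrC subrK.
have qE : q = angle (x + v) by rewrite angleD angK addrC subrK.
have aE : ang (p - q) = u - v.
  rewrite pE qE -angleB (_ : x + u - (x + v) = u - v); last by ring.
  by rewrite angleK//; apply/andP; split; lra.
pose D := F (x + u) - F (x + v).
have Dd : d <= D.
  have h1 : F (x + rho / 2) <= F (x + u) by rewrite (lift_le gD gF); lra.
  have h2 : F (x + v) <= F x by rewrite (lift_le gD gF); lra.
  by rewrite /D; rewrite Fx in h2; lra.
have D2 : D < 2 * pi.
  have : F (x + u) < F (x + v + 2 * pi) by rewrite (lift_lt gD gF); lra.
  by rewrite (lift_period gF) /D; lra.
have bE : ang (g p - g q) = ang (angle D).
  by rewrite pE qE /D angleB !(lift_angle gF).
rewrite distortionE; last exact: cd_inj gD.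
rewrite /density_kernel /= !cderive_id mulr1 sqrtr1 aE bE.
set s := Num.sqrt _.
have c0 t : 0 <= cderive g t by exact/ltW/(cd_pos gD).
have s2 : s ^+ 2 = cderive g p * cderive g q by rewrite sqr_sqrtr// mulr_ge0.
have s0 : 0 <= s by exact: sqrtr_ge0.
rewrite -s2 mul1r.
have uv0 : 0 < u - v by lra.
have X1 : (2 * rho)^-1 <= (u - v)^-1 by rewrite lef_pV2 ?posrE ?mulr_gt0//; lra.
have X0 : 0 < (2 * rho)^-1 by rewrite invr_gt0 mulr_gt0.
have -> : (8 * rho ^+ 2)^-1 = ((2 * rho)^-1) ^+ 2 / 2 by field; rewrite gt_eqF.
have -> : (d ^+ 2)^-1 * s ^+ 2 = (s / d) ^+ 2 by field; rewrite gt_eqF.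
move: X1 X0; set X := (u - v)^-1; set W := (2 * rho)^-1 => X1 X0.
have WX : W ^+ 2 <= X ^+ 2 by rewrite ler_sqr ?nnegrE; lra.
have [Dpi|Dpi] := leP D pi.
  rewrite angleK; last by apply/andP; split; lra.
  have D0 : 0 < D by lra.
  have Y0 : 0 <= s / D by rewrite divr_ge0// ltW.
  have Y1 : s / D <= s / d by rewrite ler_wpM2l// lef_pV2 ?posrE.
  move: Y0 Y1; set Y := s / D; set Z := s / d => Y0 Y1.
  have YZ : Y ^+ 2 <= Z ^+ 2 by rewrite ler_sqr ?nnegrE; lra.
  have := sqr_ge0 (2 * Y - X); rewrite !expr2 in WX YZ *; lra.
have -> : ang (angle D) = D - 2 * pi.
  rewrite (_ : angle D = angle (D - 2 * pi)); last first.
    by apply/angle_eqP; exists 1; rewrite mulr1 subrK.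
  by rewrite angleK//; apply/andP; split; lra.
have Y0 : s / (D - 2 * pi) <= 0 by rewrite mulr_ge0_le0// invr_le0; lra.
move: Y0; set Y := s / _ => Y0.
have := sqr_ge0 (s / d); have := sqr_ge0 Y; rewrite !expr2 in WX *; nra.
Qed.

(** The boxes at the dyadic scales rho_k = r / 2^k, k < N, are disjoint; box k has
measure rho_k^2 / 2, so by [box_pointwise] each contributes 1 / 16.  The integral of
g'(p) g'(q) is the total mass whatever g is. *)
Lemma box_estimate (alpha : R) (g : bijection (circle R)) F x d r N :
  1 / 2 < alpha -> Diff1 alpha g -> lift_of g F -> F x = x ->
  0 < d -> 0 < r -> r <= pi / 4 ->
  x + d <= F (x + r / 2 ^+ N) ->
  ((N%:R / 16)%:E <= \int[dth2]_z (distortion g z ^+ 2)%:E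
     + (d ^+ 2)^-1%:E * dth2 setT)%E.
Proof.
move=> a12 gDiff gF Fx d0 r0 rpi Fd; have pi0 := pi_gt0 R.
have gD : circle_diffeo g by apply: Diff1_circle_diffeo gDiff; lra.
have c0 p : 0 <= cderive g p by exact/ltW/(cd_pos gD).
pose rho (k : nat) := r / 2 ^+ k.
have rho0 k : 0 < rho k by rewrite divr_gt0// exprn_gt0.
have rhor k : rho k <= r.
  by rewrite /rho ler_pdivrMr ?exprn_gt0// ler_peMr ?(ltW r0)// exprn_ege1// ler1n.
have rhoS k : rho k.+1 = rho k / 2.
  by rewrite /rho exprS; field; rewrite expf_neq0.
pose B k := arc (angle x) (rho k / 2) (rho k) `*` arc (angle x) (- rho k) 0.
have mB k : measurable (B k) by apply: measurableX; exact: measurable_arc.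
have BE k : dth2 (B k) = (rho k ^+ 2 / 2)%:E.
  have h1 := rho0 k; have h2 := rhor k.
  have -> : (dth2 (B k) = dth (arc (angle x) (rho k / 2) (rho k)) *
      dth (arc (angle x) (- rho k) 0))%E.
    by apply: product_measure1E; exact: measurable_arc.
  rewrite (_ : dth (arc _ (rho k / 2) _) = (rho k - rho k / 2)%:E); last first.
    by apply: dtheta_arc; lra.
  rewrite (_ : dth (arc _ _ 0) = (0 - - rho k)%:E); last by apply: dtheta_arc; lra.
  by rewrite -EFinM; congr EFin; field.
pose w (k : nat) : R := (8 * rho k ^+ 2)^-1.
have w0 k : 0 <= w k by rewrite invr_ge0 mulr_ge0 ?sqr_ge0.
pose f z : \bar R := ((cderive g z.1 * cderive g z.2)%:E)%E.
have If : (\int[dth2]_z f z = dth2 setT)%E.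
  have := double_substitution gD (f := fun=> 1%E) (measurable_cst _) (fun=> lee01).
  by rewrite integral_cst// mul1e => <-; apply: eq_integral => z _; rewrite mul1e.
have mf : measurable_fun setT f.
  by apply/measurable_EFinP; exact: measurable_cderive2.
have f0 z : (0 <= f z)%E by rewrite lee_fin mulr_ge0.
have mD : measurable_fun setT (fun z => (distortion g z ^+ 2)%:E).
  by apply/measurable_EFinP/measurable_funX; exact: measurable_distortion.
have dd0 : (0 <= (d ^+ 2)^-1%:E)%E by rewrite lee_fin invr_ge0 sqr_ge0.
rewrite -If -ge0_integralZl// -ge0_integralD//; last 3 first.
- by move=> z _; rewrite lee_fin sqr_ge0.
- by move=> z _; rewrite mule_ge0.
- exact: measurable_funeM.
have -> : (N%:R / 16)%:E = (\int[dth2]_z \sum_(k <- iota 0 N) (w k * \1_(B k) z)%:E)%E.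
  rewrite ge0_integral_sum//; last 2 first.
  - by move=> k; apply/measurable_EFinP; apply: measurable_funM.
  - by move=> k z _; rewrite lee_fin mulr_ge0.
  rewrite (eq_bigr (fun=> (16^-1)%:E)) => [|k _].
    rewrite sumEFin; congr EFin; rewrite big_const_seq count_predT size_iota iter_addr_0.
    by rewrite mulr_natl.
  under eq_integral do rewrite EFinM.
  rewrite ge0_integralZl//; last 2 first.
  - by apply/measurable_EFinP.
  - by rewrite lee_fin.
  rewrite integral_indic// setIT [X in (_ * X)%E]BE -EFinM; congr EFin.
  by rewrite /w; field; rewrite gt_eqF.
apply: ge0_le_integral => //.
- by move=> z _; rewrite sume_ge0// => k _; rewrite lee_fin mulr_ge0.
- apply: emeasurable_sum => k; apply/measurable_EFinP; exact: measurable_funM.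
- by apply: emeasurable_funD => //; exact: measurable_funeM.
case=> p q _; rewrite sumEFin /f -EFinM -EFinD lee_fin /=.
have rhs0 : 0 <= distortion g (p, q) ^+ 2 + (d ^+ 2)^-1 * (cderive g p * cderive g q).
  by rewrite addr_ge0 ?sqr_ge0// mulr_ge0 ?invr_ge0 ?sqr_ge0// mulr_ge0.
have [[k [kN Bk]]|noB] := pselect (exists k, (k < N)%N /\ B k (p, q)); last first.
  rewrite big_seq big1 ?rhs0// => k; rewrite mem_iota/= add0n => kN.
  by rewrite indicE memNset ?mulr0// => Bk; apply: noB; exists k.
rewrite (big_rem k)/=; last by rewrite mem_iota.
rewrite big_seq big1 ?addr0.
  rewrite indicE mem_set// mulr1; case: Bk => /= Bp Bq.
  have Fk : x + d <= F (x + rho k / 2).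
    apply: le_trans Fd _; rewrite (lift_le gD gF) lerD2l -rhoS /rho.
    rewrite ler_pM2l// lef_pV2 ?posrE ?exprn_gt0//.
    by rewrite ler_eXn2l// ltr1n.
  by apply: (box_pointwise gD gF Fx d0 (rho0 k) _ Fk Bp Bq); exact: le_trans (rhor k) rpi.
move=> j; rewrite mem_rem_uniq ?iota_uniq// !inE => /andP[jk _].
rewrite indicE memNset ?mulr0// => -[/= Bj _]; case: Bk => /= Bk _.
have mono (i l : nat) : (i < l)%N -> rho l <= rho i / 2.
  move=> il; rewrite -rhoS /rho ler_pM2l// lef_pV2 ?posrE ?exprn_gt0//.
  by rewrite ler_eXn2l// ltr1n.
move: Bj Bk; rewrite /arc /= => /andP[j1 j2] /andP[k1 k2].
have [h|h] := ltnP j k; first by have := mono _ _ h; lra.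
have {}h : (k < j)%N by rewrite ltn_neqAle h eq_sym jk.
by have := mono _ _ h; lra.
Qed.

End FixedPoints.

(** * Freeness of the action *)

Section FreeAction.
Variable R : realType.
Local Notation pi := (@pi R).
Local Notation dth2 := (@dtheta R \x @dtheta R)%E.
Variables (alpha : R) (G : groupClosed (bijection (circle R))).
Hypotheses (a12 : 1 / 2 < alpha) (hG : forall g, g \in G -> Diff1 alpha g).
Implicit Types (g h : bijection (circle R)).

Lemma group_diffeo g : g \in G -> circle_diffeo g.
Proof.
have a0 : 0 < alpha by apply: lt_trans a12; rewrite divr_gt0.
by move=> /hG; exact: Diff1_circle_diffeo.
Qed.

Lemma lift_id : lift_of (@id (circle R)) id.
Proof.
split=> // x; rewrite cderive_id; exact: is_derive_id.
Qed.

Lemma lift_iter g F n : g \in G -> lift_of g F -> lift_of (g ^+ n)%g (iter n F).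
Proof.
move=> gG gF; elim: n => [|n IH]; first by rewrite expg0; exact: lift_id.
rewrite expgS; apply: (lift_comp _ _ gF IH); apply: group_diffeo => //.
exact: gpredXn.
Qed.

Lemma dth2_setT : exists2 T : R, 0 <= T & dth2 setT = T%:E.
Proof.
exists (fine (dth2 setT)); first exact: fine_ge0.
rewrite fineK// ge0_fin_numE// -setXTT product_measure1E//.
by apply: lte_mul_pinfty; rewrite ?measure_ge0 ?fin_num_measure// ltey_eq fin_num_measure.
Qed.

Variable M : R.
Hypothesis bounded : forall g, g \in G ->
  (\int[dth2]_z ((distortion g z) ^+ 2)%:E <= M%:E)%E.

(** A power g^n carries p + r / 2^N beyond x, where N is as large as desired, and
[box_estimate] for g^n contradicts the uniform bound on the distortion. *)
Lemma no_expansion g F a x : g \in G -> lift_of g F -> F a = a -> a < x ->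
  ~ x < F x.
Proof.
move=> gG gF Fa ax Fx; have gD := group_diffeo gG.
have Fmono : {homo F : u v / u <= v} by move=> u v; rewrite (lift_le gD gF).
have [p [ap px Fp Fgt]] := last_fixed_point (lift_cont gF) Fmono Fa ax Fx.
have pi0 := pi_gt0 R.
pose d := x - p; pose r := Num.min d (pi / 4).
have d0 : 0 < d by rewrite subr_gt0.
have r0 : 0 < r by rewrite lt_min d0 divr_gt0.
have rpi : r <= pi / 4 by rewrite ge_min lexx orbT.
have [T T0 TE] := dth2_setT.
pose C := M + (d ^+ 2)^-1 * T.
pose N := (Num.truncn (16 * `|C|)).+1.
have NC : C < N%:R / 16.
  rewrite ltr_pdivlMr// mulrC; apply: le_lt_trans (_ : 16 * `|C| < _).
    by rewrite ler_pM2l// ler_norm.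
  exact: truncnS_gt.
have py : p < p + r / 2 ^+ N by rewrite ltrDl divr_gt0// exprn_gt0.
have [n nP] := orbit_escapes (lift_cont gF) Fgt py.
have gnG : (g ^+ n)%g \in G by exact: gpredXn.
have iFp : iter n F p = p by elim: n {nP gnG} => //= n ->.
have := box_estimate a12 (hG gnG) (lift_iter n gG gF) iFp d0 r0 rpi (N := N).
rewrite /d addrC subrK => /(_ nP); rewrite -/d TE => h.
have {h} := le_trans h (leeD2r _ (bounded gnG)).
by rewrite -EFinM -EFinD lee_fin leNgt NC.
Qed.

Lemma fixed_point_trivial g p : g \in G -> g p = p -> g = 1%g.
Proof.
move=> gG gp; apply: bijectionP => q /=; apply: contrapT => gq.
have gD := group_diffeo gG; have [F0 gF0] := circle_diffeo_lift gD.
have /angle_eqP[k kE] : angle (F0 (ang p)) = angle (ang p).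
  by rewrite (lift_angle gF0) angK.
pose F y := F0 y + 2 * pi * (- k)%:~R.
have gF : lift_of g F by exact: lift_of_shift.
pose a := ang p; have Fa : F a = a.
  by rewrite /F /a kE mulrNz; ring.
have [x ax xq] : exists2 x, a < x & angle x = q.
  exists (ang q + 2 * pi); last by rewrite angleD angK angle2pi addr0.
  have := ang_le_pi p; have := ang_le_pi q; rewrite !ler_norml => /andP[h1 h2] /andP[h3 h4].
  have := ang_itv q; rewrite in_itv/= => /andP[h5 _].
  by rewrite /a; lra.
have Fx : F x != x.
  by apply/eqP => Fx; apply: gq; rewrite -xq -(lift_angle gF) Fx.
(* If F moves x to the left then the inverse lift moves it to the right. *)
move: Fx; rewrite neq_lt => /orP[Fx|Fx]; last exact: no_expansion gG gF Fa ax Fx.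
have giG : (g^-1)%g \in G by rewrite gpredV.
have giD := group_diffeo giG; have [H0 gH0] := circle_diffeo_lift giD.
have idF : lift_of (@id (circle R)) (H0 \o F).
  have := lift_comp giD gD gH0 gF.
  by rewrite (_ : (g^-1)%g \o g = id)//; apply/funext => y /=; rewrite bij_funK.
have [j jE] := lift_unique idF lift_id.
pose H y := H0 y + 2 * pi * j%:~R.
have gH : lift_of (g^-1)%g H by exact: lift_of_shift.
have HF y : H (F y) = y by rewrite /H -[LHS]/((H0 \o F) y + 2 * pi * j%:~R) -jE.
have Ha : H a = a by rewrite -{1}Fa HF.
apply: (no_expansion giG gH Ha ax).
by rewrite -{1}(HF x) (lift_lt giD gH).
Qed.

End FreeAction.

(** * Translation numbers *)

Section QuasiAdditive.
Variable R : realType.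

(** The numbers (a_m - C) / m never exceed the numbers (a_n + C) / n, since both compare
with a_(mn) / (mn); tau is the supremum of the former. *)
Lemma quasi_additive (a : nat -> R) C : (forall m n, `|a (m + n)%N - a m - a n| <= C) ->
  exists tau, forall n, `|a n - n%:R * tau| <= C.
Proof.
move=> aC; have C0 : 0 <= C by apply: le_trans (aC 0%N 0%N).
have a0 : `|a 0%N| <= C by have := aC 0%N 0%N; rewrite addn0 subrr sub0r normrN.
have mulC m n : `|a (m.+1 * n)%N - m.+1%:R * a n| <= m.+1%:R * C.
  elim: m => [|m IH]; first by rewrite mul1n mul1r subrr normr0 mul1r.
  rewrite mulSn -natr1 !mulrDl !mul1r.
  have -> : a (n + m.+1 * n)%N - (m.+1%:R * a n + a n) =
      (a (n + m.+1 * n)%N - a n - a (m.+1 * n)%N) + (a (m.+1 * n)%N - m.+1%:R * a n).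
    by ring.
  by apply: le_trans (ler_normD _ _) _; rewrite addrC; apply: lerD.
pose S := [set t | exists m : nat, t = (a m.+1 - C) / m.+1%:R].
have SU n : ubound S ((a n.+1 + C) / n.+1%:R).
  move=> _ [m ->]; rewrite ler_pdivrMr// mulrAC ler_pdivlMr//.
  have := mulC m n.+1; have := mulC n m.+1; rewrite mulnC.
  rewrite !ler_norml => /andP[h1 h2] /andP[h3 h4].
  by lra.
have S0 : S !=set0 by exists ((a 1%N - C) / 1); exists 0%N.
exists (sup S) => -[|n]; first by rewrite mul0r subr0.
have h1 : sup S <= (a n.+1 + C) / n.+1%:R by apply: ge_sup.
have h2 : (a n.+1 - C) / n.+1%:R <= sup S.
  by apply: ub_le_sup; [exists ((a 1%N + C) / 1%:R); exact: SU|exists n].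
move: h1 h2; rewrite ler_pdivlMr// ler_pdivrMr// => h1 h2.
by rewrite ler_norml; apply/andP; split; lra.
Qed.

Lemma bounded_multiples (t C : R) : (forall n, `|n%:R * t| <= C) -> t = 0.
Proof.
move=> tC; apply/eqP; rewrite -normr_le0 leNgt; apply/negP => t0.
have := tC (Num.truncn (C / `|t|)).+1; rewrite normrM ger0_norm// leNgt => /negP; apply.
by rewrite -ltr_pdivrMr//; exact: truncnS_gt.
Qed.

End QuasiAdditive.

Section MonotoneWords.
Variable R : realType.
Variables (f h : R -> R).
Hypotheses (fm : {homo f : x y / x <= y}) (hm : {homo h : x y / x <= y})
  (hf : forall x, h (f x) <= f (h x)).

Let hmn n : {homo iter n h : x y / x <= y}.
Proof. by elim: n => [//|n IH] x y xy /=; apply/hm/IH. Qed.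

Let hfn n x : h (iter n f x) <= iter n f (h x).
Proof.
elim: n => [//|n IH] /=; apply: le_trans (hf _) _; exact: fm.
Qed.

(** When h f <= f h, moving the letters f to the left in a word of f's and h's
increases it, so (f h)^n and (h f)^n lie between h^n f^n and f^n h^n. *)
Lemma word_le n x : iter n h (iter n f x) <= iter n (h \o f) x /\
  iter n (h \o f) x <= iter n (f \o h) x /\ iter n (f \o h) x <= iter n f (iter n h x).
Proof.
split; last split.
- elim: n x => [//|n IH] x; rewrite (iterSr n h) (iterSr n f) (iterSr n (h \o f)).
  by apply: le_trans (IH _); apply: hmn; exact: hfn.
- elim: n => [//|n IH] /=; apply: le_trans (hf _) _.
  by apply/fm/hm.
- elim: n => [//|n IH] /=; apply: fm.
  by apply: le_trans (hfn _ _); exact: hm.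
Qed.

End MonotoneWords.

Section TranslationNumber.
Variable R : realType.
Local Notation pi := (@pi R).
Let p2 : 0 < 2 * pi :> R := twopi_gt0 R.

Definition degree_one (F : R -> R) := {homo F : x y / x <= y} /\
  forall x, F (x + 2 * pi) = F x + 2 * pi.

(** Asking for a bounded distance to n tau, rather than for tau = lim F^n(0) / n, avoids
limits: existence is [quasi_additive]. *)
Definition translation_number (F : R -> R) tau :=
  exists C, forall n, `|iter n F 0 - n%:R * tau| <= C.

Lemma degree_one_iter F n : degree_one F -> degree_one (iter n F).
Proof.
move=> [Fm Fp]; split; first by elim: n => [//|n IH] x y xy /=; apply/Fm/IH.
by elim: n => [//|n IH] x /=; rewrite IH Fp.
Qed.

Lemma degree_one_int F (k : int) x : degree_one F ->
  F (x + 2 * pi * k%:~R) = F x + 2 * pi * k%:~R.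
Proof. by move=> [_]; exact: turn_equivariant_int. Qed.

(** F - id is periodic, and over one turn it varies by at most one turn. *)
Lemma degree_one_near F x : degree_one F -> `|F x - x - F 0| <= 2 * pi.
Proof.
move=> FD; have [k /andP[y0 y1]] := first_turn x.
pose y := x - 2 * pi * k%:~R; rewrite -/y in y0 y1.
have xE : x = y + 2 * pi * k%:~R by rewrite subrK.
have -> : F x - x - F 0 = F y - y - F 0.
  have Fx : F x = F y + 2 * pi * k%:~R by rewrite {1}xE degree_one_int.
  by rewrite Fx /y; ring.
have [Fm Fp] := FD; have h1 := Fm _ _ y0; have h2 := Fm _ _ y1.
have h3 := Fp 0; rewrite add0r in h3.
by rewrite ler_norml; apply/andP; split; lra.
Qed.

Lemma translation_number_exists F : degree_one F -> exists tau, translation_number F tau.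
Proof.
move=> FD.
have qa m n : `|iter (m + n) F 0 - iter m F 0 - iter n F 0| <= 2 * pi.
  by rewrite iterD addrAC; exact: degree_one_near (degree_one_iter m FD).
by have [tau H] := quasi_additive (a := fun n => iter n F 0) qa; exists tau, (2 * pi).
Qed.

Lemma translation_number_unique F tau sigma :
  translation_number F tau -> translation_number F sigma -> tau = sigma.
Proof.
move=> [C HC] [D HD]; apply/eqP; rewrite -subr_eq0; apply/eqP.
apply: (@bounded_multiples _ _ (C + D)) => n.
have -> : n%:R * (tau - sigma) = (iter n F 0 - n%:R * sigma) - (iter n F 0 - n%:R * tau).
  by ring.
by apply: le_trans (ler_normB _ _) _; rewrite addrC lerD.
Qed.

Lemma translation_number_shift F tau (k : int) : degree_one F ->
  translation_number F tau ->
  translation_number (fun x => F x + 2 * pi * k%:~R) (tau + 2 * pi * k%:~R).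
Proof.
move=> FD [C HC]; exists C => n.
have -> : iter n (fun x => F x + 2 * pi * k%:~R) 0 = iter n F 0 + n%:R * (2 * pi * k%:~R).
  elim: n => [|n IH]; first by rewrite mul0r addr0.
  rewrite iterS IH.
  have -> : n%:R * (2 * pi * k%:~R) = 2 * pi * (n%:Z * k)%:~R :> R.
    by rewrite intrM; ring.
  by rewrite degree_one_int// iterS -addrA; congr (_ + _); rewrite intrM -natr1; ring.
suff -> : iter n F 0 + n%:R * (2 * pi * k%:~R) - n%:R * (tau + 2 * pi * k%:~R) =
  iter n F 0 - n%:R * tau by exact: HC.
by ring.
Qed.

(** By [word_le] the orbit of 0 under the n-th power of F H or of H F lies between the
values at 0 of H^n F^n and F^n H^n, and these are n (tau + sigma) up to a bounded
error. *)
Lemma translation_number_word F H tau sigma : degree_one F -> degree_one H ->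
  translation_number F tau -> translation_number H sigma ->
  (forall x, H (F x) <= F (H x)) ->
  translation_number (F \o H) (tau + sigma) /\
  translation_number (H \o F) (tau + sigma).
Proof.
move=> FD HD [C HC] [D HDn] HF.
have key (u : nat -> R) : (forall n, iter n H (iter n F 0) <= u n) ->
    (forall n, u n <= iter n F (iter n H 0)) ->
    exists C, forall n, `|u n - n%:R * (tau + sigma)| <= C.
  move=> u1 u2; exists (2 * pi + C + D) => n.
  have := degree_one_near (iter n H 0) (degree_one_iter n FD).
  have := degree_one_near (iter n F 0) (degree_one_iter n HD).
  have := u1 n; have := u2 n; have := HC n; have := HDn n.
  rewrite !ler_norml => /andP[? ?] /andP[? ?] ? ? /andP[? ?] /andP[? ?].
  by apply/andP; split; lra.
have W n := word_le FD.1 HD.1 HF n 0.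
split; apply: key => n; have [w1 [w2 w3]] := W n => //.
  exact: le_trans w2.
exact: le_trans w3.
Qed.

End TranslationNumber.

(** * Dirichlet approximation and torsion *)

Section Dirichlet.
Variable R : realType.
Local Notation pi := (@pi R).
Let p2 : 0 < 2 * pi :> R := twopi_gt0 R.

Definition near_turns (e t : R) := exists k : int, `|t - 2 * pi * k%:~R| < e.

(** Pigeonhole on the fractional parts of j t / (2 pi), j <= N. *)
Lemma dirichlet1 (e : R) : 0 < e -> exists N : nat, forall t : R,
  exists j : nat, (0 < j <= N)%N /\ near_turns e (j%:R * t).
Proof.
move=> e0; pose N := (Num.truncn (2 * pi / e)).+1.
have Ne : 2 * pi < N%:R * e by rewrite -ltr_pdivrMr//; exact: truncnS_gt.
have p0 : 2 * pi != 0 :> R by rewrite gt_eqF.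
exists N => t.
pose k (j : nat) := Num.floor (j%:R * t / (2 * pi)).
pose y (j : nat) := j%:R * t / (2 * pi) - (k j)%:~R.
have y0 j : 0 <= y j by rewrite subr_ge0; exact: ge_floor.
have y1 j : y j < 1.
  by have := floorD1_gt (j%:R * t / (2 * pi)); rewrite -/(k j) intrD /y; lra.
have yb j : (Num.truncn (N%:R * y j) < N)%N.
  by rewrite truncn_lt_nat ?mulr_ge0// -[ltRHS]mulr1 ltr_pM2l// ltr0n.
pose b (j : 'I_N.+1) := Ordinal (yb j).
have /injectivePn[i [j ij bij]] : ~~ injectiveb b.
  apply/negP => /injectiveP/leq_card; by rewrite !card_ord ltnn.
wlog lij : i j ij bij / (i < j)%N.
  move=> W; have [|h|h] := ltngtP i j; first exact: W.
    by apply: (W j i) => //; rewrite eq_sym.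
  by move: ij; rewrite -val_eqE /= h eqxx.
exists (j - i)%N; split.
  by rewrite subn_gt0 lij /= (leq_trans (leq_subr _ _))// -ltnS.
exists (k j - k i).
have -> : (j - i)%:R * t - 2 * pi * (k j - k i)%:~R = 2 * pi * (y j - y i).
  have piN0 : pi != 0 :> R by rewrite gt_eqF ?pi_gt0.
  rewrite natrB ?(ltnW lij)// intrB /y; move: (pi) piN0 => P PN0.
  by field; rewrite PN0.
have tb : Num.truncn (N%:R * y i) = Num.truncn (N%:R * y j) by case: bij.
have h1 := truncn_le (N%:R * y i); have h2 := truncn_le (N%:R * y j).
have h3 := truncnS_gt (N%:R * y i); have h4 := truncnS_gt (N%:R * y j).
rewrite tb in h1 h3; rewrite mulr_ge0// in h1; rewrite mulr_ge0// in h2.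
rewrite -natr1 in h3 h4.
have N0 : 0 < N%:R :> R by rewrite ltr0n.
rewrite normrM gtr0_norm//.
have : `|y j - y i| * N%:R < 1.
  rewrite -[X in _ * X]gtr0_norm// -normrM ltr_norml; apply/andP; split; lra.
have := normr_ge0 (y j - y i); set u := `|_| => u0 u1.
have [->|uN0] := eqVneq u 0; first by rewrite mulr0.
have up : 0 < u by rewrite lt_def uN0.
have h5 : u * (2 * pi) < u * (N%:R * e) by rewrite ltr_pM2l.
have h6 : u * N%:R * e < 1 * e by rewrite ltr_pM2r.
by rewrite mulrC; lra.
Qed.

(** Induction on the sequence: having found m for the tail with precision e / N, a
further factor j <= N handles the head and loses at most a factor N on the tail. *)
Lemma dirichlet (s : seq R) (e : R) : 0 < e -> exists m : nat, (0 < m)%N /\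
  forall t, t \in s -> near_turns e (m%:R * t).
Proof.
elim: s e => [|t0 s IH] e e0; first by exists 1%N.
have [N NP] := dirichlet1 e0.
have N0 : (0 < N)%N by have [j [/andP[j0 jN] _]] := NP 0; exact: leq_trans jN.
have eN : 0 < e / N%:R by rewrite divr_gt0// ltr0n.
have [m [m0 mP]] := IH _ eN.
have [j [/andP[j0 jN] jP]] := NP (m%:R * t0).
exists (j * m)%N; split; first by rewrite muln_gt0 j0.
move=> t; rewrite inE => /orP[/eqP ->|/mP[k kP]].
  by rewrite natrM -mulrA.
exists (j%:Z * k); rewrite natrM intrM.
have -> : j%:R * m%:R * t - 2 * pi * (j%:~R * k%:~R) = j%:R * (m%:R * t - 2 * pi * k%:~R).
  by ring.
rewrite normrM ger0_norm//.
have j0' : 0 < j%:R :> R by rewrite ltr0n.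
apply: (@lt_le_trans _ _ (j%:R * (e / N%:R))); first by rewrite ltr_pM2l.
rewrite mulrCA ger_pMr// ler_pdivrMr ?ltr0n// mul1r ler_nat//.
Qed.

Lemma cos_near (eps : R) : 0 < eps -> exists2 e, 0 < e &
  forall t, near_turns e t -> 1 - cos t < eps.
Proof.
move=> eps0; have c : cos y @[y --> (0:R)] --> cos (0 : R) by exact: continuous_cos.
move/cvgrPdist_lt : c => /(_ _ eps0)/nbhs_ballP[e /= e0 eP]; exists e => // t [k tk].
have := eP (t - 2 * pi * k%:~R); rewrite /ball/= sub0r normrN => /(_ tk).
rewrite cos0 -(cos_periodic k (t - _)) subrK => h.
exact: le_lt_trans (ler_norm _) h.
Qed.

Lemma cos_eq1_turns (t : R) : cos t = 1 -> exists k : int, t = 2 * pi * k%:~R.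
Proof.
have [k kE] := ang_shift t; rewrite kE cos_periodic => /cos_eq1 h.
exists k; rewrite h ?add0r//; have := ang_itv (angle t); by rewrite in_itv.
Qed.

End Dirichlet.

Section Characters.
Variables (R : realType) (gT : groupType) (tau : gT -> R).
Local Notation pi := (@pi R).
Hypothesis tauM : forall x y, exists k : int, tau (x * y)%g = tau x + tau y + 2 * pi * k%:~R.

Lemma psd_cos (c : R) : psd (fun x y => cos (c * (tau x - tau y))).
Proof.
rewrite (_ : (fun x y => _) = (fun x y => cos (c * tau x) * cos (c * tau y) * 1 +
    sin (c * tau x) * sin (c * tau y) * 1)).
  by apply: psd_add; apply: psd_rank1; exact: psd_cst.
by apply/funext => x; apply/funext => y; rewrite !mulr1 mulrBr cosB.
Qed.

(** Apply [kazhdan_kernel] to cos(m (tau x - tau y)), with m given by [dirichlet] so that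
the kernel is close to 1 on the Kazhdan set.  Every combination f of its sections
satisfies f(u) + f(u^-1) = 2 cos(m tau(u)) f(1); as f can be uniformly close to 1,
cos(m tau(u)) = 1. *)
Lemma kazhdan_torsion : kazhdan R gT ->
  exists m : nat, (0 < m)%N /\ forall x, exists k : int, m%:R * tau x = 2 * pi * k%:~R.
Proof.
move=> /kazhdan_kernel[S [eps [eps0 SP]]].
have [e e0 eP] := cos_near eps0.
have [m [m0 mP]] := dirichlet [seq tau 1%g - tau s | s <- S] e0.
exists m; split=> // u.
have cosm x y (k : int) : x = y + m%:R * (2 * pi * k%:~R) -> cos x = cos y.
  move=> ->; have -> : m%:R * (2 * pi * k%:~R) = 2 * pi * (m%:Z * k)%:~R :> R.
    by rewrite intrM; ring.
  exact: cos_periodic.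
pose K := PsdKernel (kern := fun x y => cos (m%:R * (tau x - tau y)))
  (fun x y => etrans (esym (cosN _)) (congr1 cos (esym (etrans (congr1 ( *%R m%:R) (esym (opprB _ _))) (mulrN _ _)))))
  (psd_cos m%:R).
have [v vE] := tauM 1%g 1%g; rewrite mul1g in vE.
have tau1 : tau 1%g = - (2 * pi * v%:~R) by lra.
have [w wE] := tauM u u^-1%g; rewrite mulgV tau1 in wE.
have tauV : tau u^-1%g = - tau u - 2 * pi * (v + w)%:~R by rewrite intrD; lra.
have H d : 0 < d -> 2 - 2 * cos (m%:R * tau u) <= 4 * d.
  move=> d0; have [|||s sP] := SP K _ _ _ d d0.
  - move=> y x x'; rewrite /=; have [k ->] := tauM x y; have [k' ->] := tauM x' y.
    by apply: (cosm _ _ (k - k')); rewrite intrB; ring.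
  - by rewrite /= subrr mulr0 cos0.
  - by move=> k kS; rewrite /=; apply/eP/mP/map_f.
  pose f g := section_of K s g.
  have fE : f u + f u^-1%g = 2 * cos (m%:R * tau u) * f 1%g.
    rewrite /f /section_of mulr_sumr -big_split; apply: eq_bigr => p _ /=.
    have -> : cos (m%:R * (tau p.2 - tau u)) =
        cos (m%:R * (tau p.2 - tau 1%g) - m%:R * tau u).
      by apply: (cosm _ _ (- v)); rewrite tau1 mulrNz; ring.
    have -> : cos (m%:R * (tau p.2 - tau u^-1%g)) =
        cos (m%:R * (tau p.2 - tau 1%g) + m%:R * tau u).
      by apply: (cosm _ _ w); rewrite tau1 tauV intrD; ring.
    by rewrite cosB cosD; ring.
  have := sP u; have := sP u^-1%g; have := sP 1%g; rewrite -/(f _) -/(f _) -/(f _).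
  rewrite !ler_norml => /andP[h1 h2] /andP[h3 h4] /andP[h5 h6].
  have := cos_le1 (m%:R * tau u); have := cos_geN1 (m%:R * tau u).
  by nra.
apply: cos_eq1_turns; apply: le_anti; rewrite cos_le1 /= leNgt; apply/negP => h.
have := H ((1 - cos (m%:R * tau u)) / 4); rewrite divr_gt0 ?subr_gt0// => /(_ isT).
by lra.
Qed.

End Characters.

(** * Finiteness of the group *)

Section FixedPointOfTranslation0.
Variable R : realType.
Local Notation pi := (@pi R).
Let p2 : 0 < 2 * pi :> R := twopi_gt0 R.

(** Without a fixed point F - id would be positive, hence bounded below by some d > 0 by
compactness of a turn, and F^n(0) >= n d would be unbounded. *)
Lemma translation0_fixed_pos (F : R -> R) : continuous F -> degree_one F ->
  translation_number F 0 -> 0 < F 0 -> exists t, F t = t.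
Proof.
move=> cF FD [C HC] F0; apply: contrapT => /forallNP nofix.
have cphi : continuous (fun t => F t - t).
  by move=> t; apply: cvgB; [exact: cF|exact: cvg_id].
have pos t : 0 < F t - t.
  rewrite lt_neqAle; apply/andP; split.
    by apply/eqP => /esym/eqP; rewrite subr_eq0 => /eqP; exact: nofix.
  rewrite leNgt; apply/negP => Ft.
  have ivt a b : a <= b -> Num.min (F a - a) (F b - b) <= 0 <= Num.max (F a - a) (F b - b) -> False.
    move=> ab h; have [|z _ /eqP] := @IVT _ (fun t => F t - t) a b 0 ab _ h.
      exact: continuous_subspaceT.
    by rewrite subr_eq0 => /eqP; exact: nofix.
  have [t0|t0] := leP 0 t.
    by apply: (ivt _ _ t0); rewrite ge_min le_max subr0 (ltW F0) (ltW Ft) orbT.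
  by apply: (ivt _ _ (ltW t0)); rewrite ge_min le_max subr0 (ltW F0) (ltW Ft) orbT.
have [c _ cP] : exists2 c, c \in `[0, 2 * pi] & forall t, t \in `[0, 2 * pi] -> F c - c <= F t - t.
  by apply: EVT_min; [exact: ltW|exact: continuous_subspaceT].
pose d := F c - c.
have dle t : d <= F t - t.
  have [k /andP[y0 y1]] := first_turn t.
  pose y := t - 2 * pi * k%:~R; rewrite -/y in y0 y1.
  have tE : t = y + 2 * pi * k%:~R by rewrite subrK.
  have Ft : F t = F y + 2 * pi * k%:~R by rewrite {1}tE degree_one_int.
  have -> : F t - t = F y - y by rewrite Ft /y; ring.
  by apply: cP; rewrite in_itv/= y0.
have it n : n%:R * d <= iter n F 0.
  elim: n => [|n IH]; first by rewrite mul0r.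
  by rewrite -natr1 mulrDl mul1r /=; have := dle (iter n F 0); lra.
have d0 : 0 < d by exact: pos.
have : d = 0.
  apply: (@bounded_multiples _ _ C) => n; rewrite ger0_norm ?mulr_ge0 ?(ltW d0)//.
  apply: le_trans (it n) _; apply: le_trans (ler_norm _) _.
  by have := HC n; rewrite mulr0 subr0.
by move=> dE; rewrite dE ltxx in d0.
Qed.

Lemma translation0_fixed (F : R -> R) : continuous F -> degree_one F ->
  translation_number F 0 -> exists t, F t = t.
Proof.
move=> cF FD FT; have [F0|F0|F0] := ltgtP (F 0) 0.
- pose H x := - F (- x).
  have cH : continuous H.
    move=> x; apply: cvgN; apply: (@continuous_comp _ _ _ -%R F); last exact: cF.
    exact: opp_continuous.
  have HD : degree_one H.
    split=> [x y xy|x]; first by rewrite /H lerN2; apply: FD.1; rewrite lerN2.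
    have := FD.2 (- x - 2 * pi); rewrite subrK => FE.
    by rewrite /H opprD FE; ring.
  have HT : translation_number H 0.
    have [C HC] := FT; exists C => n.
    have -> : iter n H 0 = - iter n F 0.
      by elim: n => [|n IH]; [rewrite oppr0|rewrite !iterS IH /H opprK].
    by have := HC n; rewrite !mulr0 !subr0 normrN.
  have [|t tE] := translation0_fixed_pos cH HD HT.
    by rewrite /H oppr0 oppr_gt0.
  by exists (- t); rewrite -{2}tE opprK.
- exact: translation0_fixed_pos.
- by exists 0.
Qed.

End FixedPointOfTranslation0.

Section Finiteness.
Variable R : realType.
Local Notation pi := (@pi R).
Variables (alpha : R) (G : groupClosed (bijection (circle R))).
Hypotheses (a12 : 1 / 2 < alpha) (hG : forall g, g \in G -> Diff1 alpha g).
Hypothesis free : forall g p, g \in G -> g p = p -> g = 1%g.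
Implicit Types (g h : bijection (circle R)).

Lemma lift_degree_one g F : g \in G -> lift_of g F -> degree_one F.
Proof.
move=> gG gF; have gD := group_diffeo a12 hG gG.
by split; [move=> x y; rewrite (lift_le gD gF)|exact: lift_period gF].
Qed.

(** If neither of F H and H F dominates the other, they agree at some point, where
(hg)^-1 gh has a fixed point; by freeness gh = hg, so the lifts F H and H F differ by
a constant, which is 0.  Otherwise [translation_number_word] applies. *)
Lemma translation_number_comp g h F H tau sigma : g \in G -> h \in G ->
  lift_of g F -> lift_of h H ->
  translation_number F tau -> translation_number H sigma ->
  translation_number (F \o H) (tau + sigma).
Proof.
move=> gG hGr gF hH FT HT.
have gD := group_diffeo a12 hG gG; have hD := group_diffeo a12 hG hGr.
have FD := lift_degree_one gG gF; have HD := lift_degree_one hGr hH.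
have [K|/existsNP[s sK]] := pselect (forall x, H (F x) <= F (H x)).
  by have [] := translation_number_word FD HD FT HT K.
have [K|/existsNP[t tK]] := pselect (forall x, F (H x) <= H (F x)).
  by have [_] := translation_number_word HD FD HT FT K; rewrite addrC.
exfalso; move/negP : sK; rewrite -ltNge => sK; move/negP : tK; rewrite -ltNge => tK.
have ghL := lift_comp gD hD gF hH; have hgL := lift_comp hD gD hH gF.
have cF := lift_cont gF; have cH := lift_cont hH.
pose phi x := F (H x) - H (F x).
have cphi : continuous phi.
  move=> x; apply: cvgB.
    by apply: (@continuous_comp _ _ _ H F); [exact: cH|exact: cF].
  by apply: (@continuous_comp _ _ _ F H); [exact: cF|exact: cH].
have [u uE] : exists u, phi u = 0.
  have [st|st] := leP s t.
    have [||u _ uE] := @IVT _ phi s t 0 st; last by exists u.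
      exact: continuous_subspaceT.
    by rewrite ge_min le_max /phi !subr_le0 !subr_ge0 (ltW sK) (ltW tK) orbT.
  have [||u _ uE] := @IVT _ phi t s 0 (ltW st); last by exists u.
    exact: continuous_subspaceT.
  by rewrite ge_min le_max /phi !subr_le0 !subr_ge0 (ltW sK) (ltW tK) orbT.
have uE' : F (H u) = H (F u) by apply/eqP; rewrite -subr_eq0; apply/eqP.
have gh1 : ((h * g)^-1 * (g * h))%g = 1%g.
  apply: (free (p := angle u)).
    by rewrite gpredM ?gpredV ?gpredM.
  have -> : ((h * g)^-1 * (g * h))%g (angle u) = ((h * g)^-1)%g (g (h (angle u))) by [].
  rewrite -(lift_angle hH) -(lift_angle gF) uE' (lift_angle hH) (lift_angle gF).
  exact: (bij_funK (h * g)%g).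
have gh : (g * h)%g = (h * g)%g.
  by have := congr1 (fun x => ((h * g) * x)%g) gh1; rewrite mulgA mulgV mul1g mulg1.
have ghL' : lift_of (h \o g) (F \o H).
  by have := congr1 (@bij_fun _) gh => /= <-.
have [k kE] := lift_unique hgL ghL'.
have k0 : 2 * pi * k%:~R = 0 by have := kE u; rewrite /= uE'; lra.
by have := kE s; rewrite /= k0 addr0 => sE; rewrite sE ltxx in sK.
Qed.

Lemma translation_number_trivial g F (k : int) : g \in G -> lift_of g F ->
  translation_number F (2 * pi * k%:~R) -> g = 1%g.
Proof.
move=> gG gF FT; have FD := lift_degree_one gG gF.
have gF' := lift_of_shift (- k) gF.
have FT' := translation_number_shift (- k) FD FT.
rewrite [X in translation_number _ X](_ : _ = 0) in FT'; last by rewrite mulrNz mulrN subrr.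
have [t tE] := translation0_fixed (lift_cont gF') (lift_degree_one gG gF') FT'.
by apply: (free (p := angle t) gG); rewrite -(lift_angle gF') tE.
Qed.

Lemma group_translation : exists tau : subgroup_of G -> R,
  (forall x y, exists k : int, tau (x * y)%g = tau x + tau y + 2 * pi * k%:~R) /\
  (forall x (k : int), tau x = 2 * pi * k%:~R -> x = 1%g).
Proof.
have gin (x : subgroup_of G) : sg_val x \in G by case: x.
have ex (x : subgroup_of G) : exists Ft : (R -> R) * R,
    lift_of (sg_val x) Ft.1 /\ translation_number Ft.1 Ft.2.
  have [F xF] := circle_diffeo_lift (group_diffeo a12 hG (gin x)).
  have [t tP] := translation_number_exists (lift_degree_one (gin x) xF).
  by exists (F, t).
have [L LP] := choice ex; exists (fun x => (L x).2); split.
  move=> x y; have [xF xT] := LP x; have [yF yT] := LP y; have [xyF xyT] := LP (x * y)%g.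
  have T := translation_number_comp (gin x) (gin y) xF yF xT yT.
  have F : lift_of (sg_val (x * y)%g) ((L x).1 \o (L y).1).
    have -> : (sg_val (x * y)%g : circle R -> circle R) = sg_val x \o sg_val y by [].
    by apply: lift_comp => //; exact: (group_diffeo a12 hG).
  have [k kE] := lift_unique F xyF; exists k.
  have := translation_number_shift k (lift_degree_one (gin _) F) T.
  apply: translation_number_unique.
  by rewrite (_ : (L (x * y)%g).1 = fun t => ((L x).1 \o (L y).1) t + 2 * pi * k%:~R) in xyT; last exact/funext.
move=> x k xk; have [xF xT] := LP x; rewrite xk in xT.
have x1 := translation_number_trivial (gin x) xF xT.
exact: val_inj.
Qed.

(** Since m tau takes values in 2 pi Z, the class of m tau / (2 pi) modulo m determines
tau modulo 2 pi, and hence the element.  The enumeration may repeat elements. *)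
Lemma kazhdan_finite : kazhdan R (subgroup_of G) ->
  exists (m : nat) (e : 'I_m -> bijection (circle R)),
    (forall i, e i \in G) /\ forall g, g \in G -> exists i, g = e i.
Proof.
move=> kG; have [tau [tauM tau1]] := group_translation.
have [m [m0 mP]] := kazhdan_torsion tauM kG.
pose res (i : 'I_m) (x : subgroup_of G) :=
  exists j : int, m%:R * tau x = 2 * pi * (i%:Z + m%:Z * j)%:~R.
have pick (i : 'I_m) : exists y : subgroup_of G, forall x, res i x -> x = y.
  have [[y yi]|no] := pselect (exists y, res i y); last first.
    by exists 1%g => x xi; exfalso; apply: no; exists x.
  exists y => x [j jE]; have [j' jE'] := yi.
  have [v vE] := tauM x y^-1%g; have [w wE] := tauM y y^-1%g.
  have [q0 oE] := tauM 1%g 1%g; rewrite mul1g in oE.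
  rewrite mulgV in wE.
  have mN0 : m%:R != 0 :> R by rewrite pnatr_eq0 -lt0n.
  have txy : tau x - tau y = 2 * pi * (j - j')%:~R.
    apply: (mulfI mN0); rewrite mulrBr jE jE' !intrD !intrM intrN; ring.
  suff xy : (x * y^-1)%g = 1%g.
    by have := congr1 (fun z => (z * y)%g) xy; rewrite mulgVK mul1g.
  apply: (tau1 _ (j - j' - q0 + v - w)); rewrite vE.
  by rewrite !(intrD, intrN) in txy *; lra.
have [e eP] := choice pick.
exists m, (fun i => sg_val (e i)); split; first by move=> i; case: (e i).
move=> g gG; pose x := SubgroupOf gG; have [k kE] := mP x.
have mZ : (m%:Z != 0)%R by rewrite eqz_nat -lt0n.
have lt : (`|(k %% m%:Z)%Z| < m)%N.
  rewrite -ltz_nat gez0_abs ?modz_ge0//; by have := ltz_mod k mZ; rewrite ger0_norm.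
exists (Ordinal lt); rewrite -(eP (Ordinal lt) x)// /res /=.
exists (k %/ m%:Z)%Z; rewrite kE gez0_abs ?modz_ge0//.
by congr (2 * pi * _%:~R); rewrite addrC mulrC -divz_eq.
Qed.

End Finiteness.

(** * Complex square-integrable functions *)

Section RealInner.
Context d (T : measurableType d) (R : realType) (mu : {measure set T -> \bar R}).
Implicit Types f g h : T -> R.

Lemma Lfun2P f : f \in Lfun mu 2%:E <-> sq_integrable mu f.
Proof.
split=> [fL|[mf f2]].
  move: (Lfun2_integrable_sqr fL) (sub_Lfun_mfun fL) => /integrableP[_ f2] /[!inE] mf.
  split=> //; apply: le_lt_trans f2; apply: ge0_le_integral => //.
  - by move=> x _; rewrite lee_fin sqr_ge0.
  - by apply/measurable_EFinP; exact: measurable_funX.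
  - by apply: measurableT_comp => //; apply/measurable_EFinP; exact: measurable_funX.
  - by move=> x _; exact: lee_abs.
rewrite inE; apply/andP; split; rewrite inE//= /finite_norm unlock.
apply: poweR_lty; apply: le_lt_trans f2.
rewrite le_eqVlt; apply/orP; left; apply/eqP; apply: eq_integral => x _ /=.
by rewrite powR_mulrn ?normr_ge0// real_normK// num_real.
Qed.

Lemma sq_integrable_comb a b f g : sq_integrable mu f -> sq_integrable mu g ->
  sq_integrable mu (fun x => a * f x + b * g x).
Proof.
move=> fS gS; have f0 : sq_integrable mu (fun x => f x + (a - 1) * f x).
  exact: sq_integrable_lin.
have := sq_integrable_lin b f0 gS; congr sq_integrable; apply/funext => x; ring.
Qed.

Lemma inner_comb a b f g h : sq_integrable mu f -> sq_integrable mu g ->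
  sq_integrable mu h ->
  \int[mu]_x ((a * f x + b * g x) * h x) =
    a * (\int[mu]_x (f x * h x)) + b * (\int[mu]_x (g x * h x)).
Proof.
move=> fS gS hS; have If := sq_integrableM fS hS; have Ig := sq_integrableM gS hS.
rewrite -RintegralZl// -RintegralZl// -RintegralD//; try exact: rintegrableZ.
by apply: eq_Rintegral => x _; ring.
Qed.

End RealInner.

Section L2Complex.
Variable R : realType.
Local Notation dth := (@dtheta R).
Local Notation sqI := (sq_integrable dth).
Local Notation reP f := (fun p => complex.Re (f p)).
Local Notation imP f := (fun p => complex.Im (f p)).
Implicit Types f u v w : circle R -> R[i].

Lemma L2CP f : L2C f <-> sqI (reP f) /\ sqI (imP f).
Proof. by split=> -[/Lfun2P fr /Lfun2P fi]. Qed.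

Let rdot (x y : circle R -> R) := \int[dth]_p (x p * y p).

Lemma Re_lin (a x y : R[i]) : complex.Re (a * x + y) =
  complex.Re a * complex.Re x + (- complex.Im a) * complex.Im x + complex.Re y.
Proof. by case: a x y => [a1 a2] [x1 x2] [y1 y2] /=; ring. Qed.

Lemma Im_lin (a x y : R[i]) : complex.Im (a * x + y) =
  complex.Re a * complex.Im x + complex.Im a * complex.Re x + complex.Im y.
Proof. by case: a x y => [a1 a2] [x1 x2] [y1 y2] /=; ring. Qed.

Lemma L2C_lin (a : R[i]) u v : L2C u -> L2C v -> L2C (fun p => a * u p + v p).
Proof.
move=> /L2CP[ur ui] /L2CP[vr vi]; apply/L2CP; split.
- under eq_fun do rewrite Re_lin -[X in _ + X]mul1r.
  have := sq_integrable_comb 1 1 (sq_integrable_comb (complex.Re a) (- complex.Im a) ur ui) vr.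
  by congr sq_integrable; apply/funext => x; ring.
- under eq_fun do rewrite Im_lin -[X in _ + X]mul1r.
  have := sq_integrable_comb 1 1 (sq_integrable_comb (complex.Re a) (complex.Im a) ui ur) vi.
  by congr sq_integrable; apply/funext => x; ring.
Qed.

Lemma L2_innerE u v : L2C u -> L2C v -> L2_inner u v =
  Complex (rdot (reP u) (reP v) + rdot (imP u) (imP v))
          (rdot (imP u) (reP v) - rdot (reP u) (imP v)).
Proof.
move=> /L2CP[ur ui] /L2CP[vr vi]; rewrite /rdot -RintegralD//; try exact: sq_integrableM.
rewrite -RintegralB//; try exact: sq_integrableM.
congr Complex; apply: eq_Rintegral => p _; case: (u p) => [a b]; case: (v p) => [c e] /=; ring.
Qed.

Lemma L2_inner_lin a u v w : L2C u -> L2C v -> L2C w ->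
  L2_inner (fun p => a * u p + v p) w = a * L2_inner u w + L2_inner v w.
Proof.
move=> uL vL wL; rewrite !L2_innerE//; try exact: L2C_lin.
have [[[ur ui] [vr vi]] [wr wi]] := (proj1 (L2CP _) uL, proj1 (L2CP _) vL, proj1 (L2CP _) wL).
have rl x y z s q b1 b2 : sqI x -> sqI y -> sqI z -> sqI q ->
   (forall p, s p = b1 * x p + b2 * y p + z p) ->
   rdot s q = b1 * rdot x q + b2 * rdot y q + rdot z q.
  move=> xS yS zS qS sE; rewrite /rdot -(inner_comb _ _ xS yS)//.
  have := inner_comb 1 1 (sq_integrable_comb b1 b2 xS yS) zS qS; rewrite !mul1r => <-.
  by apply: eq_Rintegral => p _; rewrite sE; ring.
have er p := Re_lin a (u p) (v p); have ei p := Im_lin a (u p) (v p).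
rewrite (rl _ _ _ _ _ _ _ ur ui vr wr er) (rl _ _ _ _ _ _ _ ur ui vr wi er).
rewrite (rl _ _ _ _ _ _ _ ui ur vi wr ei) (rl _ _ _ _ _ _ _ ui ur vi wi ei).
by apply/eqP; rewrite eq_complex Re_lin Im_lin /=; apply/andP; split; apply/eqP; ring.
Qed.

Lemma L2_norm2E f : L2C f ->
  L2_norm2 f = \int[dth]_p (complex.Re (f p) ^+ 2) + \int[dth]_p (complex.Im (f p) ^+ 2).
Proof.
move=> /L2CP[/sq_integrableP[_ fr] /sq_integrableP[_ fi]].
by rewrite -RintegralD.
Qed.

(** Young's inequality with a free parameter t takes the place of Cauchy-Schwarz: it
suffices for continuity of the inner product and only involves integrals of
pointwise inequalities. *)
Lemma young t x y : 0 < t -> sqI x -> sqI y ->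
  `|rdot x y| <= (t * rdot y y + t^-1 * rdot x x) / 2.
Proof.
move=> t0 xS yS; have I := sq_integrableM xS yS.
have Iy := rintegrableZ (t / 2) (sq_integrableM yS yS).
have Ix := rintegrableZ (t^-1 / 2) (sq_integrableM xS xS).
have -> : (t * rdot y y + t^-1 * rdot x x) / 2 =
    \int[dth]_p (t / 2 * (y p * y p) + t^-1 / 2 * (x p * x p)).
  by rewrite RintegralD// !RintegralZl//; try exact: sq_integrableM; rewrite /rdot; lra.
apply: le_trans (le_normr_Rintegral _ _) _ => //.
apply: le_Rintegral => //; [exact: integrable_norm|exact: rintegrableD|move=> p _].
have ti : t * t^-1 = 1 by rewrite divff// gt_eqF.
have ti0 : 0 < t^-1 by rewrite invr_gt0.
have sq e : e ^+ 2 = 1 -> 0 <= t^-1 * (x p) ^+ 2 + 2 * e * (x p * y p) + t * (y p) ^+ 2.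
  move=> e2; have -> : t^-1 * (x p) ^+ 2 + 2 * e * (x p * y p) + t * (y p) ^+ 2 =
      t^-1 * (x p) ^+ 2 + 2 * e * (t * t^-1) * (x p * y p) + e ^+ 2 * (t * t^-1) * t * (y p) ^+ 2.
    by rewrite ti e2; ring.
  have := mulr_ge0 (ltW ti0) (sqr_ge0 (x p + e * t * y p)); congr (0 <= _); ring.
have := sq 1 (expr1n _ _); have := sq (-1) (etrans (sqrrN _) (expr1n _ _)).
by rewrite ler_norml !expr2 => ? ?; apply/andP; split; lra.
Qed.

Lemma L2_inner_bound t u v : 0 < t -> L2C u -> L2C v ->
  `|complex.Re (L2_inner u v)| <= (t * L2_norm2 v + t^-1 * L2_norm2 u) / 2 /\
  `|complex.Im (L2_inner u v)| <= (t * L2_norm2 v + t^-1 * L2_norm2 u) / 2.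
Proof.
move=> t0 uL vL; rewrite L2_innerE// !L2_norm2E//=.
have [[ur ui] [vr vi]] := (proj1 (L2CP _) uL, proj1 (L2CP _) vL).
have := young t0 ur vr; have := young t0 ui vi; have := young t0 ui vr; have := young t0 ur vi.
have sq x : \int[dth]_p (x p ^+ 2) = rdot x x by apply: eq_Rintegral => p _; rewrite expr2.
rewrite !sq => h1 h2 h3 h4.
split.
  by apply: le_trans (ler_normD _ _) _; lra.
by apply: le_trans (ler_normB _ _) _; lra.
Qed.

Lemma L2_inner_self_null f : L2C f -> L2_inner f f = 0 -> Defs.null_fun f.
Proof.
move=> /L2CP[fr fi]; have [[mr If] [mi Ig]] := (sq_integrableP fr, sq_integrableP fi).
have I2 := rintegrableD If Ig; have [mI Ilty] := integrableP _ _ _ I2.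
have pos p : (0 <= (complex.Re (f p) ^+ 2 + complex.Im (f p) ^+ 2)%:E)%E.
  by rewrite lee_fin addr_ge0 ?sqr_ge0.
move=> /(congr1 (@complex.Re R)) /= f0.
have : (\int[dth]_p (complex.Re (f p) ^+ 2 + complex.Im (f p) ^+ 2)%:E = 0)%E.
  rewrite -[LHS]fineK; last first.
    rewrite ge0_fin_numE; last exact: integral_ge0.
    by apply: le_lt_trans Ilty; rewrite le_eqVlt; apply/orP; left; apply/eqP;
       apply: eq_integral => p _ /=; rewrite ger0_norm// -lee_fin.
  congr EFin; rewrite -[RHS]f0; apply: eq_Rintegral => p _.
  by case: (f p) => [? ?] /=; ring.
move=> I0.
have /ae_eq_integral_abs : measurable_fun setT (fun p => (complex.Re (f p) ^+ 2 + complex.Im (f p) ^+ 2)%:E) := mI.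
move=> /(_ dth measurableT)[+ _] => /(_ _)/wrap[].
  by under eq_integral do rewrite gee0_abs//.
apply: filterS => p /(_ I)[] /eqP; rewrite paddr_eq0 ?sqr_ge0// !sqrf_eq0 => /andP[/eqP a /eqP b].
by move: a b; case: (f p) => [? ?] /= -> ->.
Qed.

End L2Complex.

(** * The half-density action *)

Section Koopman.
Variable R : realType.
Local Notation dth := (@dtheta R).
Local Notation sqI := (sq_integrable dth).
Implicit Types f u v w : circle R -> R[i].
Implicit Types g h : bijection (circle R).

Lemma koopman_Re g f p : complex.Re (koopman g f p) = complex.Re (f (g^-1%g p)) * Num.sqrt (cderive g^-1%g p).
Proof. by rewrite /koopman; case: (f _) => [a b] /=; ring. Qed.

Lemma koopman_Im g f p : complex.Im (koopman g f p) = complex.Im (f (g^-1%g p)) * Num.sqrt (cderive g^-1%g p).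
Proof. by rewrite /koopman; case: (f _) => [a b] /=; ring. Qed.

Lemma koopman_lin g (a : R[i]) u v :
  koopman g (fun p => a * u p + v p) = (fun p => a * koopman g u p + koopman g v p).
Proof. by apply/funext => p; rewrite /koopman mulrDl mulrA. Qed.

Lemma koopman1 f : koopman 1%g f = f.
Proof.
apply/funext => p; rewrite /koopman invg1 cderive_id sqrtr1.
by rewrite (_ : 1%:C%C = 1)// mulr1.
Qed.

Lemma koopman_comp g h f : circle_diffeo g^-1%g -> circle_diffeo h^-1%g ->
  koopman g (koopman h f) = koopman (g * h)%g f.
Proof.
move=> gD hD; apply/funext => p; rewrite /koopman invgM.
have -> : cderive (h^-1 * g^-1)%g p = cderive h^-1%g (g^-1%g p) * cderive g^-1%g p.
  exact: (cderive_comp p hD gD).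
by rewrite sqrtrM ?(ltW (cd_pos hD _))// -mulrA rmorphM.
Qed.

Lemma sq_integrable_koopman g (x : circle R -> R) : circle_diffeo g^-1%g -> sqI x ->
  sqI (fun p => x (g^-1%g p) * Num.sqrt (cderive g^-1%g p)) /\
  (\int[dth]_p ((x (g^-1%g p) * Num.sqrt (cderive g^-1%g p)) ^+ 2)%:E =
   \int[dth]_p (x p ^+ 2)%:E)%E.
Proof.
move=> gD [mx xlty]; have [F gF] := circle_diffeo_lift gD.
have E : (\int[dth]_p ((x (g^-1%g p) * Num.sqrt (cderive g^-1%g p)) ^+ 2)%:E =
   \int[dth]_p (x p ^+ 2)%:E)%E.
  rewrite -(circle_substitution gD (f := fun p => (x p ^+ 2)%:E)).
  - by apply: eq_integral => p _; rewrite exprMn sqr_sqrtr ?(ltW (cd_pos gD _))// EFinM.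
  - by apply/measurable_EFinP; exact: measurable_funX.
  - by move=> p; rewrite lee_fin sqr_ge0.
split=> //; split; last by rewrite E.
apply: measurable_funM.
  by apply: measurableT_comp => //; exact: measurable_diffeo gF.
by apply: measurableT_comp; [exact: measurable_sqrt|exact: measurable_cderive].
Qed.

Lemma L2C_koopman g f : circle_diffeo g^-1%g -> L2C f -> L2C (koopman g f).
Proof.
move=> gD /L2CP[fr fi]; apply/L2CP.
under eq_fun do rewrite koopman_Re; under [X in _ /\ sqI X]eq_fun do rewrite koopman_Im.
by split; [case: (sq_integrable_koopman gD fr)|case: (sq_integrable_koopman gD fi)].
Qed.

Lemma L2_norm2_koopman g f : circle_diffeo g^-1%g -> L2C f ->
  L2_norm2 (koopman g f) = L2_norm2 f.
Proof.
move=> gD fL; rewrite !L2_norm2E//; last exact: L2C_koopman.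
have [fr fi] := proj1 (L2CP _) fL; rewrite /Rintegral; congr (fine _ + fine _).
  rewrite -(proj2 (sq_integrable_koopman gD fr)); apply: eq_integral => p _; by rewrite koopman_Re.
rewrite -(proj2 (sq_integrable_koopman gD fi)); apply: eq_integral => p _; by rewrite koopman_Im.
Qed.

(** [koopman g] is isometric, so koopman g (u_n - u) tends to 0 in norm and its inner
product with w, which does not depend on n, is arbitrarily small. *)
Lemma L2_inner_koopman_cvg g (u_ : nat -> circle R -> R[i]) u w : circle_diffeo g^-1%g ->
  (forall n, L2C (u_ n)) -> L2C u -> L2C w ->
  L2_norm2 (fun p => u_ n p - u p) @[n --> \oo] --> (0 : R) ->
  (forall n, L2_inner (koopman g (u_ n)) w = 0) -> L2_inner (koopman g u) w = 0.
Proof.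
move=> gD uL_ uL wL ucv u0.
(* Written as a linear combination in order to use [L2_inner_lin]. *)
pose d n p := (-1) * u p + u_ n p.
have dL n : L2C (d n) by exact: L2C_lin.
have dE n : L2_inner (koopman g (d n)) w = - L2_inner (koopman g u) w.
  rewrite koopman_lin L2_inner_lin ?u0//; try exact: L2C_koopman.
  by rewrite addr0 mulN1r.
have N2 : 0 <= L2_norm2 w by apply: Rintegral_ge0 => p _; rewrite addr_ge0 ?sqr_ge0.
have key e : 0 < e -> exists n (t : R), 0 < t /\
    t * L2_norm2 w + t^-1 * L2_norm2 (koopman g (d n)) < e.
  move=> e0; pose t := e / 2 / (L2_norm2 w + 1).
  have w1 : 0 < L2_norm2 w + 1 by rewrite ltr_wpDl.
  have t0 : 0 < t by rewrite divr_gt0// divr_gt0.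
  have te0 : 0 < t * (e / 2) by rewrite mulr_gt0// divr_gt0.
  move/cvgrPdist_lt : ucv => /(_ _ te0)[n _ /(_ n (leqnn n))].
  rewrite sub0r normrN => nP; exists n, t; split=> //.
  rewrite L2_norm2_koopman//.
  have <- : L2_norm2 (fun p => u_ n p - u p) = L2_norm2 (d n).
    by congr L2_norm2; apply/funext => p; rewrite /d mulN1r addrC.
  have : t * L2_norm2 w < e / 2.
    have : t * (L2_norm2 w + 1) = e / 2 by rewrite divfK// gt_eqF.
    by lra.
  have : t^-1 * L2_norm2 (fun p => u_ n p - u p) < e / 2.
    rewrite mulrC ltr_pdivrMr// mulrC; exact: le_lt_trans (ler_norm _) nP.
  by lra.
have gdL n : L2C (koopman g (d n)) by exact: L2C_koopman.
have small (x : R) : (forall e : R, 0 < e -> `|x| < e) -> x = 0.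
  by move=> H; apply/eqP; rewrite -normr_le0; apply/ler_addgt0Pr => e e0; rewrite add0r ltW// H.
apply/eqP; rewrite eq_complex; apply/andP; split; apply/eqP; apply: small => e e0.
  have [n [t [t0 tP]]] := key e e0; have [+ _] := L2_inner_bound t0 (gdL n) wL.
  by rewrite dE raddfN normrN; lra.
have [n [t [t0 tP]]] := key e e0; have [_] := L2_inner_bound t0 (gdL n) wL.
by rewrite dE raddfN normrN; lra.
Qed.

End Koopman.

(** * Irreducible subspaces for a finite group *)

Section FiniteGroup.
Variable R : realType.
Local Notation dth := (@dtheta R).
Implicit Types V : set (circle R -> R[i]).

Lemma closed_subspace_sum V I (s : seq I) (c : I -> R[i]) (u : I -> circle R -> R[i]) :
  closed_subspace V -> (forall k, V (u k)) -> V (fun p => \sum_(k <- s) c k * u k p).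
Proof.
move=> [_ V0 Vl _] uV; elim: s => [|k s IH].
  by under eq_fun do rewrite big_nil; exact: V0.
by under eq_fun do rewrite big_cons; exact: Vl.
Qed.

Lemma koopman_inner_sum V I (s : seq I) (c : I -> R[i]) (u : I -> circle R -> R[i])
    (g : bijection (circle R)) w :
  closed_subspace V -> (forall k, V (u k)) -> circle_diffeo g^-1%g -> L2C w ->
  L2_inner (koopman g (fun p => \sum_(k <- s) c k * u k p)) w =
  \sum_(k <- s) c k * L2_inner (koopman g (u k)) w.
Proof.
move=> Vc uV gD wL; have [VL V0 _ _] := Vc; elim: s => [|k s IH].
  rewrite big_nil; under eq_fun do rewrite big_nil.
  have L0 : L2C (koopman g (cst 0)) by apply: L2C_koopman => //; exact: VL.
  have := L2_inner_lin (-1) L0 L0 wL.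
  rewrite mulN1r addNr; apply: etrans; congr L2_inner; apply/funext => p.
  by rewrite /koopman /cst mul0r mulr0 addr0.
rewrite big_cons -IH; under eq_fun do rewrite big_cons.
rewrite koopman_lin L2_inner_lin//; apply: L2C_koopman => //; apply: VL; first exact: uV.
exact: closed_subspace_sum.
Qed.

Variable G : groupClosed (bijection (circle R)).
Hypothesis GD : forall g : bijection (circle R), g \in G -> circle_diffeo g.

Let GDV (g : bijection (circle R)) : g \in G -> circle_diffeo g^-1%g.
Proof. by move=> gG; apply: GD; rewrite gpredV. Qed.

(** The u in V orthogonal to f under all translations form an invariant closed subspace.
It is not V, because f is not orthogonal to itself, so it consists of null
functions. *)
Lemma irreducible_cyclic V : irreducible_subspace G V ->
  exists2 f, L2C f & forall u, V u ->
    (forall g, g \in G -> L2_inner (koopman g u) f = 0) -> Defs.null_fun u.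
Proof.
move=> [[Vc Vinv] Vnn Virr]; have [VL V0 Vlin Vcl] := Vc.
have [f Vf fnn] : exists2 f, V f & ~ Defs.null_fun f.
  by apply: contrapT => H; apply: Vnn => f Vf; apply: contrapT => fn; apply: H; exists f.
exists f; first exact: VL.
pose W : set (circle R -> R[i]) :=
  [set u | V u /\ forall g, g \in G -> L2_inner (koopman g u) f = 0].
have WV : W `<=` V by move=> u [].
have WI : invariant_subspace G W.
  split; last first.
    move=> g u gG [Vu u0]; split; first exact: Vinv.
    move=> h hG; rewrite koopman_comp; [|exact: GDV|exact: GDV].
    by apply: u0; rewrite gpredM.
  split=> [u [/VL//]|||].
  - split=> // g gG.
    have := @koopman_inner_sum V nat [::] (fun=> 0) (fun=> cst 0) g f Vc (fun=> V0) (GDV gG) (VL _ Vf).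
    by under eq_fun do rewrite big_nil; rewrite big_nil.
  - move=> a u v [Vu u0] [Vv v0]; split; first exact: Vlin.
    move=> g gG; rewrite koopman_lin L2_inner_lin ?u0 ?v0 ?mulr0 ?addr0//.
    + by apply: L2C_koopman; [exact: GDV|exact: VL].
    + by apply: L2C_koopman; [exact: GDV|exact: VL].
    + exact: VL.
  - move=> u_ u uW uL ucv; split; first by apply: (Vcl u_) => // n; case: (uW n).
    move=> g gG; apply: (L2_inner_koopman_cvg (u_ := u_)) => //.
    + exact: GDV.
    + by move=> n; apply: VL; case: (uW n).
    + exact: VL.
    + by move=> n; case: (uW n) => _; exact.
case: (Virr W WI WV) => [WN u Vu u0|WE]; first by apply: WN; split.
have [_ /(_ 1%g)] : W f by rewrite WE.
rewrite koopman1 => f0; exfalso; apply: fnn; apply: L2_inner_self_null; first exact: VL.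
by apply: f0; exact: gpred1.
Qed.

Lemma arc_indicator_L2C P a b : L2C (fun p => (\1_(arc P a b) p : R)%:C%C).
Proof.
apply/L2CP; split=> /=; split.
- exact: measurable_indic (measurable_arc P a b).
- rewrite (eq_integral (fun p => (\1_(arc P a b) p : R)%:E)); last first.
    by move=> p _; rewrite indicE; case: (p \in _); rewrite ?expr1n ?expr0n.
  rewrite integral_indic//; last exact: measurable_arc.
  by rewrite setIT ltey_eq fin_num_measure//; exact: measurable_arc.
- exact: measurable_cst.
- under eq_integral do rewrite expr0n /=.
  by rewrite integral0.
Qed.

Lemma arc_indicators_independent N (c : 'I_N.+1 -> R[i]) :
  let w k := \1_(arc (0 : circle R) (k%:R / N.+1%:R) (k.+1%:R / N.+1%:R)) in
  Defs.null_fun (fun p => \sum_k c k * (w k p : R)%:C%C) -> forall k, c k = 0.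
Proof.
move=> w [A [mA A0 sA]] k0; apply/eqP/negP => /negP ck0.
have N0 : 0 < N.+1%:R :> R by rewrite ltr0n.
have kA : arc (0 : circle R) (k0%:R / N.+1%:R) (k0.+1%:R / N.+1%:R) `<=` A.
  move=> p pA; apply: sA => /= /eqP; apply/negP.
  rewrite (bigD1 k0)//= big1 ?addr0.
    by rewrite /w indicE mem_set// mulr1.
  move=> k kk0; rewrite /w indicE memNset ?mulr0// => pk.
  move: pA pk; rewrite /arc /= !ltr_pdivrMr// !ler_pdivlMr//.
  move=> /andP[h1 h2] /andP[h3 h4]; move: kk0; rewrite neq_ltn => /orP[kk|kk].
    have : (k.+1%:R : R) <= k0%:R by rewrite ler_nat.
    by lra.
  have : (k0.+1%:R : R) <= k%:R by rewrite ler_nat.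
  by lra.
have : (dth (arc (0 : circle R) (k0%:R / N.+1%:R) (k0.+1%:R / N.+1%:R))%R <= 0)%E.
  rewrite -A0; apply: le_measure => //; rewrite inE//; exact: measurable_arc.
rewrite dtheta_arc.
- rewrite lee_fin -mulrBl -natrB// subSnn leNgt divr_gt0//.
- rewrite (@le_trans _ _ 0)// ?oppr_le0 ?pi_ge0// divr_ge0//.
- by rewrite ler_pM2r ?invr_gt0// ler_nat.
- apply: (@le_lt_trans _ _ 1); first by rewrite ler_pdivrMr// mul1r ler_nat.
  by apply: lt_le_trans (pi_ge2 R); rewrite ltr1n.
Qed.

Lemma kernel_vector (F : fieldType) N (M : 'M[F]_(N.+1, N)) :
  exists2 c : 'rV_N.+1, c *m M = 0 & c != 0.
Proof.
have : kermx M != 0.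
  rewrite -mxrank_eq0 mxrank_ker -lt0n subn_gt0; exact: rank_leq_col.
by move=> /rowV0Pn[c /sub_kermxP cM c0]; exists c.
Qed.

(** Let f_i be given by [irreducible_cyclic].  The n m numbers <e_j u_i, f_i> determine
u_i in V_i up to null functions.  So among more than n m indicators of disjoint arcs,
decomposed along the V_i, some nontrivial combination has null components, and is
therefore null. *)
Lemma finite_group_not_finite_sum m (e : 'I_m -> bijection (circle R)) :
  (forall i, e i \in G) -> (forall g, g \in G -> exists i, g = e i) ->
  ~ finite_sum_of_irreducibles G.
Proof.
move=> eG Ge [n [V [Virr _ Vsum]]].
have Vc i : closed_subspace (V i) by case: (Virr i) => -[].
have /choice[f fP] i : exists f, L2C f /\ forall u, V i u ->
    (forall g, g \in G -> L2_inner (koopman g u) f = 0) -> Defs.null_fun u.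
  by have [f fL fP] := irreducible_cyclic (Virr i); exists f.
pose N := #|{: 'I_n * 'I_m}|.
pose w (k : 'I_N.+1) (p : circle R) : R[i] :=
  (\1_(arc (0 : circle R) (k%:R / N.+1%:R) (k.+1%:R / N.+1%:R)) p : R)%:C%C.
have /choice[u uP] (k : 'I_N.+1) : exists u : 'I_n -> circle R -> R[i],
    (forall i, V i (u i)) /\ Defs.null_fun (fun p => w k p - \sum_i u i p).
  by apply: Vsum; exact: arc_indicator_L2C.
pose M := \matrix_(k < N.+1, l < N)
  L2_inner (koopman (e (enum_val l).2) (u k (enum_val l).1)) (f (enum_val l).1).
have [c cM c0] := kernel_vector M.
pose v i p := \sum_k c 0 k * u k i p.
have v0 i : Defs.null_fun (v i).
  have [fL] := fP i; apply; first by apply: closed_subspace_sum => // k; case: (uP k).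
  move=> g /Ge[j ->]; rewrite (koopman_inner_sum _ _ (Vc i))//; last 2 first.
  - by move=> k; case: (uP k).
  - exact: GDV.
  move/rowP : cM => /(_ (enum_rank (i, j))); rewrite !mxE => cM'; apply: etrans cM'.
  by apply: eq_bigr => k _; rewrite !mxE enum_rankK.
move/eqP : c0; apply; apply/rowP => k; rewrite mxE; apply: (arc_indicators_independent _ k).
have uN k' : {ae dth, forall p, w k' p - \sum_i u k' i p = 0} by case: (uP k').
have vae : {ae dth, forall p, forall i, v i p = 0} by apply: filter_forall => i; exact: v0.
have uae : {ae dth, forall p, forall k', w k' p - \sum_i u k' i p = 0}.
  by apply: filter_forall => k'; exact: uN.
apply: filterS2 vae uae => p vp up.
have -> : \sum_k c 0 k * (w k p) = \sum_k c 0 k * (w k p - \sum_i u k i p) + \sum_i v i p.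
  rewrite [X in _ + X]exchange_big -big_split /=; apply: eq_bigr => k' _.
  by rewrite mulrBr mulr_sumr subrK.
rewrite big1 ?add0r => [|k' _]; last by rewrite up mulr0.
by rewrite big1.
Qed.

End FiniteGroup.

(** * Fixed points of fractional linear maps *)

Section Mobius.
Variable R : realType.
Local Notation pi := (@pi R).
Implicit Types (A : 'M[R]_2) (m : circle R -> circle R).

Lemma det_mx2 A : \det A = A 0 0 * A 1 1 - A 0 1 * A 1 0.
Proof.
rewrite (expand_det_row _ 0) !big_ord_recl big_ord0 /cofactor !det_mx11 !mxE /=.
rewrite (_ : lift 0 0 = 1 :> 'I_2); last exact: val_inj.
rewrite (_ : lift 1 0 = 0 :> 'I_2); last exact: val_inj.
rewrite expr0 expr1; ring.
Qed.

Lemma mxtrace2 A : \tr A = A 0 0 + A 1 1.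
Proof.
rewrite /mxtrace !big_ord_recl big_ord0 addr0.
by rewrite (_ : lift 0 0 = 1 :> 'I_2); last exact: val_inj.
Qed.

Lemma mul_half_angle A s : let h := half_angle s in
  (A *m h) 0 0 = A 0 0 * cos (s / 2) + A 0 1 * sin (s / 2) /\
  (A *m h) 1 0 = A 1 0 * cos (s / 2) + A 1 1 * sin (s / 2).
Proof.
rewrite /= !mxE !big_ord_recl !big_ord0 !mxE /=.
by rewrite (_ : lift 0 0 = 1 :> 'I_2); [rewrite !addr0|exact: val_inj].
Qed.

(** s and t are the same angle exactly when the directions s / 2 and t / 2 agree modulo pi. *)
Lemma half_angle_parallel s t (k l : R) : l != 0 ->
  k * cos (t / 2) = l * cos (s / 2) -> k * sin (t / 2) = l * sin (s / 2) ->
  angle s = angle t.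
Proof.
move=> l0 ec es.
have s0 : sin (s / 2 - t / 2) = 0.
  have : l * sin (s / 2 - t / 2) = 0.
    rewrite sinB mulrBr !mulrA -es -ec; ring.
  by move/eqP; rewrite mulf_eq0 (negbTE l0) /= => /eqP.
have c1 : cos (s - t) = 1.
  have -> : s - t = (s / 2 - t / 2) *+ 2 by rewrite mulr2n; lra.
  by rewrite cos_mulr2n cos2sin2 s0 expr0n subr0 /= mulr2n addrK.
have /cos_eq1 : - pi < ang (angle (s - t)) <= pi by have := ang_itv (angle (s - t)); rewrite in_itv.
have [k' k'E] : exists k : int, ang (angle (s - t)) = s - t + 2 * pi * k%:~R.
  by apply/angle_eqP; rewrite angK.
rewrite k'E cos_periodic => /(_ c1); rewrite -k'E => /ang_eq0.
by rewrite angleB => /eqP; rewrite subr_eq0 => /eqP.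
Qed.

(** The discriminant of the characteristic polynomial is (tr A)^2 - 4 >= 0.  If the lower
left entry c is not 0, an eigenvector is (x, 1) with x a root of
c x^2 + (d - a) x - b, and it spans the direction pi / 2 - atan x. *)
Lemma fractional_linear_fixed A m : fractional_linear A m -> 2 <= `|\tr A| ->
  exists p, m p = p.
Proof.
move=> [dA mA] trA; rewrite det_mx2 in dA; rewrite mxtrace2 in trA.
set a := A 0 0 in dA trA; set b := A 0 1 in dA; set c := A 1 0 in dA; set d := A 1 1 in dA trA.
have disc : 0 <= (a + d) ^+ 2 - 4.
  by rewrite subr_ge0 -real_normK ?num_real//; nra.
have [s [l [lc ls]]] : exists s l, a * cos (s / 2) + b * sin (s / 2) = l * cos (s / 2) /\
    c * cos (s / 2) + d * sin (s / 2) = l * sin (s / 2).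
  have [c0|c0] := eqVneq c 0.
    by exists 0, a; rewrite mul0r cos0 sin0 c0; split; ring.
  pose q := Num.sqrt ((a + d) ^+ 2 - 4).
  have q2 : q ^+ 2 = (a + d) ^+ 2 - 4 by rewrite sqr_sqrtr.
  pose x := ((a - d) + q) / (2 * c).
  have xE : 2 * c * x = a - d + q by rewrite /x [LHS]mulrC divfK// mulf_neq0// gt_eqF.
  have quad : c * x ^+ 2 + (d - a) * x - b = 0.
    have : 4 * c * (c * x ^+ 2 + (d - a) * x - b) = 0.
      have -> : 4 * c * (c * x ^+ 2 + (d - a) * x - b) =
         (2 * c * x) ^+ 2 + 2 * (d - a) * (2 * c * x) - 4 * b * c by ring.
      rewrite xE.
      have -> : (a - d + q) ^+ 2 + 2 * (d - a) * (a - d + q) - 4 * b * c = q ^+ 2 - (a - d) ^+ 2 - 4 * (b * c) by ring.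
      by rewrite q2 (_ : b * c = a * d - 1); [ring|rewrite -dA; ring].
    by move/eqP; rewrite mulf_eq0 mulf_eq0 (negbTE c0) orbF (negbTE (_ : 4 != 0 :> R))//= => /eqP.
  exists (pi - 2 * atan x), (c * x + d).
  have -> : (pi - 2 * atan x) / 2 = - (atan x - pi / 2) by lra.
  rewrite cosN sinN cosBpihalf sinBpihalf opprK.
  have cn0 : cos (atan x) != 0.
    by rewrite gt_eqF// cos_gt0_pihalf// atan_gtNpi2 atan_ltpi2.
  have -> : sin (atan x) = x * cos (atan x).
    by rewrite -[X in _ = X * _](atanK x) /tan divfK.
  split; last by ring.
  apply/eqP; rewrite -subr_eq0; apply/eqP.
  transitivity (- (c * x ^+ 2 + (d - a) * x - b) * cos (atan x)); first by ring.
  by rewrite quad oppr0 mul0r.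
have l0 : l != 0.
  apply/eqP => l0; move: lc ls; rewrite l0 !mul0r => e1 e2.
  have s2 := cos2Dsin2 (s / 2).
  have : cos (s / 2) = 0.
    transitivity ((a * d - b * c) * cos (s / 2)); first by rewrite dA mul1r.
    transitivity (d * (a * cos (s / 2) + b * sin (s / 2)) - b * (c * cos (s / 2) + d * sin (s / 2))); first by ring.
    by rewrite e1 e2; ring.
  have : sin (s / 2) = 0.
    transitivity ((a * d - b * c) * sin (s / 2)); first by rewrite dA mul1r.
    transitivity (a * (c * cos (s / 2) + d * sin (s / 2)) - c * (a * cos (s / 2) + b * sin (s / 2))); first by ring.
    by rewrite e1 e2; ring.
  by move=> h1 h2; move: s2; rewrite h1 h2 expr0n /= addr0 => /eqP; rewrite eq_sym oner_eq0.
exists (angle s); pose t := ang (m (angle s)).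
have mt : m (angle s) = angle t by rewrite angK.
have [k kE] := mA _ _ mt; rewrite mt; symmetry.
have [e0 e1] := mul_half_angle A s; apply: (@half_angle_parallel s t k l l0).
  by rewrite -lc -/a -e0 kE !mxE.
by rewrite -ls -e1 kE !mxE.
Qed.

(** The directions 0, pi / 2 and pi / 4 are eigenvectors, so A is scalar. *)
Lemma fractional_linear_id A : fractional_linear A id -> A = 1%:M \/ A = - 1%:M.
Proof.
move=> [dA mA]; rewrite det_mx2 in dA.
have [k0 /matrixP k0E] := mA 0 0 erefl.
have [k1 /matrixP k1E] := mA pi pi erefl.
have [k2 /matrixP k2E] := mA (pi / 2) (pi / 2) erefl.
have [a0 a1] := mul_half_angle A 0; have [b0 b1] := mul_half_angle A pi.
have [c0 c1] := mul_half_angle A (pi / 2).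
move: (k0E 1 0) (k1E 0 0) (k2E 0 0) (k2E 1 0); rewrite a1 b0 c0 c1 !mxE /=.
rewrite mul0r cos0 sin0 sin_pihalf cos_pihalf => A10 A01.
have {}A10 : A 1 0 = 0 by lra.
have {}A01 : A 0 1 = 0 by lra.
rewrite A10 A01.
have q0 : 0 < pi / 2 / 2 by rewrite !divr_gt0// pi_gt0.
have sc : sin (pi / 2 / 2) = cos (pi / 2 / 2).
  by rewrite -cosBpihalf -cosN; congr cos; lra.
have cn0 : cos (pi / 2 / 2) != 0.
  by rewrite gt_eqF// cos_gt0_pihalf//; apply/andP; split; lra.
rewrite sc !mul0r addr0 add0r => /(mulIf cn0) A00 /(mulIf cn0) A11.
have a2 : A 0 0 ^+ 2 = 1 by rewrite -dA A01 A11 -A00; ring.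
have E (x : R) : A 0 0 = x -> A = x%:M.
  move=> Ax; apply/matrixP => i j; rewrite mxE.
  have o2 (l : 'I_2) : l = 0 \/ l = 1.
    by case: l => -[|[|//]] ?; [left|right]; exact: val_inj.
  have [->|->] := o2 i; have [->|->] := o2 j => /=; rewrite ?mulr1n ?mulr0n//.
  by rewrite A11 -A00.
move/eqP : a2; rewrite sqrf_eq1 => /orP[/eqP|/eqP] /E ->; [left|right] => //.
by apply/matrixP => i j; rewrite !mxE mulNrn.
Qed.
End Mobius.

(** * The theorem *)

Theorem theorem1p7 (R : realType) (alpha : R) (halpha : 1 / 2 < alpha)
    (G : groupClosed (bijection (circle R)))
    (hG : forall g, g \in G -> Diff1 alpha g) :
  (irreducible_subspace G (@L2C R) \/ finite_sum_of_irreducibles G) \/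
  (exists2 g, g \in G & exists2 h, Diff1 alpha h & hyperbolic (h * g * h^-1)%g) \/
  (exists2 g, g \in G & exists2 h, Diff1 alpha h & parabolic (h * g * h^-1)%g) \/
  ereal_sup [set (\int[@dtheta R \x @dtheta R]_z ((distortion g z) ^+ 2)%:E)%E
            | g in [set g | g \in G]] = +oo%E ->
  ~ kazhdan R (subgroup_of G).
Proof.
move=> cases kG; have a12 : 1 / 2 < alpha := halpha.
have [M MP] := kazhdan_distortion_bounded a12 hG kG.
have free g p : g \in G -> g p = p -> g = 1%g.
  exact: (fixed_point_trivial a12 hG MP).
(* The conjugate has a fixed point, hence so has g, and g = 1 by freeness. *)
have conj1 (g h : bijection (circle R)) A : g \in G ->
    fractional_linear A (h * g * h^-1)%g -> 2 <= `|\tr A| -> A = 1%:M \/ A = - 1%:M.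
  move=> gG Am trA; have [p pfix] := fractional_linear_fixed Am trA.
  have g1 : g = 1%g.
    by apply: (free g (h^-1%g p)) => //; apply: (can_inj (bij_funK h)); rewrite [RHS]bij_invK.
  apply: fractional_linear_id; rewrite g1 mulg1 in Am.
  by rewrite (_ : id = (h * h^-1)%g)// mulgV.
case: cases => [irr|[[g gG [h _ [A Am trA]]]|[[g gG [h _ [A Am [trA A1 AN1]]]]|sup]]].
- have [m [e [eG Ge]]] := kazhdan_finite a12 hG free kG.
  have GD (g : bijection (circle R)) : g \in G -> circle_diffeo g.
    exact: group_diffeo a12 hG g.
  apply: (finite_group_not_finite_sum GD eG Ge); case: irr => // irr.
  exists 1, (fun=> @L2C R); split=> // [i j|f fL]; first by rewrite !ord1 eqxx.
  exists (fun=> f); split=> //.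
  by apply: aeW => p; rewrite big_ord1 subrr.
- have tr1 : `|\tr (1%:M : 'M[R]_2)| = 2 by rewrite mxtrace1 normr_nat.
  have [AE|AE] := conj1 g h A gG Am (ltW trA); move: trA; rewrite AE.
    by rewrite tr1 ltxx.
  by rewrite raddfN normrN tr1 ltxx.
- have tr2 : 2 <= `|\tr A| by rewrite trA.
  have [AE|AE] := conj1 g h A gG Am tr2; first by rewrite AE eqxx in A1.
  by rewrite AE eqxx in AN1.
- suff : (ereal_sup [set (\int[@dtheta R \x @dtheta R]_z ((distortion g z) ^+ 2)%:E)%E
      | g in [set g | g \in G]] <= M%:E)%E by rewrite sup.
  by apply: ge_ereal_sup => _ [g gG <-]; exact: MP.
Qed.
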